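(* Let $\Omega\subset\mathbb{R}^n$ be a bounded Lipschitz domain and $\Omega^\ast\subset\mathbb{R}^n$ an open Lipschitz domain with $\Omega\Subset\Omega^\ast$. Let $f\in W^{-1,\infty}(\Omega)\cap L^2(\Omega)$ with $\|f\|_{W^{-1,\infty}}\le1$ and $u_o\in W^{1,1}(\Omega^\ast)\cap L^2(\Omega^\ast)$. Then $$\inf_{u\in \mathrm{BV}_{u_o}(\Omega)\cap L^2(\Omega^\ast)}\bigg(\|Du\|(\overline\Omega)+\int_\Omega f(u-u_o)\,dx\bigg)=\max_{z\in S^\infty_f(\Omega)}\int_\Omega z\cdot\nabla u_o\,dx,$$ where $S^\infty_f(\Omega)=\{z\in L^\infty(\Omega,\mathbb{R}^n):\ \|z\|_{L^\infty}\le1\ \text{and}\ \operatorname{div}z=f\}$ (divergence in the sense of distributions in $\Omega$). In particular the maximum on the right-hand side is attained.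
   Context: $\mathrm{BV}(\Omega^\ast)$ is the space of $u\in L^1(\Omega^\ast)$ whose distributional derivative $Du$ is a finite $\mathbb{R}^n$-valued Radon measure on $\Omega^\ast$; $\|Du\|$ is the total variation measure of $Du$. $\mathrm{BV}_{u_o}(\Omega)=\{u\in\mathrm{BV}(\Omega^\ast): u=u_o\text{ a.e. in }\Omega^\ast\setminus\Omega\}$. $W^{-1,\infty}(\Omega)=[W^{1,1}_0(\Omega)]'$, where $W_0^{1,1}(\Omega)$ carries the norm $\|\nabla\varphi\|_{L^1(\Omega)}$; thus for $f\in L^2(\Omega)$, the condition $f\in W^{-1,\infty}(\Omega)$ with $\|f\|_{W^{-1,\infty}}\le1$ means $|\int_\Omega f\varphi\,dx|\le\|\nabla\varphi\|_{L^1(\Omega)}$ for all $\varphi\in C_0^\infty(\Omega)$. *)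

(* Defs.v *)
From HB Require Import structures.
From mathcomp Require Import all_boot all_order all_algebra.
From mathcomp Require Import all_classical all_reals all_analysis.
From mathcomp Require Import measurable_realfun.

Set Implicit Arguments.
Unset Strict Implicit.
Unset Printing Implicit Defensive.

Import Order.TTheory GRing.Theory Num.Theory.
Import numFieldNormedType.Exports.

Local Open Scope classical_set_scope.
Local Open Scope ring_scope.

(** Borel sigma-algebra on matrices, hence on [R^n := 'rV[R]_n]. *)
Definition mx_borel_display : measure_display. Proof. exact. Qed.

Section mx_borel.
Context {R : realType} {m n : nat}.

Definition mx_borel : set (set 'M[R]_(m, n)) := <<s (@open 'M[R]_(m, n)) >>.

Let mx_borel0 : mx_borel set0. Proof. exact: sigma_algebra0. Qed.

Let mx_borelC A : mx_borel A -> mx_borel (~` A).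
Proof. exact: sigma_algebraC. Qed.

Let mx_borel_bigcup (F : (set 'M[R]_(m, n))^nat) :
  (forall i, mx_borel (F i)) -> mx_borel (\bigcup_i F i).
Proof. exact: sigma_algebra_bigcup. Qed.

HB.instance Definition _ := @isMeasurable.Build mx_borel_display
  'M[R]_(m, n) mx_borel mx_borel0 mx_borelC mx_borel_bigcup.

Lemma mx_open_measurable (A : set 'M[R]_(m, n)) : open A -> measurable A.
Proof. by move=> oA; exact: sub_sigma_algebra. Qed.

End mx_borel.

(** [pushforward], with the measurability of the map carried by its type so
    that the result is canonically a measure. *)
Section pushforward_mfun.
Context d d' {T : measurableType d} {T' : measurableType d'} {R : realType}.
Variables (mu : {measure set T -> \bar R}) (h : {mfun T >-> T'}).

Definition pushforward_mfun : set T' -> \bar R := pushforward mu h.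

Let pushforward_mfun0 : pushforward_mfun set0 = 0%E.
Proof. exact: measure0. Qed.

Let pushforward_mfun_ge0 A : (0 <= pushforward_mfun A)%E.
Proof. exact: measure_ge0. Qed.

Let pushforward_mfun_sigma_additive : semi_sigma_additive pushforward_mfun.
Proof. exact: measure_semi_sigma_additive. Qed.

HB.instance Definition _ := isMeasure.Build _ _ _ pushforward_mfun
  pushforward_mfun0 pushforward_mfun_ge0 pushforward_mfun_sigma_additive.

End pushforward_mfun.

Section lebesgue_rV.
Context {R : realType}.

Definition cons_pair n (p : n.-tuple (measurableTypeR R) * measurableTypeR R)
  : n.+1.-tuple (measurableTypeR R) := [tuple of p.2 :: p.1].

Lemma measurable_cons_pair n : measurable_fun setT (@cons_pair n).
Proof. exact: measurable_cons. Qed.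

HB.instance Definition _ n := isMeasurableFun.Build _ _ _ _ (@cons_pair n)
  (@measurable_cons_pair n).

Definition rV_of_tuple n (t : n.-tuple (measurableTypeR R)) : 'rV[R]_n :=
  \row_i tnth t i.

Lemma measurable_rV_of_tuple n : measurable_fun setT (@rV_of_tuple n).
Proof.
apply: (@measurability _ _ _ _ setT (@rV_of_tuple n) (@open 'rV[R]_n)) => //.
move=> _ [A oA <-]; rewrite setTI.
pose box (q : 'rV[rat]_n) (k : nat) : set (n.-tuple (measurableTypeR R)) :=
  \big[setI/setT]_(i < n) ((@tnth n _)^~ i @^-1` (ball (ratr (q 0 i) : R) k.+1%:R^-1)).
have mbox q k : measurable (box q k).
  apply: bigsetI_measurable => i _; rewrite -[X in measurable X]setTI.
  apply: measurable_tnth => //.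
  by apply: open_measurable; exact: ball_open.
have boxE q k t : box q k t <->
    forall i, ball (ratr (q 0 i) : R) k.+1%:R^-1 (tnth t i).
  rewrite /box -bigcap_seq; split=> [tb i|tb i _]; last exact: tb.
  by apply: tb; rewrite /= mem_index_enum.
pose P (p : 'rV[rat]_n * nat) := box p.1 p.2 `<=` @rV_of_tuple n @^-1` A.
rewrite (_ : _ @^-1` A = \bigcup_p (if `[< P p >] then box p.1 p.2 else set0)).
  apply: countable_bigcupT_measurable => // p.
  by case: ifPn.
apply/seteqP; split=> [t At|t [p _]]; last by case: ifPn => // /asboolP; apply.
have /nbhs_ballP[e /= e0 eA] := open_nbhs_nbhs (conj oA At).
have [k ke] : exists k, k.+1%:R^-1 < e / 2 :> R.
  have [k _ /(_ k (leqnn k))] := near_infty_natSinv_lt (PosNum (divr_gt0 e0 (ltr0Sn R 1))).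
  by exists k.
have k0 : 0 < k.+1%:R^-1 :> R by [].
have /choice[q qt] i : exists q : rat, ball (tnth t i : R) k.+1%:R^-1 (ratr q).
  have := @dense_rat R (ball (tnth t i : R) k.+1%:R^-1).
  case=> [||y [ty [q _ qy]]].
  - by exists (tnth t i); exact: ballxx.
  - exact: ball_open.
  - by exists q; rewrite qy.
exists (\row_i q i, k) => //.
rewrite asboolT; first by apply/boxE => i /=; rewrite mxE; exact/ball_sym.
move=> s /boxE /= sq; apply: eA; split=> // i j; rewrite !mxE.
apply: (@le_ball _ _ _ (k.+1%:R^-1 + k.+1%:R^-1)).
  by rewrite (splitr e) lerD// ltW.
by apply: (ball_triangle (qt j)); have := sq j; rewrite mxE.
Qed.

HB.instance Definition _ n := isMeasurableFun.Build _ _ _ _ (@rV_of_tuple n)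
  (@measurable_rV_of_tuple n).

Fixpoint tuple_lebesgue n : {measure set (n.-tuple (measurableTypeR R)) -> \bar R} :=
  if n is n'.+1
  then pushforward_mfun (tuple_lebesgue n' \x lebesgue_measure)%E (@cons_pair n')
  else dirac ([tuple of [::]] : 0.-tuple (measurableTypeR R)).

(** Lebesgue measure on [R^n]. *)
Definition lebesgue_rV n : {measure set 'rV[R]_n -> \bar R} :=
  pushforward_mfun (tuple_lebesgue n) (@rV_of_tuple n).

Lemma tuple_lebesgue_box n (A : 'I_n -> set (measurableTypeR R)) :
  (forall i, measurable (A i)) ->
  tuple_lebesgue n [set t | forall i, A i (tnth t i)] =
  (\prod_(i < n) lebesgue_measure (A i))%E.
Proof.
elim: n A => [|n IHn] A mA.
  by rewrite big_ord0 /= /dirac indicE mem_set//= => -[].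
have mB : measurable [set t : n.-tuple (measurableTypeR R) |
    forall i, A (lift ord0 i) (tnth t i)].
  rewrite (_ : mkset _ = \big[setI/setT]_(i < n)
      ((@tnth n _)^~ i @^-1` A (lift ord0 i))).
    apply: bigsetI_measurable => i _; rewrite -[X in measurable X]setTI.
    exact: measurable_tnth.
  rewrite -bigcap_seq; apply/seteqP; split=> [t tA i _|t tA i]; first exact: tA.
  by apply: tA; rewrite /= mem_index_enum.
rewrite big_ord_recl muleC -IHn//= /pushforward_mfun /pushforward.
rewrite -product_measure1E//; congr (_ _); apply/seteqP; split=> -[t x] /=.
  by move=> tA; split=> [i|]; [have := tA (lift ord0 i); rewrite tnthS|exact: tA ord0].
by move=> [tA xA] i; case: (unliftP ord0 i) => [j|] ->; rewrite ?tnthS.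
Qed.

Lemma lebesgue_rV_box n (A : 'I_n -> set (measurableTypeR R)) :
  (forall i, measurable (A i)) ->
  lebesgue_rV n [set v | forall i, A i (v 0 i)] =
  (\prod_(i < n) lebesgue_measure (A i))%E.
Proof.
move=> mA; rewrite -tuple_lebesgue_box// /lebesgue_rV /= /pushforward_mfun.
congr (tuple_lebesgue n _); apply/seteqP; split=> t /= tA i; have := tA i.
- by rewrite mxE.
- by rewrite mxE.
Qed.

End lebesgue_rV.

Section euclidean.
Context {R : realType} {n : nat}.
Implicit Types v w : 'rV[R]_n.

Definition dot v w : R := \sum_(i < n) v 0 i * w 0 i.

(** The library's norm on ['rV[R]_n] is the sup norm: it gives the same
    topology and bounded sets, but lengths have to be measured with [enorm]. *)
Definition enorm v : R := Num.sqrt (dot v v).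

End euclidean.

Section domains.
Context {R : realType} {n : nat}.
Implicit Types D : set 'rV[R]_n.

(** Near each boundary point, in rotated coordinates [y *m Q], [D] is the
    strict epigraph of a Lipschitz function of all coordinates but one. *)
Definition lipschitz_boundary D : Prop :=
  forall x, closure D x -> ~ D x ->
  exists (Q : 'M[R]_n) (i : 'I_n) (gamma : 'rV[R]_n.-1 -> R),
    [/\ Q *m Q^T = 1%:M, lipschitz gamma &
        \forall y \near x, D y <-> gamma (col' i (y *m Q)) < (y *m Q) 0 i].

Definition lipschitz_domain D : Prop :=
  [/\ open D, connected D, D !=set0 & lipschitz_boundary D].

End domains.

Section test_functions.
Context {R : realType} {n : nat}.
Implicit Types (D : set 'rV[R]_n) (phi : 'rV[R]_n -> R).

Definition partial (i : 'I_n) phi : 'rV[R]_n -> R :=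
  fun x => 'D_(delta_mx 0 i) phi x.

Definition grad phi : 'rV[R]_n -> 'rV[R]_n := fun x => \row_i partial i phi x.

Definition iter_partial (s : seq 'I_n) phi : 'rV[R]_n -> R :=
  foldr partial phi s.

Definition smooth phi : Prop := forall s : seq 'I_n,
  continuous (iter_partial s phi) /\
  forall (i : 'I_n) x, derivable (iter_partial s phi) x (delta_mx 0 i).

(** [C_0^oo(D)], each function being extended by zero to the whole space. *)
Definition test_function D phi : Prop :=
  let supp := closure [set x | phi x != 0] in
  [/\ smooth phi, compact supp & supp `<=` D].

End test_functions.

Section function_spaces.
Context {R : realType} {n : nat}.
Implicit Types (D : set 'rV[R]_n) (u f : 'rV[R]_n -> R)
  (g z : 'rV[R]_n -> 'rV[R]_n).
Local Notation leb := (@lebesgue_rV R n).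

(** Membership in spaces of functions on [D] only depends on the restriction
    of the function to [D]. *)
Definition in_L1 D u : Prop := leb.-integrable D (EFin \o u).

Definition in_L2 D u : Prop :=
  measurable_fun D u /\ leb.-integrable D (fun x => (u x ^+ 2)%:E).

(** [u] belongs to [W^{1,1}(D)], with weak gradient [g]. *)
Definition in_W11 D u g : Prop :=
  [/\ in_L1 D u,
      forall i, in_L1 D (fun x => g x 0 i) &
      forall phi, test_function D phi -> forall i : 'I_n,
        \int[leb]_(x in D) (u x * partial i phi x) =
        - \int[leb]_(x in D) (g x 0 i * phi x)].

(** [f] belongs to [W^{-1,oo}(D)], with norm at most [1]. *)
Definition in_Wdual_ball D f : Prop :=
  forall phi, test_function D phi ->
    `| \int[leb]_(x in D) (f x * phi x) | <=
    \int[leb]_(x in D) enorm (grad phi x).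

(** [z] belongs to [L^oo(D, R^n)], with norm at most [1]. *)
Definition in_Linfty_ball D z : Prop :=
  (forall i, measurable_fun D (fun x => z x 0 i)) /\
  {ae leb, forall x, D x -> enorm (z x) <= 1}.

Definition distributional_div D z f : Prop :=
  forall phi, test_function D phi ->
    \int[leb]_(x in D) dot (z x) (grad phi x) =
    - \int[leb]_(x in D) (f x * phi x).

(** [S^oo_f(D)] *)
Definition S_infty D f : set ('rV[R]_n -> 'rV[R]_n) :=
  [set z | in_Linfty_ball D z /\ distributional_div D z f].

End function_spaces.

Section signed_integral.
Context d {T : measurableType d} {R : realType}.
Variable nu : {charge set T -> \bar R}.

Lemma hahn_pair : {PN | hahn_decomposition nu PN.1 PN.2}.
Proof.
by apply: cid; have [P [N PN]] := Hahn_decomposition nu; exists (P, N).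
Qed.

(** Integral against a finite signed measure, through its Jordan
    decomposition (which does not depend on the chosen Hahn decomposition). *)
Definition charge_Rintegral (D : set T) (phi : T -> R) : R :=
  \int[jordan_pos (svalP hahn_pair)]_(x in D) phi x -
  \int[jordan_neg (svalP hahn_pair)]_(x in D) phi x.

End signed_integral.

Section BV.
Context {R : realType} {n : nat}.
Implicit Types (D A : set 'rV[R]_n) (u : 'rV[R]_n -> R)
  (nu : 'I_n -> {charge set 'rV[R]_n -> \bar R}).
Local Notation leb := (@lebesgue_rV R n).

(** An [R^n]-valued finite measure is given by its [n] component charges,
    which are finite by definition. *)
Definition vmeasure nu A : 'rV[R]_n := \row_i fine (nu i A).

(** Total variation measure: supremum over countable Borel partitions of [A]. *)
Definition vmeasure_variation nu A : \bar R :=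
  ereal_sup [set (\sum_(k <oo) (enorm (vmeasure nu (E k)))%:E)%E |
    E in [set E : (set 'rV[R]_n)^nat |
      [/\ forall k, measurable (E k), trivIset setT E & \bigcup_k E k = A]]].

(** [u] belongs to [BV(D)] and [Du = nu]. A measure on [D] is represented by a
    measure on the whole space of which only the restriction to [D] matters. *)
Definition in_BV D u nu : Prop :=
  in_L1 D u /\
  forall phi, test_function D phi -> forall i : 'I_n,
    \int[leb]_(x in D) (u x * partial i phi x) =
    - charge_Rintegral (nu i) D phi.

(** [u] belongs to [BV_{u0}(D)], where functions are defined on [Ds], and
    [Du = nu]. *)
Definition in_BV_dirichlet D Ds u0 u nu : Prop :=
  in_BV Ds u nu /\ {ae leb, forall x, (Ds `\` D) x -> u x = u0 x}.

End BV.

(* Main.v *)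
Require Import Defs.
From HB Require Import structures.
From mathcomp Require Import all_boot all_order all_algebra.
From mathcomp Require Import all_classical all_reals all_analysis.
From mathcomp Require Import measurable_realfun ring lra.

Set Implicit Arguments.
Unset Strict Implicit.
Unset Printing Implicit Defensive.

Import Order.TTheory GRing.Theory Num.Theory.
Import numFieldNormedType.Exports.

Local Open Scope classical_set_scope.
Local Open Scope ring_scope.

(** The proof compares the two sides through a duality argument.

    Weak duality ([weak_duality]): every admissible field [z] gives at most the
    value of every competitor [u]. Formally one integrates by parts, since
    [u - u0] vanishes outside [Omega]: the integral of [z] against [grad u0]
    is the integral of [z] against [Du] plus that of [f] against [u - u0], and
    the former is at most the variation of [Du] on [closure Omega]. But [z] is
    only defined almost everywhere, so it cannot be integrated against the
    measure [Du]. Mollifying [u] instead would lose control of the variation at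
    the boundary, so it is [z] that is mollified ([regularized_field]). It is
    extended by zero, cut by a smooth partition of unity into small pieces, and
    each piece is first pushed slightly out of [Omega], along a direction along
    which [Omega] contains a cone of fixed shape ([lipschitz_inner_cone]): the
    mollified piece then sees, at points of [Omega], only the divergence of [z]
    inside [Omega] and not its jump across the boundary. The resulting smooth
    fields have compact support in [Omegas] and norm at most [1 + eps]; their
    divergence converges to [f] against [u - u0], and they converge to [z]
    against [grad u0]. Both convergences come from the continuity of
    translations in the mean ([corr_tc_bounded], [corr_tc_L2]). A smooth field
    of norm at most [1 + eps] integrates against [Du] to at most [1 + eps] times
    the variation ([charge_integral_le_variation]), and what the supports see of
    [Du] outside [closure Omega] is negligible.

    Strong duality: let [relaxed g] be the infimum, over test functions [phi] of
    [Omega], of the integral of the norm of [g + grad phi] plus that of [f]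
    times [phi]. The hypothesis on [f] makes it finite, and it is a sublinear
    functional of the integrable field [g]. The Hahn-Banach theorem gives a
    linear functional below [relaxed] that agrees with it at [grad u0]
    ([hahn_banach]). This functional is bounded by the norm of [L^1], so it is
    the integral against a field [z] with values in the unit ball ([L1_dual],
    [field_dual_norm]); being below [relaxed] at the gradients of test functions
    and of their opposites forces the divergence of [z] to be [f]
    ([dual_maximizer]). So the value of [z] is [relaxed (grad u0)].

    Finally, each [u0 + phi] is a competitor of the primal problem. Its
    derivative is absolutely continuous and the boundary of [Omega] is a null
    set ([boundary_null]), so its energy is the one in the definition of
    [relaxed], and the infimum of the primal problem is at most
    [relaxed (grad u0)] ([smooth_competitor]). By weak duality it is also at
    least the value of every admissible field, which closes the circle. *)

(** * Lebesgue measure on R^n *)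

Section rV_measurability.
Context {R : realType}.

Lemma rV_continuous_measurable m n (g : 'rV[R]_m -> 'rV[R]_n) :
  continuous g -> measurable_fun setT g.
Proof.
move=> /continuousP cg.
apply: (@measurability _ _ _ _ setT g (@open 'rV[R]_n)) => //.
by move=> _ [A oA <-]; rewrite setTI; apply: mx_open_measurable; exact: cg.
Qed.

Lemma closure_measurable n (D : set 'rV[R]_n) : measurable (closure D).
Proof.
rewrite -[closure D]setCK; apply: measurableC; apply: mx_open_measurable.
exact/closed_openC/closed_closure.
Qed.

Lemma continuous_measurable n (g : 'rV[R]_n -> R) :
  continuous g -> measurable_fun setT g.
Proof.
move=> /continuousP cg; apply: (measurability _ (RGenOpens.measurableE R)) => //.
by move=> _ [_ [a [b -> <-]]]; rewrite setTI; apply: mx_open_measurable;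
  apply: cg; exact: interval_open.
Qed.

Lemma measurable_coord n (i : 'I_n) :
  measurable_fun setT (fun v : 'rV[R]_n => v 0 i).
Proof. by apply: continuous_measurable => x; exact: coord_continuous. Qed.

Lemma measurable_fun_rVP d (T : measurableType d) n (g : T -> 'rV[R]_n) :
  measurable_fun setT g <-> forall i, measurable_fun setT (fun x => g x 0 i).
Proof.
split=> [mg i|mg].
  exact: (measurableT_comp (@measurable_coord _ i) mg).
rewrite (_ : g = @rV_of_tuple R n \o (fun x => [tuple g x 0 i | i < n])).
  apply: measurableT_comp; first exact: measurable_rV_of_tuple.
  apply/measurable_fun_tnthP => i /=.
  rewrite (_ : _ \o _ = fun x => g x 0 i); first exact: mg.
  by apply/funext => x /=; rewrite tnth_mktuple.
by apply/funext => x; apply/rowP => i; rewrite mxE tnth_mktuple.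
Qed.

Lemma measurable_rV_addr n (h : 'rV[R]_n) :
  measurable_fun setT (fun x : 'rV[R]_n => x + h).
Proof.
apply: rV_continuous_measurable => x.
exact: (@cvgD R 'rV[R]_n 'rV[R]_n (nbhs x) (nbhs_filter x) (fun x => x)
  (fun=> h) x h (@cvg_id _ _) (@cvg_cst _ _ _ _ _)).
Qed.

Lemma measurable_rV_add d (T : measurableType d) n (g h : T -> 'rV[R]_n) :
  measurable_fun setT g -> measurable_fun setT h ->
  measurable_fun setT (fun x => g x + h x).
Proof.
move=> /measurable_fun_rVP mg /measurable_fun_rVP mh; apply/measurable_fun_rVP => i.
rewrite (_ : (fun _ => _) = (fun x => g x 0 i + h x 0 i)).
  exact: measurable_funD.
by apply/funext => x; rewrite mxE.
Qed.

Lemma measurable_rV_opp d (T : measurableType d) n (g : T -> 'rV[R]_n) :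
  measurable_fun setT g -> measurable_fun setT (fun x => - g x).
Proof.
move=> /measurable_fun_rVP mg; apply/measurable_fun_rVP => i.
rewrite (_ : (fun _ => _) = (fun x => - g x 0 i)).
  exact: measurableT_comp.
by apply/funext => x; rewrite mxE.
Qed.

End rV_measurability.

Section lebesgue_rV_theory.
Context {R : realType} {n : nat}.
Local Notation leb := (@lebesgue_rV R n).
Implicit Types a b h v : 'rV[R]_n.

Definition box a b : set 'rV[R]_n := [set v | forall i, v 0 i \in `]a 0 i, b 0 i[].

Lemma normr_coord_le v (i : 'I_n) : `|v 0 i| <= `|v|.
Proof.
rewrite [leRHS]/Num.Def.normr/= mx_normrE.
by apply/bigmax_geP; right => /=; exists (0, i).
Qed.

Lemma ball_box a r : 0 < r ->
  ball a r = box (a - const_mx r) (a + const_mx r).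
Proof.
move=> r0; apply/seteqP; split => v.
  move=> [_ /(_ ord0)] av i; have := av i.
  by rewrite /ball/= !mxE ltr_distlC in_itv.
move=> av; split => // i j; have := av j.
by rewrite (ord1 i) /ball/= !mxE ltr_distlC in_itv.
Qed.

Lemma box_open a b : open (box a b).
Proof.
rewrite (_ : box a b = \bigcap_(i in [set` enum 'I_n])
    ((fun v : 'rV[R]_n => v 0 i) @^-1` `]a 0 i, b 0 i[%classic)).
  rewrite bigcap_seq; elim/big_ind: _ => //.
  - exact: openT.
  - by move=> ? ? ? ?; exact: openI.
  - move=> i _; apply: open_comp; last exact: interval_open.
    by move=> x _; exact: coord_continuous.
apply/seteqP; split=> [v vab i _|v vab i]; first exact: vab.
by apply: vab => /=; rewrite mem_enum.
Qed.

Lemma box_measurable a b : measurable (box a b).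
Proof. by apply: mx_open_measurable; exact: box_open. Qed.

Lemma lebesgue_box a b :
  leb (box a b) = (\prod_(i < n) lebesgue_measure (`]a 0 i, b 0 i[%classic : set R)%R)%E.
Proof.
rewrite -(@lebesgue_rV_box R n (fun i => `]a 0 i, b 0 i[%classic)) //.
Qed.

Definition boxes : set (set 'rV[R]_n) := [set box p.1 p.2 | p in setT].

(** Boxes are a pi-system whose measure is an explicit product, so that
    comparing measures on boxes is enough. *)
Lemma measurable_boxes : measurable = <<s boxes >>.
Proof.
apply/seteqP; split; last first.
  apply: smallest_sub; first exact: sigma_algebra_measurable.
  by move=> _ [p _ <-]; exact: box_measurable.
apply: smallest_sub; first exact: smallest_sigma_algebra.
move=> A oA.
pose rbox (p : 'rV[rat]_n * 'rV[rat]_n) :=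
  box (map_mx ratr p.1) (map_mx ratr p.2).
rewrite (_ : A = \bigcup_p (if `[< rbox p `<=` A >] then rbox p else set0)).
  apply: (@countable_bigcupT_measurable _ (g_sigma_algebraType boxes)) => // p.
  case: ifPn => _; last exact: measurable0.
  by apply: sub_sigma_algebra; exists (map_mx ratr p.1, map_mx ratr p.2).
apply/seteqP; split=> [v Av|v [p _]]; last by case: ifPn => // /asboolP; apply.
have /nbhs_ballP[e /= e0 eA] := open_nbhs_nbhs (conj oA Av).
have rat_between (x y : R) : x < y -> exists q : rat, x < ratr q < y.
  move=> xy; have [q] := rat_in_itvoo xy.
  by rewrite in_itv; exists q.
have /choice[q qv] i : exists q : rat, v 0 i - e < ratr q < v 0 i.
  by apply: rat_between; rewrite ltrBlDr ltrDl.
have /choice[p pv] i : exists q : rat, v 0 i < ratr q < v 0 i + e.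
  by apply: rat_between; rewrite ltrDl.
exists (\row_i q i, \row_i p i) => //.
rewrite asboolT; first by move=> i; rewrite !mxE in_itv/=; have := qv i; have := pv i; lra.
apply: subset_trans eA => w wq; rewrite ball_box// => i.
have := wq i; have := qv i; have := pv i.
by rewrite /= !mxE !in_itv/=; lra.
Qed.

Lemma boxI a b a' b' : box a b `&` box a' b' =
  box (\row_i Num.max (a 0 i) (a' 0 i)) (\row_i Num.min (b 0 i) (b' 0 i)).
Proof.
apply/seteqP; split=> v.
  move=> [vab va'b'] i; have := vab i; have := va'b' i.
  by rewrite !mxE !in_itv/= gt_max lt_min => /andP[-> ->] /andP[-> ->].
move=> vm; split=> i; have := vm i; rewrite !mxE !in_itv/= gt_max lt_min.
  by move=> /andP[/andP[-> _] /andP[-> _]].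
by move=> /andP[/andP[_ ->] /andP[_ ->]].
Qed.

Lemma boxes_setI_closed : setI_closed boxes.
Proof.
move=> _ _ [[a b] _ <-] [[a' b'] _ <-]; rewrite boxI.
by eexists (_, _) => //=.
Qed.

Definition big_box (k : nat) : set 'rV[R]_n :=
  box (const_mx (- k%:R)) (const_mx k%:R).

Lemma big_box_cover : \bigcup_k big_box k = setT.
Proof.
apply/seteqP; split=> // v _.
exists (Num.bound `|v|) => // i; rewrite !mxE in_itv/= -ltr_norml.
apply: le_lt_trans (archi_boundP (normr_ge0 v)).
exact: normr_coord_le.
Qed.

Lemma lebesgue_box_lty a b : (leb (box a b) < +oo)%E.
Proof.
rewrite lebesgue_box.
suff /andP[] : (0 <= \prod_(i < n)
  lebesgue_measure (`]a 0 i, b 0 i[%classic : set R)%R < +oo)%E by [].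
elim/big_ind: _ => //.
- by rewrite ltry lee01.
- move=> x y /andP[x0 xoo] /andP[y0 yoo].
  by rewrite mule_ge0//= lte_mul_pinfty// ge0_fin_numE.
- move=> i _; rewrite measure_ge0 lebesgue_measure_itv/=.
  by case: ifP => _; rewrite ?ltry.
Qed.

Lemma lebesgue_bounded_lty (A : set 'rV[R]_n) :
  measurable A -> bounded_set A -> (leb A < +oo)%E.
Proof.
move=> mA [M [_ AM]].
apply: le_lt_trans (lebesgue_box_lty (const_mx (- (`|M| + 2))) (const_mx (`|M| + 2))).
apply: le_measure; rewrite ?inE//; first exact: box_measurable.
move=> v /(AM (`|M| + 1)) vM i; rewrite !mxE in_itv/= -ltr_norml.
apply: le_lt_trans (normr_coord_le v i) _.
apply: le_lt_trans (vM _) _; last by rewrite ltrD2l ltr1n.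
by rewrite (le_lt_trans (ler_norm M))// ltrDl.
Qed.

Lemma lebesgue_rV_sigma_finite : sigma_finite setT leb.
Proof.
exists big_box; first by rewrite big_box_cover.
by move=> k; split; [exact: box_measurable|exact: lebesgue_box_lty].
Qed.

(** A copy of [lebesgue_rV] that can carry its sigma-finiteness. *)
Definition lebesgue_rV_sf : set 'rV[R]_n -> \bar R := leb.

HB.instance Definition _ := Measure.on lebesgue_rV_sf.

HB.instance Definition _ := Measure_isSigmaFinite.Build _ _ _ lebesgue_rV_sf
  lebesgue_rV_sigma_finite.

Lemma lebesgue_tonelli (F : 'rV[R]_n * 'rV[R]_n -> \bar R) :
  measurable_fun setT F -> (forall z, 0 <= F z)%E ->
  (\int[leb]_x \int[leb]_y F (x, y) = \int[leb]_y \int[leb]_x F (x, y))%E.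
Proof. exact: (@fubini_tonelli _ _ _ _ _ lebesgue_rV_sf lebesgue_rV_sf F). Qed.

Lemma box_translate h a b :
  (fun v => v + h) @^-1` box a b = box (a - h) (b - h).
Proof.
by apply/seteqP; split=> v vab i; have := vab i;
  rewrite /= !mxE !in_itv/= ltrBlDr ltrBrDr.
Qed.

(** Both measures agree on boxes, a generating pi-system. *)
Lemma lebesgue_translate h (A : set 'rV[R]_n) : measurable A ->
  leb ((fun v => v + h) @^-1` A) = leb A.
Proof.
move=> mA.
pose tau := HB.pack_for {mfun 'rV[R]_n >-> 'rV[R]_n} (fun v : 'rV[R]_n => v + h)
  (isMeasurableFun.Build _ _ _ _ _ (measurable_rV_addr h)).
apply/esym.
apply: (@measure_unique _ _ _ boxes big_box _ _ _ _ leb (pushforward_mfun leb tau)) => //.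
- exact: measurable_boxes.
- exact: boxes_setI_closed.
- by move=> k; eexists (_, _).
- exact: big_box_cover.
- move=> _ [[a b] _ <-].
  change (leb (box a b) = leb ((fun v => v + h) @^-1` box a b)).
  rewrite box_translate !lebesgue_box.
  apply: eq_bigr => i _; rewrite !lebesgue_measure_itv/= !mxE !lte_fin.
  rewrite ltrD2r; case: ifP => // _; rewrite -!EFinD; congr EFin.
  by rewrite opprB addrA subrK.
- by move=> k; exact: lebesgue_box_lty.
Qed.

Lemma ge0_integral_translate h (g : 'rV[R]_n -> \bar R) :
  measurable_fun setT g -> (forall x, 0 <= g x)%E ->
  (\int[leb]_x g (x + h)%R = \int[leb]_x g x)%E.
Proof.
move=> mg g0.
rewrite -(@eq_measure_integral _ _ _ _ leb (pushforward leb (fun v => v + h)) g).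
- exact: measurable_rV_addr.
- by move=> mh; rewrite [RHS]ge0_integral_pushforward// => y _; exact: g0.
- by move=> mh A mA _; exact: lebesgue_translate.
Qed.

Lemma integrable_translate h (g : 'rV[R]_n -> R) :
  leb.-integrable setT (EFin \o g) ->
  leb.-integrable setT (EFin \o (fun x => g (x + h))).
Proof.
move=> /integrableP[mg goo]; apply/integrableP; split.
  by apply: (measurableT_comp mg); exact: measurable_rV_addr.
rewrite (ge0_integral_translate h (g := fun x => `|(EFin \o g) x|%E))//.
exact: measurableT_comp.
Qed.

Lemma Rintegral_translate h (g : 'rV[R]_n -> R) :
  leb.-integrable setT (EFin \o g) ->
  \int[leb]_x g (x + h) = \int[leb]_x g x.
Proof.
move=> ig; congr fine.
rewrite -(@eq_measure_integral _ _ _ _ leb (pushforward leb (fun v => v + h))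
  (EFin \o g)).
- exact: measurable_rV_addr.
- move=> mh; rewrite [RHS]integral_pushforward//; first by case/integrableP: ig.
  exact: integrable_translate.
- by move=> mh A mA _; exact: lebesgue_translate.
Qed.

End lebesgue_rV_theory.

(* Unfolding the iterated product would only slow unification down: the
   measure is used through the properties above. *)
#[global] Opaque lebesgue_rV.

(** * Continuity of translations in the mean *)

Section integral_tools.
Context d (T : measurableType d) (R : realType) (mu : {measure set T -> \bar R}).
Implicit Types (D : set T) (f g : T -> R).

Lemma measurable_set_gt f (c : R) : measurable_fun setT f ->
  measurable [set x | c < f x].
Proof.
move=> mf; have := mf measurableT `]c, +oo[%classic (measurable_itv _).
rewrite setTI (_ : _ @^-1` _ = [set x | c < f x])//.
by apply/seteqP; split=> x; rewrite /= in_itv/= andbT.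
Qed.

Lemma integrable_measurable D f : mu.-integrable D (EFin \o f) -> measurable_fun D f.
Proof. by case/integrableP => /measurable_EFinP. Qed.

Lemma normr_indic_le1 D x : `|\1_D x| <= 1 :> R.
Proof. by rewrite indicE; case: (_ \in _); rewrite ?normr1 ?normr0. Qed.

Lemma dominated_integrable D f g : measurable D -> measurable_fun D f ->
  mu.-integrable D (EFin \o g) -> (forall x, D x -> `|f x| <= g x) ->
  mu.-integrable D (EFin \o f).
Proof.
move=> mD mf ig fg; apply: le_integrable ig => //; first exact/measurable_EFinP.
move=> x Dx /=; rewrite lee_fin (le_trans (fg _ Dx))//.
exact: ler_norm.
Qed.

Lemma integrableZ_EFin D f (k : R) : measurable D ->
  mu.-integrable D (EFin \o f) -> mu.-integrable D (EFin \o (fun x => k * f x)).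
Proof.
move=> mD intf; rewrite (_ : _ \o _ = fun x => (k%:E * (f x)%:E)%E)//.
exact: integrableZl.
Qed.

Lemma integrableD_EFin D f g : measurable D ->
  mu.-integrable D (EFin \o f) -> mu.-integrable D (EFin \o g) ->
  mu.-integrable D (EFin \o (fun x => f x + g x)).
Proof.
move=> mD intf intg; rewrite (_ : _ \o _ = ((EFin \o f) \+ (EFin \o g))%E)//.
exact: integrableD.
Qed.

Lemma integrableB_EFin D f g : measurable D ->
  mu.-integrable D (EFin \o f) -> mu.-integrable D (EFin \o g) ->
  mu.-integrable D (EFin \o (fun x => f x - g x)).
Proof.
move=> mD intf intg; rewrite (_ : _ \o _ = ((EFin \o f) \- (EFin \o g))%E)//.
exact: integrableB.
Qed.

Lemma integrableM_bounded D f g (C : R) : measurable D -> mu.-integrable D (EFin \o f) ->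
  measurable_fun D g -> (forall x, D x -> `|g x| <= C) ->
  mu.-integrable D (EFin \o (fun x => f x * g x)).
Proof.
move=> mD iF mg gC; have mf := integrable_measurable iF.
have iC : mu.-integrable D (EFin \o (fun x => C * `|f x|)).
  by apply: integrableZ_EFin => //; exact: integrable_norm.
apply: (dominated_integrable mD _ iC) => [|x Dx]; first exact: measurable_funM.
by rewrite normrM mulrC ler_wpM2r ?gC.
Qed.

Lemma ge0_le_integral_EFin D f g : measurable D -> measurable_fun D f ->
  measurable_fun D g -> (forall x, D x -> 0 <= f x) ->
  (forall x, D x -> f x <= g x) ->
  (\int[mu]_(x in D) (f x)%:E <= \int[mu]_(x in D) (g x)%:E)%E.
Proof.
move=> mD mf mg f0 fg; apply: ge0_le_integral => //.
- exact/measurable_EFinP.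
- exact/measurable_EFinP.
Qed.

Lemma ge0_integralD_EFin D f g : measurable D -> measurable_fun D f ->
  measurable_fun D g -> (forall x, D x -> 0 <= f x) ->
  (forall x, D x -> 0 <= g x) ->
  (\int[mu]_(x in D) (f x + g x)%:E =
   \int[mu]_(x in D) (f x)%:E + \int[mu]_(x in D) (g x)%:E)%E.
Proof.
move=> mD mf mg f0 g0; under eq_integral do rewrite EFinD.
by apply: ge0_integralD => //; exact/measurable_EFinP.
Qed.

Lemma ge0_integralM_EFin D f (k : R) : measurable D -> measurable_fun D f ->
  (forall x, D x -> 0 <= f x) -> 0 <= k ->
  (\int[mu]_(x in D) (k * f x)%:E = k%:E * \int[mu]_(x in D) (f x)%:E)%E.
Proof.
move=> mD mf f0 k0; under eq_integral do rewrite EFinM.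
by apply: ge0_integralZl_EFin => //; exact/measurable_EFinP.
Qed.

(** Dominated convergence for sets that each point eventually leaves: the common
    source of all the truncation arguments below. *)
Lemma integral_tail_small f (E : (set T)^nat) :
  mu.-integrable setT (EFin \o f) -> (forall k, measurable (E k)) ->
  (forall x, exists k0, forall k, (k0 <= k)%N -> ~ E k x) ->
  forall e : R, 0 < e -> exists k0, forall k, (k0 <= k)%N ->
    (\int[mu]_x (`|f x| * \1_(E k) x)%:E <= e%:E)%E.
Proof.
move=> fi mE Etail e e0.
have mf : measurable_fun setT f by exact: integrable_measurable fi.
have := @dominated_cvg _ _ _ mu setT measurableT
  (fun k x => (`|f x| * \1_(E k) x)%:E) (cst 0%E) (EFin \o (fun x => `|f x|)).
rewrite integral0 => /(_ _ _ _ _ _ [set y | (y < e%:E)%E])[].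
- move=> k; apply/measurable_EFinP; apply: measurable_funM.
    exact: measurableT_comp.
  exact: measurable_indic.
- move=> x _; have [k0 xk0] := Etail x; apply: cvg_near_cst.
  exists k0 => // k /= k0k.
  by rewrite indicE memNset ?mulr0//; exact: xk0.
- by [].
- exact: integrable_norm.
- move=> k x _; rewrite lee_fin normrM normr_id ler_piMr//.
  exact: normr_indic_le1.
- by apply: open_nbhs_nbhs; split; [exact: open_ereal_lt_ereal|rewrite /= lte_fin].
- by move=> k0 _ k0P; exists k0 => k k0k; apply/ltW/k0P.
Qed.

End integral_tools.

Import HBSimple.

Section translation_continuity.
Context {R : realType} {n : nat}.
Local Notation leb := (@lebesgue_rV R n).
Implicit Types (a b : 'rV[R]_n -> R) (s h : 'rV[R]_n).

Lemma measurable_translate a h : measurable_fun setT a ->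
  measurable_fun setT (fun x : 'rV[R]_n => a (x + h)).
Proof. by move=> ma; apply: (measurableT_comp ma); exact: measurable_rV_addr. Qed.

Lemma ge0_Rintegral_translate a h : measurable_fun setT a ->
  (forall x, 0 <= a x) ->
  (\int[leb]_x (a (x + h)%R)%:E = \int[leb]_x (a x)%:E)%E.
Proof.
move=> ma a0; apply: (@ge0_integral_translate _ _ h (EFin \o a)).
  exact/measurable_EFinP.
by move=> x; rewrite lee_fin.
Qed.

Definition L1_translation_continuous a : Prop := forall e : R, 0 < e ->
  exists2 d : R, 0 < d & forall s, `|s| < d ->
    (\int[leb]_x (`|a (x + s)%R - a x|%R)%:E <= e%:E)%E.

Lemma L1tc_lin (p q : R) a b : measurable_fun setT a -> measurable_fun setT b ->
  L1_translation_continuous a -> L1_translation_continuous b ->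
  L1_translation_continuous (fun x : 'rV[R]_n => p * a x + q * b x).
Proof.
move=> ma mb ta tb e e0.
have pe : 0 < e / 2 / (`|p| + 1) by rewrite divr_gt0// ?divr_gt0// ltr_wpDl.
have qe : 0 < e / 2 / (`|q| + 1) by rewrite divr_gt0// ?divr_gt0// ltr_wpDl.
have [d1 d10 ad1] := ta _ pe; have [d2 d20 bd2] := tb _ qe.
exists (Num.min d1 d2); first by rewrite lt_min d10.
move=> s; rewrite lt_min => /andP[/ad1 as1 /bd2 bs2].
have mas : measurable_fun setT (fun x : 'rV[R]_n => `|a (x + s) - a x|).
  by apply: measurableT_comp => //; apply: measurable_funB => //; exact: measurable_translate.
have mbs : measurable_fun setT (fun x : 'rV[R]_n => `|b (x + s) - b x|).
  by apply: measurableT_comp => //; apply: measurable_funB => //; exact: measurable_translate.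
have mZ (g : 'rV[R]_n -> R) (k : R) : measurable_fun setT g -> measurable_fun setT (fun x => k * g x).
  by move=> mg; apply: measurable_funM.
apply: (@le_trans _ _ (\int[leb]_x ((`|p| + 1) * `|a (x + s)%R - a x| +
    (`|q| + 1) * `|b (x + s)%R - b x|)%R%:E)%E).
  apply: ge0_le_integral_EFin => //.
  - apply: measurableT_comp => //; apply: measurable_funB; last first.
      by apply: measurable_funD; exact: mZ.
    by apply: measurable_funD; apply: mZ; exact: measurable_translate.
  - by apply: measurable_funD; exact: mZ.
  - move=> x _; rewrite (_ : _ - _ = p * (a (x + s) - a x) + q * (b (x + s) - b x)); last by ring.
    apply: (le_trans (ler_normD _ _)); rewrite !normrM.
    by rewrite lerD// ler_wpM2r// lerDl.
rewrite ge0_integralD_EFin//; try by exact: mZ.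
rewrite !ge0_integralM_EFin//; try by rewrite addr_ge0.
apply: (@le_trans _ _ ((`|p| + 1)%:E * (e / 2 / (`|p| + 1))%:E + (`|q| + 1)%:E * (e / 2 / (`|q| + 1))%:E)%E).
  by apply: leeD; apply: lee_wpmul2l; rewrite ?lee_fin ?addr_ge0.
rewrite -!EFinM -EFinD lee_fin [(`|p| + 1) * _]mulrC [(`|q| + 1) * _]mulrC !divfK ?gt_eqF ?ltr_wpDl//.
by rewrite -splitr.
Qed.

Lemma L1tc_limit a : measurable_fun setT a ->
  (forall e : R, 0 < e -> exists b, [/\ measurable_fun setT b,
     L1_translation_continuous b & (\int[leb]_x (`|a x - b x|)%:E <= e%:E)%E]) ->
  L1_translation_continuous a.
Proof.
move=> ma alim e e0.
have e3 : 0 < e / 3 by rewrite divr_gt0.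
have [b [mb tb ab]] := alim _ e3.
have [d d0 bd] := tb _ e3.
exists d => // s /bd bs.
have mab : measurable_fun setT (fun x : 'rV[R]_n => `|a x - b x|).
  by apply: measurableT_comp => //; exact: measurable_funB.
have mabs : measurable_fun setT (fun x : 'rV[R]_n => `|a (x + s) - b (x + s)|).
  exact: (measurable_translate s mab).
have mbs : measurable_fun setT (fun x : 'rV[R]_n => `|b (x + s) - b x|).
  by apply: measurableT_comp => //; apply: measurable_funB => //; exact: measurable_translate.
apply: (@le_trans _ _ (\int[leb]_x (`|a (x + s)%R - b (x + s)%R| +
    (`|b (x + s)%R - b x| + `|a x - b x|))%R%:E)%E).
  apply: ge0_le_integral_EFin => //.
  - by apply: measurableT_comp => //; apply: measurable_funB => //; exact: measurable_translate.
  - by do 2 apply: measurable_funD => //.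
  - move=> x _.
    rewrite (_ : a (x + s) - a x = (a (x + s) - b (x + s)) + ((b (x + s) - b x) - (a x - b x))); last by ring.
    apply: (le_trans (ler_normD _ _)); rewrite lerD2l.
    exact: ler_normB.
rewrite !ge0_integralD_EFin//; last first.
  by apply: measurable_funD.
rewrite (@ge0_Rintegral_translate (fun x => `|a x - b x|))//.
apply: (@le_trans _ _ ((e / 3)%:E + ((e / 3)%:E + (e / 3)%:E))%E).
  by apply: leeD => //; exact: leeD.
by rewrite -!EFinD lee_fin; lra.
Qed.

(** If [B] is the set of points of [A] that are not [d]-deep inside [A], then
    [A] and its translate by less than [d] only differ on [B] and its translate. *)
Lemma L1tc_open (A : set 'rV[R]_n) : open A -> (leb A < +oo)%E ->
  L1_translation_continuous (\1_A).
Proof.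
move=> oA Aoo e e0.
have mA : measurable A by exact: mx_open_measurable.
pose B k : set 'rV[R]_n := A `&` \bigcup_(y in ~` A) ball y k.+1%:R^-1.
have mB k : measurable (B k).
  apply: measurableI => //; apply: mx_open_measurable.
  by apply: bigcup_open => y _; exact: ball_open.
have iA : leb.-integrable setT (EFin \o (\1_A : _ -> R)).
  apply/integrableP; split; first by apply/measurable_EFinP; exact: measurable_indic.
  rewrite (eq_integral (fun x => (\1_A x)%:E)); last first.
    by move=> x _ /=; rewrite ger0_norm// indicE.
  by rewrite integral_indic// setIT.
have e2 : 0 < e / 2 by rewrite divr_gt0.
have [] := @integral_tail_small _ _ R leb (\1_A) B iA mB _ (e / 2) e2.
  move=> x; have [Ax|nAx] := pselect (A x); last by exists 0%N => k _ [].
  have /nbhs_ballP[r /= r0 rA] := open_nbhs_nbhs (conj oA Ax).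
  have [k0 _ k0P] := near_infty_natSinv_lt (PosNum r0).
  exists k0 => k k0k [_ [y nAy yx]]; apply: nAy; apply: rA.
  by apply: (le_ball (ltW (k0P k k0k))); exact: ball_sym.
move=> k /(_ k (leqnn k)) Bk.
exists k.+1%:R^-1; first by rewrite invr_gt0.
move=> s sk.
have mBk : measurable_fun setT (\1_(B k) : _ -> R) by exact: measurable_indic.
have {Bk}Bk : (\int[leb]_x (\1_(B k) x)%:E <= (e / 2)%:E)%E.
  apply: le_trans Bk; apply: ge0_le_integral_EFin => //.
    by apply: measurable_funM => //; apply: measurableT_comp => //; exact: measurable_indic.
  move=> x _; rewrite !indicE; have [[Ax _]|Bx] := pselect (B k x).
    by rewrite (mem_set Ax) normr1 mul1r.
  by rewrite (memNset Bx) mulr0.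
apply: (@le_trans _ _ (\int[leb]_x (\1_(B k) (x + s)%R + \1_(B k) x)%R%:E)%E).
  apply: ge0_le_integral_EFin => //.
  - apply: measurableT_comp => //; apply: measurable_funB; last exact: measurable_indic.
    by apply: measurable_translate; exact: measurable_indic.
  - by apply: measurable_funD => //; exact: measurable_translate.
  move=> x _; rewrite !indicE.
  have nearA (y z : 'rV[R]_n) : `|y - z| < k.+1%:R^-1 -> y \in A -> z \notin A -> y \in B k.
    move=> yz Ay Az; apply/mem_set; split; first exact: set_mem.
    exists z; first by move=> /mem_set; rewrite (negbTE Az).
    by rewrite -ball_normE/= distrC.
  have [xA|xA] := boolP (x \in A); have [sA|sA] := boolP (x + s \in A).
  - by rewrite subrr normr0 addr_ge0.
  - rewrite (nearA _ _ _ xA sA) ?sub0r ?normrN ?normr1 ?lerDr//.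
    by rewrite opprD addNKr normrN.
  - rewrite (nearA _ _ _ sA xA) ?subr0 ?normr1 ?lerDl//.
    by rewrite [x + s]addrC addrK.
  - by rewrite subrr normr0 addr_ge0.
rewrite ge0_integralD_EFin//; last first.
  exact: measurable_translate.
rewrite (@ge0_Rintegral_translate (\1_(B k)))//.
by rewrite [e in X in (_ <= X)%E]splitr EFinD; exact: leeD.
Qed.

(** Dynkin's theorem propagates the property from the open sets to all Borel
    sets; intersecting with a ball keeps the measures finite, which complements
    require. *)
Lemma L1tc_indic_bounded (A : set 'rV[R]_n) (M : R) : measurable A ->
  L1_translation_continuous (\1_(A `&` ball 0 M)).
Proof.
have finX : (leb (ball (0 : 'rV[R]_n)%R M) < +oo)%E.
  apply: lebesgue_bounded_lty; first by apply: mx_open_measurable; exact: ball_open.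
  exists M; split; first exact: num_real.
  move=> r Mr x; rewrite -ball_normE/= sub0r normrN => /ltW xM.
  exact: le_trans (ltW Mr).
set X := ball (0 : 'rV[R]_n) M in finX *.
have oX : open X by exact: ball_open.
have mX : measurable X by exact: mx_open_measurable.
have tX : L1_translation_continuous (\1_X) by exact: L1tc_open.
have m1 (B : set 'rV[R]_n) : measurable B -> measurable_fun setT (\1_(B `&` X) : _ -> R).
  by move=> mB; apply: measurable_indic; exact: measurableI.
move: A; apply: (@dynkin_induction _ _ (@open 'rV[R]_n)) => //.
- by move=> B C; exact: openI.
- by rewrite setTI.
- move=> B oB; apply: L1tc_open; first exact: openI.
  apply: le_lt_trans finX; apply: le_measure; rewrite ?inE//.
  by apply: mx_open_measurable; exact: openI.
- move=> B mB tB.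
  have := @L1tc_lin 1 (-1) _ _ (measurable_indic mX) (m1 _ mB) tX tB.
  rewrite (_ : (fun x : 'rV[R]_n => _) = \1_(~` B `&` X))//.
  apply/funext => x; rewrite !indicE.
  have [xX|xX] := pselect (X x); last first.
    by rewrite !memNset ?mulr0 ?addr0// => -[].
  rewrite (mem_set xX); have [xB|xB] := pselect (B x).
    rewrite mem_set//= memNset; last by case.
    by rewrite /=; ring.
  rewrite memNset; last by case.
  by rewrite mem_set//=; ring.
move=> F mF tF FP.
pose U k := \big[setU/set0]_(i < k) F i.
have mU k : measurable (U k) by exact: bigsetU_measurable.
have tU k : L1_translation_continuous (\1_(U k `&` X)).
  elim: k => [|k IH].
    rewrite /U big_ord0 set0I => e e0; exists 1 => // s _.
    by rewrite integral0_eq ?lee_fin ?ltW// => x _; rewrite !indicE !in_set0 subrr normr0.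
  have := @L1tc_lin 1 1 _ _ (m1 _ (mU k)) (m1 _ (mF k)) IH (FP k).
  rewrite (_ : (fun x : 'rV[R]_n => _) = \1_(U k.+1 `&` X))//.
  apply/funext => x; rewrite !indicE !mul1r /U big_ord_recr/= -/(U k).
  have dUF : ~ (U k x /\ F k x).
    rewrite /U -bigcup_mkord => -[[j /= jk Fj] Fk].
    by have := tF j k I I (ex_intro _ x (conj Fj Fk)) => jk'; rewrite jk' ltnn in jk.
  have [xX|xX] := pselect (X x); last first.
    by rewrite !memNset ?addr0// => -[].
  have [xU|xU] := pselect (U k x).
    rewrite (@mem_set _ (U k `&` X))// (@memNset _ (F k `&` X)).
      by rewrite mem_set ?addr0//; split => //; left.
    by move=> [xF _]; apply: dUF.
  rewrite (@memNset _ (U k `&` X)); last by case.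
  rewrite add0r; congr ((nat_of_bool _)%:R); apply/idP/idP => /set_mem [xF _]; apply/mem_set; split=> //.
    by right.
  by case: xF.
apply: L1tc_limit.
  by apply: m1; exact: bigcup_measurable.
move=> e e0.
have iX : leb.-integrable setT (EFin \o (\1_X : _ -> R)).
  apply/integrableP; split; first by apply/measurable_EFinP; exact: measurable_indic.
  rewrite (eq_integral (fun x => (\1_X x)%:E)); last first.
    by move=> x _ /=; rewrite ger0_norm// indicE.
  by rewrite integral_indic// setIT.
pose E k : set 'rV[R]_n := (\bigcup_j F j) `\` U k.
have mE k : measurable (E k) by apply: measurableD => //; exact: bigcup_measurable.
have [] := @integral_tail_small _ _ R leb (\1_X) E iX mE _ e e0.
  move=> x; have [[j _ Fj]|nF] := pselect ((\bigcup_j F j) x); last by exists 0%N => k _ [].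
  by exists j.+1 => k jk [_]; apply; rewrite /U -bigcup_mkord; exists j.
move=> k /(_ k (leqnn k)) Ek; exists (\1_(U k `&` X)); split => //.
  exact: m1.
apply: le_trans Ek; apply: ge0_le_integral_EFin => //.
- apply: measurableT_comp => //; apply: measurable_funB; apply: m1 => //.
  exact: bigcup_measurable.
- apply: measurable_funM; last exact: measurable_indic.
  by apply: measurableT_comp => //; exact: measurable_indic.
move=> x _; rewrite !indicE.
have [xX|xX] := pselect (X x); last first.
  rewrite (@memNset _ (_ `&` X)) ?(@memNset _ (U k `&` X)); [|by case..].
  by rewrite subrr normr0 mulr_ge0.
have UF : U k `<=` \bigcup_j F j.
  by rewrite /U -bigcup_mkord => y [j _ Fj]; exists j.
have [xU|xU] := pselect (U k x).
  rewrite (@mem_set _ (U k `&` X))// mem_set; last by split=> //; exact: UF.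
  by rewrite subrr normr0 mulr_ge0.
rewrite (@memNset _ (U k `&` X)); last by case.
rewrite subr0 (mem_set xX) normr1 mul1r.
have [xF|xF] := pselect ((\bigcup_j F j) x).
  by rewrite !mem_set ?normr1.
by rewrite memNset ?normr0// => -[].
Qed.

(** An integrable function is cut off outside a large ball, then approximated in
    the mean by simple functions on that ball. *)
Lemma L1tc_integrable a : leb.-integrable setT (EFin \o a) ->
  L1_translation_continuous a.
Proof.
move=> ia.
have ma : measurable_fun setT a by exact: integrable_measurable ia.
apply: L1tc_limit => // e e0.
have e2 : 0 < e / 2 by rewrite divr_gt0.
pose X k : set 'rV[R]_n := ball (0 : 'rV[R]_n) k%:R.
have mX k : measurable (X k) by apply: mx_open_measurable; exact: ball_open.
have [] := @integral_tail_small _ _ R leb a (fun k => ~` X k) ia _ _ (e / 2) e2.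
- by move=> k; exact: measurableC.
- move=> x; exists (Num.bound `|x|) => k xk; apply.
  rewrite /X -ball_normE/= sub0r normrN.
  by apply: lt_le_trans (archi_boundP _) _; rewrite ?ler_nat.
move=> k /(_ k (leqnn k)) ak.
have iaX : leb.-integrable (X k) (EFin \o a) by exact: integrableS ia.
have [g [ig _ /(_ [set y | (y < (e / 2)%:E)%E])]] := approximation_sfun_integrable (mX k) iaX.
case.
  by apply: open_nbhs_nbhs; split; [exact: open_ereal_lt_ereal|rewrite /= lte_fin].
move=> N _ /(_ N (leqnn N)) /ltW gN.
have mg : measurable_fun setT (g N : _ -> R) by [].
have mg1 : measurable_fun setT (fun x => g N x * \1_(X k) x : R).
  by apply: measurable_funM => //; exact: measurable_indic.
exists (fun x => g N x * \1_(X k) x); split => //.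
  rewrite (_ : (fun x => _) = fun x : 'rV[R]_n => \sum_(y <- finmap.enum_fset (fset_set (range (g N))))
      y * \1_((g N @^-1` [set y]) `&` X k) x); last first.
    apply/funext => x; rewrite fimfunE fsbig_finite//= big_distrl/=.
    by apply: eq_bigr => y _; rewrite indicI/= mulrA.
  elim: (finmap.enum_fset _) => [|y s IH].
    under [X in L1_translation_continuous X]funext do rewrite big_nil.
    by move=> d d0; exists 1 => // s _; rewrite integral0_eq ?lee_fin ?ltW// => x _;
      rewrite subrr normr0.
  under [X in L1_translation_continuous X]funext do rewrite big_cons -[X in _ + X]mul1r.
  apply: L1tc_lin => //.
  - by apply: measurable_indic; apply: measurableI => //; exact: measurable_sfunP.
  - apply: measurable_sum => r; apply: measurable_funM => //.
    by apply: measurable_indic; apply: measurableI => //; exact: measurable_sfunP.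
  - by apply: L1tc_indic_bounded; exact: measurable_sfunP.
rewrite [e in X in (_ <= X)%E]splitr EFinD.
apply: (@le_trans _ _ (\int[leb]_x (`|a x| * \1_(~` X k) x + `|a x - g N x| * \1_(X k) x)%:E)%E).
  apply: ge0_le_integral_EFin => //.
  - by apply: measurableT_comp => //; exact: measurable_funB.
  - apply: measurable_funD; apply: measurable_funM.
    + exact: measurableT_comp.
    + by apply: measurable_indic; exact: measurableC.
    + by apply: measurableT_comp => //; exact: measurable_funB.
    + exact: measurable_indic.
  move=> x _; rewrite !indicE in_setC.
  by case: (x \in X k) => /=; rewrite ?mulr1 ?mulr0 ?add0r ?addr0 ?subr0.
have m1 : measurable_fun setT (fun x => `|a x| * \1_(~` X k) x).
  by apply: measurable_funM; [exact: measurableT_comp|apply: measurable_indic; exact: measurableC].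
have m2 : measurable_fun setT (fun x => `|a x - g N x| * \1_(X k) x).
  apply: measurable_funM; last exact: measurable_indic.
  by apply: measurableT_comp => //; exact: measurable_funB.
rewrite ge0_integralD_EFin//; try by move=> x _; rewrite mulr_ge0.
apply: leeD => //; apply: le_trans gN.
rewrite [leRHS]integral_mkcond; rewrite le_eqVlt; apply/orP; left; apply/eqP.
apply: eq_integral => x _; rewrite patchE indicE.
by case: ifPn => _; rewrite ?mulr1 ?mulr0.
Qed.

(** These integrals control the error made by mollifying [b] before testing it
    against [a]. *)
Definition corr_translation_continuous a b : Prop := forall e : R, 0 < e ->
  exists2 d : R, 0 < d & forall s, `|s| < d ->
    (\int[leb]_x (`|b x| * `|a (x + s)%R - a x|)%R%:E <= e%:E)%E.

Lemma measurable_increment a s : measurable_fun setT a ->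
  measurable_fun setT (fun x : 'rV[R]_n => `|a (x + s) - a x|).
Proof.
move=> ma; apply: measurableT_comp => //; apply: measurable_funB => //.
exact: measurable_translate.
Qed.

Lemma corr_tc_bounded a b (C : R) : leb.-integrable setT (EFin \o a) ->
  measurable_fun setT b -> (forall x, `|b x| <= C) ->
  corr_translation_continuous a b.
Proof.
move=> ia mb bC e e0.
have ma : measurable_fun setT a by exact: integrable_measurable ia.
have C0 : 0 <= C by exact: le_trans (bC 0).
have eC : 0 < e / (C + 1) by rewrite divr_gt0// ltr_wpDl.
have [d d0 ad] := L1tc_integrable ia eC.
exists d => // s /ad as_.
have mas := measurable_increment s ma.
apply: (@le_trans _ _ (\int[leb]_x ((C + 1) * `|a (x + s)%R - a x|)%:E)%E).
  apply: ge0_le_integral_EFin => //.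
  - by apply: measurable_funM => //; exact: measurableT_comp.
  - exact: measurable_funM.
  - by move=> x _; rewrite ler_wpM2r// (le_trans (bC x))// lerDl.
rewrite ge0_integralM_EFin//; last by rewrite addr_ge0.
apply: (@le_trans _ _ ((C + 1)%:E * (e / (C + 1))%:E)%E).
  by apply: lee_wpmul2l => //; rewrite lee_fin addr_ge0.
by rewrite -EFinM mulrC divfK// gt_eqF// ltr_wpDl.
Qed.

(** Young's inequality bounds the contribution of the large values of [b],
    uniformly in the translation; the rest is bounded. *)
Lemma corr_tc_L2 a b : leb.-integrable setT (EFin \o a) ->
  leb.-integrable setT (EFin \o (fun x => a x ^+ 2)) ->
  measurable_fun setT b -> leb.-integrable setT (EFin \o (fun x => b x ^+ 2)) ->
  corr_translation_continuous a b.
Proof.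
move=> ia ia2 mb ib2 e e0.
have ma : measurable_fun setT a by exact: integrable_measurable ia.
have ma2 : measurable_fun setT (fun x => a x ^+ 2) by exact: measurable_funX.
have mb2 : measurable_fun setT (fun x => b x ^+ 2) by exact: measurable_funX.
have [A A0 aA] : exists2 A : R, 0 < A & (\int[leb]_x (a x ^+ 2)%:E <= A%:E)%E.
  have fin : (\int[leb]_x (a x ^+ 2)%:E)%E \is a fin_num by exact: integrable_fin_num.
  exists (fine (\int[leb]_x (a x ^+ 2)%:E)%E + 1).
    by rewrite ltr_wpDl// fine_ge0// integral_ge0// => x _; rewrite lee_fin sqr_ge0.
  by rewrite EFinD fineK// leeDl.
have [k k0 kA] : exists2 k : R, 0 < k & A / k = e / 3.
  exists (3 * A / e); first by rewrite divr_gt0// mulr_gt0.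
  by field; rewrite !gt_eqF.
have ek : 0 < e / 3 / k by rewrite divr_gt0// divr_gt0.
pose E m : set 'rV[R]_n := [set x | m%:R < `|b x|].
have mE m : measurable (E m).
  by apply: (@measurable_set_gt _ _ _ (fun x => `|b x|)); exact: measurableT_comp.
have [] := @integral_tail_small _ _ R leb _ E ib2 mE _ _ ek.
  move=> x; exists (Num.bound `|b x|) => m bm; apply/negP; rewrite -leNgt.
  by apply: ltW; apply: lt_le_trans (archi_boundP _) _; rewrite ?ler_nat.
move=> m /(_ m (leqnn m)) Em.
have mbE : measurable_fun setT (fun x => b x * \1_(~` E m) x).
  by apply: measurable_funM => //; apply: measurable_indic; exact: measurableC.
have [|d d0 Hd] := @corr_tc_bounded a _ m%:R ia mbE _ _ (divr_gt0 e0 (ltr0Sn R 2)).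
  move=> x; rewrite indicE; case: (boolP (x \in _)) => [/set_mem|_].
    by rewrite /E/= mulr1 => /negP; rewrite -leNgt.
  by rewrite mulr0 normr0.
exists d => // s /Hd {Hd}Hs.
have mas := measurable_increment s ma.
have mbn : measurable_fun setT (fun x => `|b x|) by exact: measurableT_comp.
pose T1 x := `|b x * \1_(~` E m) x| * `|a (x + s)%R - a x|.
pose T2 x := k * (`|b x ^+ 2| * \1_(E m) x).
pose T3 (x : 'rV[R]_n) := (2 * k)^-1 * (a (x + s) ^+ 2 + a x ^+ 2).
have mT1 : measurable_fun setT T1.
  by apply: measurable_funM => //; exact: measurableT_comp.
have mT2' : measurable_fun setT (fun x => `|b x ^+ 2| * \1_(E m) x).
  by apply: measurable_funM; [exact: measurableT_comp|exact: measurable_indic].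
have mT2 : measurable_fun setT T2 by exact: measurable_funM.
have ma2s : measurable_fun setT (fun x : 'rV[R]_n => a (x + s) ^+ 2).
  exact: (measurable_translate s ma2).
have mT3 : measurable_fun setT T3.
  by apply: measurable_funM => //; apply: measurable_funD.
have T20 x : 0 <= T2 x by rewrite /T2 !mulr_ge0// ltW.
have T30 x : 0 <= T3 x.
  by rewrite /T3 mulr_ge0// ?invr_ge0 ?mulr_ge0 ?addr_ge0 ?sqr_ge0// ltW.
apply: (@le_trans _ _ (\int[leb]_x (T1 x + (T2 x + T3 x))%:E)%E).
  apply: ge0_le_integral_EFin => //.
  - exact: measurable_funM.
  - by do 2 apply: measurable_funD => //.
  move=> x _; rewrite /T1 indicE in_setC; have [xE|xE] := boolP (x \in E m); last first.
    by rewrite mulr1 lerDl addr_ge0.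
  rewrite mulr0 normr0 mul0r add0r /T2 /T3 indicE xE mulr1 (ger0_norm (sqr_ge0 (b x))).
  have := ler_normB (a (x + s)) (a x); set p := a (x + s); set q := a x => pq.
  apply: (@le_trans _ _ (`|b x| * (`|p| + `|q|))); first by rewrite ler_wpM2l.
  rewrite -(real_normK (num_real (b x))) -(real_normK (num_real p)) -(real_normK (num_real q)).
  rewrite -subr_ge0 [X in 0 <= X](_ : _ = (2 * k)^-1 *
    ((k * `|b x| - `|p|) ^+ 2 + (k * `|b x| - `|q|) ^+ 2)); last by field; rewrite gt_eqF.
  by rewrite mulr_ge0 ?addr_ge0 ?sqr_ge0// invr_ge0 mulr_ge0// ltW.
rewrite ge0_integralD_EFin//;
  try by [exact: measurable_funD|move=> x _; rewrite addr_ge0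
  |move=> x _; rewrite /T1 mulr_ge0].
rewrite ge0_integralD_EFin// ge0_integralM_EFin//; last exact: ltW.
rewrite ge0_integralM_EFin//; try by [exact: measurable_funD
  |move=> x _; rewrite addr_ge0// sqr_ge0|rewrite invr_ge0 mulr_ge0// ltW].
rewrite (@ge0_integralD_EFin _ _ _ _ _ (fun x : 'rV[R]_n => a (x + s) ^+ 2) (fun x => a x ^+ 2))//;
  try by move=> x _; rewrite sqr_ge0.
rewrite (@ge0_Rintegral_translate (fun x => a x ^+ 2))//; last by move=> x; rewrite sqr_ge0.
apply: (@le_trans _ _ ((e / 3)%:E + (k%:E * (e / 3 / k)%:E + (2 * k)^-1%:E * (A%:E + A%:E)))%E).
  apply: leeD => //; apply: leeD.
    by apply: lee_wpmul2l => //; rewrite lee_fin ltW.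
  apply: lee_wpmul2l; last exact: leeD.
  by rewrite lee_fin invr_ge0 mulr_ge0// ltW.
rewrite -(EFinD A A) -!EFinM -!EFinD lee_fin le_eqVlt; apply/orP; left; apply/eqP.
rewrite (_ : (2 * k)^-1 * (A + A) = A / k); last by field; rewrite gt_eqF.
by rewrite kA; field; rewrite gt_eqF.
Qed.

End translation_continuity.

(** * Smooth functions with bounded support *)

Section line_derivatives.
Context {R : realType} {n : nat}.
Implicit Types (f g : 'rV[R]_n -> R) (x v : 'rV[R]_n).

(** Restricting to a line brings one-variable calculus to bear on directional
    derivatives. *)
Lemma is_derive_line f x v (l : R) :
  is_derive x v f l <-> is_derive (0 : R) 1 (fun t : R => f (t *: v + x)) l.
Proof.
have E : (fun h : R => h^-1 *: ((f \o shift x) (h *: v) - f x)) =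
   (fun h : R => h^-1 *: (((fun t : R => f (t *: v + x)) \o shift (0 : R)) (h *: (1 : R)) -
       (fun t : R => f (t *: v + x)) 0)).
  by apply/funext => h /=; rewrite scale0r add0r addr0 /GRing.scale/= mulr1.
split=> -[dv e]; split.
- by rewrite /derivable -E.
- by rewrite /derive -E.
- by rewrite /derivable E.
- by rewrite /derive E.
Qed.

Lemma is_derive_translate f x v c (l : R) :
  is_derive (x + c) v f l -> is_derive x v (fun y => f (y + c)) l.
Proof. by move=> /is_derive_line fl; apply/is_derive_line; under eq_fun do rewrite -addrA. Qed.

Lemma is_derive_reflect f x v (l : R) :
  is_derive (- x) v f l -> is_derive x v (fun y => f (- y)) (- l).
Proof.
move=> /is_derive_line fl; apply/is_derive_line.
rewrite (_ : (fun t : R => _) = (fun t : R => f (t *: v - x)) \o (-%R)); last first.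
  by apply/funext => t /=; rewrite opprD scaleNr.
rewrite -[- l]mulrN1; apply: is_derive1_comp; first by rewrite oppr0.
Qed.

Lemma is_derive_coord (g : R -> R) x (i j : 'I_n) (l : R) :
  is_derive (x 0 i) 1 g l ->
  is_derive x (delta_mx 0 j) (fun y => g (y 0 i)) ((i == j)%:R * l).
Proof.
move=> gl; apply/is_derive_line.
rewrite (_ : (fun t : R => _) = g \o (fun t : R => t * (i == j)%:R + x 0 i)); last first.
  by apply/funext => t /=; rewrite !mxE eqxx andTb.
rewrite mulrC; apply: is_derive1_comp; first by rewrite mul0r add0r.
rewrite [X in is_derive _ _ X _](_ : _ = ((i == j)%:R \*: (id : R -> R)) + cst (x 0 i)); last first.
  by apply/funext => t; rewrite /= mulrC.
by apply: is_derive_eq; rewrite addr0 /GRing.scale/= mulr1.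
Qed.

End line_derivatives.

Section smoothness.
Context {R : realType} {n : nat}.
Implicit Types (f g phi : 'rV[R]_n -> R) (x v : 'rV[R]_n).

(** Smoothness, sliced by order and peeling off the innermost derivative, so
    that closure properties follow by induction on the order. *)
Fixpoint smooth_upto (k : nat) phi : Prop :=
  continuous phi /\
  if k is k'.+1 then
    forall i : 'I_n, exists2 dphi, (forall x, is_derive x (delta_mx 0 i) phi (dphi x)) &
      smooth_upto k' dphi
  else True.

Lemma smooth_upto_continuous k phi : smooth_upto k phi -> continuous phi.
Proof. by case: k => [|k] []. Qed.

Lemma smooth_uptoP phi : smooth phi <-> forall k, smooth_upto k phi.
Proof.
split=> [sphi k|sphi s].
  elim: k phi sphi => [|k IH] phi sphi; split=> //.
  - by have [] := sphi [::].
  - by have [] := sphi [::].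
  move=> i; exists (partial i phi).
    by move=> x; have [_ /(_ i x) /derivableP] := sphi [::].
  by apply: IH => s; have := sphi (rcons s i); rewrite /iter_partial foldr_rcons.
have {sphi} : smooth_upto (size s).+1 phi by [].
elim/last_ind: s phi => [|s i IH] phi.
  move=> [cphi dphi]; split => // i x.
  by have [d /(_ x) [] //] := dphi i.
rewrite size_rcons => -[_ /(_ i) [d dphi sd]].
have -> : iter_partial (rcons s i) phi = iter_partial s d.
  rewrite /iter_partial foldr_rcons; congr (foldr _ _ _).
  by apply/funext => x; exact: derive_val.
exact: IH.
Qed.

Lemma smooth_uptoW k phi : smooth_upto k.+1 phi -> smooth_upto k phi.
Proof.
elim: k phi => [|k IH] phi [cphi dphi]; split=> // i.
by have [d dd sd] := dphi i; exists d => //; exact: IH.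
Qed.

Lemma smooth_uptoD k f g : smooth_upto k f -> smooth_upto k g ->
  smooth_upto k (fun x => f x + g x).
Proof.
elim: k f g => [|k IH] f g [cf df] [cg dg].
  by split=> // x; apply: continuousD; [exact: cf|exact: cg].
split; first by move=> x; apply: continuousD; [exact: cf|exact: cg].
move=> i; have [f' ff' sf'] := df i; have [g' gg' sg'] := dg i.
exists (fun x => f' x + g' x); last exact: IH.
by move=> x; apply: is_deriveD.
Qed.

Lemma smooth_uptoM k f g : smooth_upto k f -> smooth_upto k g ->
  smooth_upto k (fun x => f x * g x).
Proof.
elim: k f g => [|k IH] f g sf sg.
  have [cf _] := sf; have [cg _] := sg.
  by split=> // x; apply: continuousM; [exact: cf|exact: cg].
have [cf df] := sf; have [cg dg] := sg.
split; first by move=> x; apply: continuousM; [exact: cf|exact: cg].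
move=> i; have [f' ff' sf'] := df i; have [g' gg' sg'] := dg i.
exists (fun x => f x * g' x + g x * f' x).
  by move=> x; apply: is_deriveM.
by apply: smooth_uptoD; apply: IH => //; exact: smooth_uptoW.
Qed.

Lemma smooth_upto_cst k (c : R) : smooth_upto k (fun=> c).
Proof.
elim: k c => [|k IH] c; first by split=> //; exact: cst_continuous.
split; first exact: cst_continuous.
by move=> i; exists (fun=> 0) => // x; exact: is_derive_cst.
Qed.

Lemma continuous_rV_comp_shift (c : 'rV[R]_n) f : continuous f ->
  continuous (fun x => f (x + c)).
Proof.
move=> cf x; apply: (@continuous_comp _ _ _ (fun y : 'rV[R]_n => y + c) f); last exact: cf.
exact: (@cvgD R 'rV[R]_n 'rV[R]_n (nbhs x) (nbhs_filter x) (fun x => x)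
  (fun=> c) x c (@cvg_id _ _) (@cvg_cst _ _ _ _ _)).
Qed.

Lemma smooth_upto_translate k (c : 'rV[R]_n) f : smooth_upto k f ->
  smooth_upto k (fun x => f (x + c)).
Proof.
elim: k f => [|k IH] f [cf df]; split=> //; try exact: continuous_rV_comp_shift.
move=> i; have [f' ff' sf'] := df i.
by exists (fun x => f' (x + c)); [move=> x; exact: is_derive_translate|exact: IH].
Qed.

Lemma smooth_continuous phi : smooth phi -> continuous phi.
Proof. by move=> /(_ [::])[]. Qed.

Lemma smooth_partial i phi : smooth phi -> smooth (partial i phi).
Proof.
by move=> sphi s; have := sphi (rcons s i); rewrite /iter_partial foldr_rcons.
Qed.

Lemma smooth_is_derive phi i x : smooth phi ->
  is_derive x (delta_mx 0 i) phi (partial i phi x).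
Proof. by move=> /(_ [::]) [_ /(_ i x)] /derivableP. Qed.

Lemma smoothD f g : smooth f -> smooth g -> smooth (fun x => f x + g x).
Proof. by move=> /smooth_uptoP sf /smooth_uptoP sg; apply/smooth_uptoP => k; exact: smooth_uptoD. Qed.

Lemma smoothM f g : smooth f -> smooth g -> smooth (fun x => f x * g x).
Proof. by move=> /smooth_uptoP sf /smooth_uptoP sg; apply/smooth_uptoP => k; exact: smooth_uptoM. Qed.

Lemma smooth_cst (c : R) : smooth (fun _ : 'rV[R]_n => c).
Proof. by apply/smooth_uptoP => k; exact: smooth_upto_cst. Qed.

Lemma smooth_translate c f : smooth f -> smooth (fun x => f (x + c)).
Proof. by move=> /smooth_uptoP sf; apply/smooth_uptoP => k; exact: smooth_upto_translate. Qed.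

Lemma smooth_sum I (s : seq I) (F : I -> 'rV[R]_n -> R) :
  (forall i, smooth (F i)) -> smooth (fun x => \sum_(i <- s) F i x).
Proof.
move=> sF; elim: s => [|i s IH].
  by under eq_fun do rewrite big_nil; exact: smooth_cst.
by under eq_fun do rewrite big_cons; exact: smoothD.
Qed.

Lemma smooth_prod I (s : seq I) (F : I -> 'rV[R]_n -> R) :
  (forall i, smooth (F i)) -> smooth (fun x => \prod_(i <- s) F i x).
Proof.
move=> sF; elim: s => [|i s IH].
  by under eq_fun do rewrite big_nil; exact: smooth_cst.
by under eq_fun do rewrite big_cons; exact: smoothM.
Qed.

Lemma partialD f g i x : smooth f -> smooth g ->
  partial i (fun x => f x + g x) x = partial i f x + partial i g x.
Proof.
move=> sf sg; have := smooth_is_derive i x sf; have := smooth_is_derive i x sg.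
by move=> dg df; rewrite {1}/partial; exact: derive_val.
Qed.

Lemma partialM f g i x : smooth f -> smooth g ->
  partial i (fun x => f x * g x) x = f x * partial i g x + g x * partial i f x.
Proof.
move=> sf sg; have := smooth_is_derive i x sf; have := smooth_is_derive i x sg.
by move=> dg df; rewrite {1}/partial; exact: derive_val.
Qed.

Lemma partial_cst (c : R) i x : partial i (fun=> c) x = 0.
Proof. exact: derive_cst. Qed.

Lemma partialZ (c : R) f i x : smooth f ->
  partial i (fun x => c * f x) x = c * partial i f x.
Proof.
move=> sf; rewrite partialM//; last exact: smooth_cst.
by rewrite partial_cst mulr0 addr0.
Qed.

Lemma partial_sum I (s : seq I) (F : I -> 'rV[R]_n -> R) i x :
  (forall j, smooth (F j)) ->
  partial i (fun x => \sum_(j <- s) F j x) x = \sum_(j <- s) partial i (F j) x.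
Proof.
move=> sF; elim: s => [|j s IH].
  by under [X in partial i X]eq_fun do rewrite big_nil; rewrite big_nil partial_cst.
under [X in partial i X]eq_fun do rewrite big_cons.
by rewrite big_cons partialD ?IH//; exact: smooth_sum.
Qed.

Lemma partial_translate c f i x : smooth f ->
  partial i (fun x => f (x + c)) x = partial i f (x + c).
Proof.
move=> sf; have := is_derive_translate (smooth_is_derive i (x + c) sf).
by move=> h; rewrite {1}/partial; exact: derive_val.
Qed.

End smoothness.

Section bump.
Context {R : realType}.

(** The powers of [t^-1] make this family closed under differentiation. *)
Definition flat (m : nat) (t : R) : R :=
  if 0 < t then t^-1 ^+ m * expR (- t^-1) else 0.

Lemma flat_ge0 m t : 0 <= flat m t.
Proof.
rewrite /flat; case: ifPn => // t0.
by rewrite mulr_ge0 ?expR_ge0// exprn_ge0// invr_ge0 ltW.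
Qed.

Lemma flat_gt0 m t : 0 < t -> 0 < flat m t.
Proof. by move=> t0; rewrite /flat t0 mulr_gt0 ?expR_gt0// exprn_gt0// invr_gt0. Qed.

Lemma flat_eq0 m t : t <= 0 -> flat m t = 0.
Proof. by rewrite /flat leNgt => /negPf ->. Qed.

(** One term of the exponential series at [t^-1] beats the power. *)
Lemma flat_le m t : flat m t <= m.+1`!%:R * `|t|.
Proof.
rewrite /flat; case: ifPn => t0; last by rewrite mulr_ge0.
have tV0 : 0 <= t^-1 by rewrite invr_ge0 ltW.
have := expR_ge1Dxn m tV0 => E.
have {}E : t^-1 ^+ m.+1 / m.+1`!%:R <= expR t^-1 by apply: le_trans E; rewrite lerDr.
rewrite expRN (gtr0_norm t0) ler_pdivrMr ?expR_gt0//.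
apply: (@le_trans _ _ (m.+1`!%:R * t * (t^-1 ^+ m.+1 / m.+1`!%:R))); last first.
  by apply: ler_wpM2l => //; rewrite mulr_ge0// ltW.
rewrite exprS le_eqVlt; apply/orP; left; apply/eqP.
have ft : m.+1`!%:R != 0 :> R by rewrite pnatr_eq0 -lt0n fact_gt0.
by field; rewrite ft gt_eqF.
Qed.

(** Only the derivative at [0] is not a computation: there the difference
    quotient is [flat m.+1], which tends to [0]. *)
Lemma is_derive_flat m (t : R) :
  is_derive t 1 (flat m) (flat m.+2 t - m%:R * flat m.+1 t).
Proof.
have [t0|t0|<-] := ltgtP 0 t.
- have tn0 : t != 0 by rewrite gt_eqF.
  suff : is_derive t 1 (fun s : R => s^-1 ^+ m * expR (- s^-1))
      (flat m.+2 t - m%:R * flat m.+1 t).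
    apply: near_eq_is_derive; near=> s; rewrite /flat ifT//; near: s.
    exact: lt_nbhsr.
  rewrite /flat t0.
  have dV : is_derive t 1 (fun s : R => s^-1) (- t ^- 2 *: (1 : R)).
    by apply: is_deriveV.
  have dE : is_derive t 1 (fun s : R => expR (- s^-1)) (expR (- t^-1) * (t ^- 2)).
    apply: (@is_derive1_comp _ expR (fun s : R => - s^-1)).
    by apply: is_derive_eq; rewrite scaleNr opprK /GRing.scale/= mulr1.
  rewrite (_ : (fun s : R => _) =
      (fun s : R => s^-1) ^+ m * (fun s : R => expR (- s^-1))); last first.
    by apply/funext => s; rewrite exprfctE.
  apply: (is_derive_eq (is_deriveM (is_deriveX m dV) dE)); rewrite exprfctE.
  rewrite /GRing.scale/= !exprVn.
  case: (m) => [|k] /=; first by rewrite !expr0; field.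
  have tk0 : t ^+ k != 0 by rewrite expf_neq0.
  by rewrite !exprS; field; rewrite tn0 tk0.
- rewrite !flat_eq0 ?ltW// mulr0 subrr.
  suff : is_derive t 1 (cst (0 : R)) 0.
    apply: near_eq_is_derive; near=> s; rewrite flat_eq0//; apply: ltW.
    by near: s; exact: lt_nbhsl.
  exact: is_derive_cst.
rewrite !flat_eq0// mulr0 subrr.
have cv : h^-1 *: ((flat m \o shift (0 : R)) (h *: (1 : R)) - flat m 0) @[h --> 0^'] --> (0 : R).
  apply/cvgrPdist_le => e e0; near=> h.
  rewrite /= addr0 [h *: 1]mulr1 (flat_eq0 m (lexx 0)) subr0 sub0r normrN /GRing.scale/=.
  have -> : h^-1 * flat m h = flat m.+1 h.
    by rewrite /flat; case: ifPn; rewrite ?mulr0// exprS mulrA.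
  rewrite ger0_norm ?flat_ge0//; apply: (le_trans (flat_le _ _)).
  rewrite -ler_pdivlMl ?ltr0n ?fact_gt0//.
  near: h; apply: dnbhs0_le.
  by rewrite mulr_gt0// invr_gt0 ltr0n fact_gt0.
split; first by apply/cvg_ex; exists 0.
exact/cvg_lim.
Unshelve. all: by end_near. Qed.

Lemma continuous_flat m : continuous (flat m).
Proof.
move=> t; have [d _] := is_derive_flat m t.
by apply: differentiable_continuous; apply/derivable1_diffP.
Qed.

Context {n : nat}.

Lemma smooth_flat_coord m (c s : R) (i : 'I_n) :
  smooth (fun x : 'rV[R]_n => flat m (c + s * x 0 i)).
Proof.
apply/smooth_uptoP => k; elim: k m => [|k IH] m.
  split => // x; apply: (@continuous_comp _ _ _ (fun y : 'rV[R]_n => c + s * y 0 i) (flat m)); last exact: continuous_flat.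
  apply: continuousD; first exact: cst_continuous.
  by apply: continuousM; [exact: cst_continuous|exact: coord_continuous].
split; first exact: smooth_upto_continuous (IH m).
move=> j; exists (fun x => (i == j)%:R * (flat m.+2 (c + s * x 0 i) + (- m%:R) * flat m.+1 (c + s * x 0 i)) * s).
  move=> x; rewrite -mulrA.
  apply: (@is_derive_coord _ _ (fun t => flat m (c + s * t))).
  rewrite mulNr; apply: (@is_derive1_comp _ (flat m) (fun t => c + s * t)).
    exact: is_derive_flat.
  rewrite [X in is_derive _ _ X _](_ : _ = cst c + (s \*: (id : R -> R))); last by apply/funext.
  by apply: is_derive_eq; rewrite add0r /GRing.scale/= mulr1.
apply: smooth_uptoM; last exact: smooth_upto_cst.
apply: smooth_uptoM; first exact: smooth_upto_cst.
apply: smooth_uptoD; first exact: IH.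
by apply: smooth_uptoM; [exact: smooth_upto_cst|exact: IH].
Qed.

(** A product over the coordinates, so that smoothness is a one-variable matter;
    the support is a ball of the sup norm. *)
Definition bump (e : R) (x : 'rV[R]_n) : R :=
  \prod_(i < n) (flat 0 (e + x 0 i) * flat 0 (e - x 0 i)).

Lemma smooth_bump e : smooth (bump e).
Proof.
apply: smooth_prod => i; apply: smoothM.
  by under eq_fun do rewrite -[X in e + X]mul1r; exact: smooth_flat_coord.
by under eq_fun do rewrite -[X in e + X]mulN1r; exact: smooth_flat_coord.
Qed.

Lemma bump_ge0 e x : 0 <= bump e x.
Proof. by apply: prodr_ge0 => i _; rewrite mulr_ge0// flat_ge0. Qed.

Lemma bumpN e x : bump e (- x) = bump e x.
Proof. by apply: eq_bigr => i _; rewrite !mxE opprK mulrC. Qed.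

Lemma bump_gt0 e x : `|x| < e -> 0 < bump e x.
Proof.
move=> xe; apply: prodr_gt0 => i _.
have := le_lt_trans (normr_coord_le x i) xe; rewrite ltr_norml => /andP[x1 x2].
by rewrite mulr_gt0// flat_gt0// ?subr_gt0// -ltrBlDl sub0r.
Qed.

Lemma bump_eq0 e x : (0 < n)%N -> e <= `|x| -> bump e x = 0.
Proof.
move=> n0 ex; apply/eqP/prodf_eq0.
have [i xi] : exists i : 'I_n, `|x| <= `|x 0 i|.
  have [->|x0] := eqVneq x 0; first by exists (Ordinal n0); rewrite normr0.
  have xn : mx_norm x != 0 by rewrite -[mx_norm x]/(`|x|) normr_eq0.
  have [[j i] /= xij] := mx_norm_neq0 xn; exists i.
  by rewrite -[`|x|]/(mx_norm x) xij (ord1 j).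
exists i => //; have := le_trans ex xi; rewrite ler_normr => /orP[h|h].
  by rewrite (flat_eq0 _ (t := e - _)) ?mulr0// subr_le0.
by rewrite flat_eq0 ?mul0r//; lra.
Qed.

End bump.

(** * Compactness *)

Section compactness.
Context {R : realType} {n : nat}.
Implicit Types (K : set 'rV[R]_n) (x y : 'rV[R]_n).

Lemma compact_finite_net K (r : 'rV[R]_n -> R) : compact K ->
  (forall x, K x -> 0 < r x) ->
  exists2 s : seq 'rV[R]_n, (forall x, x \in s -> K x) &
    forall y, K y -> exists2 x, x \in s & ball x (r x) y.
Proof.
rewrite compact_cover => /(_ _ K (fun x => ball x (r x))) cK r0.
have [| |D DK KD] := cK.
- by move=> x _; exact: ball_open.
- by move=> y Ky; exists y => //; apply: ballxx; exact: r0.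
exists (finmap.enum_fset D) => [x /DK|y /KD [x xD yx]]; first by rewrite inE.
by exists x.
Qed.

(** Stated for any property [Q] of small sets that passes to subsets: being
    contained in a member of a cover, having small oscillation under a function,
    or admitting a common inner cone. *)
Lemma lebesgue_number K (Q : set 'rV[R]_n -> Prop) : compact K ->
  (forall A B, A `<=` B -> Q B -> Q A) ->
  (forall x, K x -> exists2 r : R, 0 < r & Q (ball x r)) ->
  exists2 d : R, 0 < d & forall x, K x -> Q (ball x d).
Proof.
move=> cK QS KQ.
have /choice[r rP] x : exists r : R, K x -> 0 < r /\ Q (ball x r).
  have [Kx|nKx] := pselect (K x); last by exists 0.
  by have [r r0 Qr] := KQ x Kx; exists r.
have r2 x : K x -> 0 < r x / 2 by move=> /rP[r0 _]; rewrite divr_gt0.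
have [s sK Ks] := compact_finite_net cK r2.
pose d := \big[Num.min/1]_(x <- s) (r x / 2).
have dle x : x \in s -> d <= r x / 2.
  rewrite /d; elim: (s) => // y t IH; rewrite in_cons big_cons ge_min.
  by move=> /orP[/eqP ->|/IH ->]; rewrite ?lexx ?orbT.
exists d.
  rewrite /d big_seq; elim/big_ind: _ => // [a b a0 b0|x xs].
    by rewrite lt_min a0.
  by apply: r2; exact: sK.
move=> y /Ks[x xs xy]; have [_] := rP x (sK x xs); apply: QS => z yz.
rewrite [r x]splitr; apply: (ball_triangle xy).
by apply: le_ball yz; exact: dle.
Qed.

Lemma compact_normr_le (M : R) : compact [set x : 'rV[R]_n | `|x| <= M].
Proof.
apply: bounded_closed_compact.
  by exists M; split; [exact: num_real|move=> r Mr x /= /le_trans; apply; exact: ltW].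
rewrite (_ : [set _ | _] = (fun x : 'rV[R]_n => `|x|) @^-1` [set t | t <= M])//.
apply: closed_comp; last exact: closed_le.
by move=> x _; exact: norm_continuous.
Qed.

End compactness.

Section bounded_support.
Context {R : realType} {n : nat}.
Local Notation leb := (@lebesgue_rV R n).
Implicit Types (f : 'rV[R]_n -> R) (x y : 'rV[R]_n).

Definition support_in (M : R) f : Prop := forall x, M < `|x| -> f x = 0.

Lemma support_in_bounded f M : continuous f -> support_in M f ->
  exists2 C : R, 0 <= C & forall x, `|f x| <= C.
Proof.
move=> cf fM.
have [] := @compact_bounded _ _ (f @` [set x | `|x| <= M]).
  apply: continuous_compact; last exact: compact_normr_le.
  exact: continuous_subspaceT.
move=> N [_ fN]; exists (`|N| + 1) => [|x]; first by rewrite addr_ge0.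
have [xM|Mx] := leP `|x| M; last by rewrite fM// normr0 addr_ge0.
apply: fN; last by exists x.
by rewrite (le_lt_trans (ler_norm N))// ltrDl.
Qed.

Lemma support_in_uniform_continuous f M : continuous f -> support_in M f ->
  forall e : R, 0 < e -> exists2 d : R, 0 < d &
    forall x y, `|x - y| < d -> `|f x - f y| <= e.
Proof.
move=> cf fM e e0.
have [] := @lebesgue_number R n [set x | `|x| <= M]
  (fun A => forall y z, A y -> A z -> `|f y - f z| <= e) (@compact_normr_le _ _ _).
- by move=> A B AB BQ y z Ay Az; apply: BQ; exact: AB.
- move=> x _; have e2 : 0 < e / 2 by rewrite divr_gt0.
  have /cvgrPdist_lt/(_ _ e2)/nbhs_ballP[r r0 rP] := cf x.
  exists r => // y z /rP/= yx /rP/= zx.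
  rewrite (_ : f y - f z = (f x - f z) - (f x - f y)); last by ring.
  by rewrite (le_trans (ler_normB _ _))// [e]splitr lerD// ltW.
move=> d d0 dP; exists d => // x y xy.
have [xM|Mx] := leP `|x| M.
  by apply: (dP x xM); [exact: ballxx|rewrite -ball_normE].
have [yM|My] := leP `|y| M.
  by apply: (dP y yM); [rewrite -ball_normE/= distrC|exact: ballxx].
by rewrite !fM// subrr normr0 ltW.
Qed.

Lemma bounded_support_integrable f (M C : R) : measurable_fun setT f ->
  (forall x, `|f x| <= C) -> support_in M f -> leb.-integrable setT (EFin \o f).
Proof.
move=> mf fC fM.
pose B := [set x : 'rV[R]_n | `|x| <= M].
have mB : measurable B.
  rewrite -[B]setCK; apply: measurableC; apply: mx_open_measurable.
  by apply: closed_openC; apply: compact_closed; [exact: norm_hausdorff|exact: compact_normr_le].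
apply: (@dominated_integrable _ _ _ _ _ _ (fun x => C * \1_B x)) => //.
  apply/integrableP; split.
    by apply/measurable_EFinP; apply: measurable_funM => //; exact: measurable_indic.
  have C0 : 0 <= C by apply: le_trans (fC 0).
  rewrite (eq_integral (fun x => (C * \1_B x)%:E)); last first.
    by move=> x _ /=; rewrite ger0_norm// indicE mulr_ge0.
  rewrite (@ge0_integralM_EFin _ _ _ leb setT (\1_B) C)//.
  rewrite integral_indic// setIT lte_mul_pinfty ?lee_fin//.
  apply: lebesgue_bounded_lty => //.
  by exists M; split; [exact: num_real|move=> r Mr x /= /le_trans; apply; exact: ltW].
move=> x _; rewrite indicE; have [xM|Mx] := leP `|x| M.
  by rewrite mem_set// mulr1.
rewrite fM// normr0 memNset ?mulr0// => /=.
by apply/negP; rewrite -ltNge.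
Qed.

Lemma continuous_support_integrable f M : continuous f -> support_in M f ->
  leb.-integrable setT (EFin \o f).
Proof.
move=> cf fM; have [C _ fC] := support_in_bounded cf fM.
by apply: (@bounded_support_integrable _ M C) => //; exact: continuous_measurable.
Qed.

Lemma support_in_partial f M i : support_in M f -> support_in M (partial i f).
Proof.
move=> fM x Mx; rewrite /partial -(@derive_cst R _ _ (0 : R) x (delta_mx 0 i)).
apply: near_eq_derive.
have : \forall y \near x, M < `|y|.
  have : open [set y : 'rV[R]_n | M < `|y|].
    rewrite (_ : [set _ | _] = (fun x : 'rV[R]_n => `|x|) @^-1` [set t | M < t])//.
    by apply: open_comp; [move=> y _; exact: norm_continuous|exact: open_gt].
  by rewrite openE; apply.
by apply: filterS => y My; rewrite fM.
Qed.

End bounded_support.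

Lemma continuous_rV_dist {R : realType} {n : nat} (f : 'rV[R]_n -> R) :
  (forall x (e : R), 0 < e -> exists2 d : R, 0 < d &
    forall z, `|x - z| < d -> `|f x - f z| <= e) -> continuous f.
Proof.
move=> fP x; apply/(@cvgrPdist_le R R 'rV[R]_n (nbhs x) (nbhs_filter x)) => e e0.
have [d d0 dP] := fP x e e0.
by apply/nbhs_ballP; exists d => // z; rewrite -ball_normE; exact: dP.
Qed.

(** * Mollification *)

Section mollifier.
Context {R : realType} {n : nat}.
Hypothesis n_gt0 : (0 < n)%N.
Local Notation leb := (@lebesgue_rV R n).
Implicit Types (g a b psi : 'rV[R]_n -> R) (x y h : 'rV[R]_n) (e : R).

Lemma bump_support e : support_in e (bump e : 'rV[R]_n -> R).
Proof. by move=> x ex; apply: bump_eq0 => //; exact: ltW. Qed.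

Lemma bump_integrable e : leb.-integrable setT (EFin \o (bump e : 'rV[R]_n -> R)).
Proof.
apply: continuous_support_integrable (@bump_support e).
exact: smooth_continuous (smooth_bump e).
Qed.

Lemma bump_integral_gt0 e : 0 < e -> 0 < \int[leb]_x bump e x.
Proof.
move=> e0; rewrite lt_neqAle Rintegral_ge0 ?andbT; last by move=> x _; exact: bump_ge0.
apply/negP => /eqP b0.
have : (\int[leb]_x `|(bump e x)%:E| = 0)%E.
  rewrite (eq_integral (fun x => (bump e x)%:E)); last first.
    by move=> x _; rewrite gee0_abs// lee_fin bump_ge0.
  by rewrite -[LHS]fineK -?/(Rintegral _ _ _) -?b0//; apply: integrable_fin_num => //; exact: bump_integrable.
move/ae_eq_integral_abs => /(_ measurableT).
case.
  by case/integrableP: (bump_integrable e).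
move=> N [mN N0 bN].
have : (leb (box (const_mx (- e)%R) (const_mx e)) <= 0)%E.
  rewrite -N0; apply: le_measure; rewrite ?inE//; first exact: box_measurable.
  move=> x xe; apply: bN => /(_ I) /= -[bx].
  have : 0 < bump e x.
    apply: bump_gt0; have := ball_box (0 : 'rV[R]_n) e0.
    rewrite !add0r => be.
    have : box (- const_mx e) (const_mx e) x by move=> i; have := xe i; rewrite !mxE.
    by rewrite -be -ball_normE/= sub0r normrN.
  by rewrite bx ltxx.
rewrite lebesgue_box leNgt => /negP; apply.
elim/big_ind: _ => //.
- by move=> u v u0 v0; exact: mule_gt0.
- move=> i _; rewrite lebesgue_measure_itv/= !mxE lte_fin.
  by rewrite ifT -?EFinD ?lte_fin; lra.
Qed.

Definition moll e x : R := (\int[leb]_x bump e x)^-1 * bump e x.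

Lemma moll_smooth e : smooth (moll e).
Proof. by apply: smoothM; [exact: smooth_cst|exact: smooth_bump]. Qed.

Lemma moll_ge0 e x : 0 <= moll e x.
Proof.
rewrite mulr_ge0 ?bump_ge0// invr_ge0 Rintegral_ge0// => y _.
exact: bump_ge0.
Qed.

Lemma mollN e x : moll e (- x) = moll e x.
Proof. by rewrite /moll bumpN. Qed.

Lemma moll_eq0 e x : e <= `|x| -> moll e x = 0.
Proof. by move=> ex; rewrite /moll bump_eq0// mulr0. Qed.

Lemma moll_support e : support_in e (moll e).
Proof. by move=> x ex; rewrite moll_eq0// ltW. Qed.

Lemma moll_integrable e : leb.-integrable setT (EFin \o moll e).
Proof.
apply: continuous_support_integrable (@moll_support e).
exact: smooth_continuous (moll_smooth e).
Qed.

Lemma moll_integral e : 0 < e -> \int[leb]_x moll e x = 1.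
Proof.
move=> e0; rewrite /moll RintegralZl//; last exact: bump_integrable.
by rewrite mulVf// gt_eqF// bump_integral_gt0.
Qed.

Lemma moll_integralE e : 0 < e -> (\int[leb]_x (moll e x)%:E = 1)%E.
Proof.
move=> e0; rewrite -[LHS]fineK -1?/(Rintegral _ _ _) ?moll_integral//.
by apply: integrable_fin_num => //; exact: moll_integrable.
Qed.

Lemma moll_integral_reflect e x : 0 < e -> \int[leb]_y moll e (x - y) = 1.
Proof.
move=> e0; rewrite -(moll_integral e0) -(Rintegral_translate (- x) (moll_integrable e)).
by apply: eq_Rintegral => y _; rewrite -mollN opprB.
Qed.

Lemma measurable_reflect psi x : measurable_fun setT psi ->
  measurable_fun setT (fun y : 'rV[R]_n => psi (x - y)).
Proof.
move=> mpsi; apply: (measurableT_comp mpsi).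
apply: (@measurable_rV_add R _ _ n (fun=> x) (fun y => - y)) => //.
exact: (@measurable_rV_opp R _ _ n id).
Qed.

Lemma moll_reflect_integrable e x : leb.-integrable setT (EFin \o (fun y => moll e (x - y))).
Proof.
have cm := smooth_continuous (moll_smooth e).
have [C _ mC] := support_in_bounded cm (@moll_support e).
apply: (@bounded_support_integrable _ _ _ (`|x| + e) C) => //.
  by apply: measurable_reflect; exact: continuous_measurable.
move=> y ye; apply: moll_support.
have := ler_normD x (y - x); rewrite addrC subrK (distrC y); move: ye; lra.
Qed.

Lemma partial_mollN e i x : partial i (moll e) (- x) = - partial i (moll e) x.
Proof.
have := is_derive_reflect (smooth_is_derive i (- x) (moll_smooth e)).
rewrite (_ : (fun y => moll e (- y)) = moll e); last by apply/funext => y; rewrite mollN.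
by move=> dm; rewrite -[LHS]opprK; congr (- _); apply/esym; exact: (@derive_val _ _ _ _ _ _ _ dm).
Qed.

#[global] Opaque moll.

Definition conv psi g x : R := \int[leb]_y (psi (x - y) * g y).

Lemma conv_integrable psi g (C : R) x : measurable_fun setT psi ->
  (forall y, `|psi y| <= C) -> leb.-integrable setT (EFin \o g) ->
  leb.-integrable setT (EFin \o (fun y => psi (x - y) * g y)).
Proof.
move=> mpsi psiC ig; under eq_fun do rewrite mulrC.
by apply: (integrableM_bounded (C := C)) => //; exact: measurable_reflect.
Qed.

Lemma conv_continuous psi g e : continuous psi -> support_in e psi ->
  leb.-integrable setT (EFin \o g) -> continuous (conv psi g).
Proof.
move=> cpsi spsi ig; apply: continuous_rV_dist => x d d0.
have mpsi := continuous_measurable cpsi.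
have [C _ psiC] := support_in_bounded cpsi spsi.
have ing := integrable_norm ig.
pose I := \int[leb]_y `|g y|.
have I0 : 0 <= I by rewrite Rintegral_ge0.
have dI : 0 < d / (I + 1) by rewrite divr_gt0// ltr_wpDl.
have [r r0 rP] := support_in_uniform_continuous cpsi spsi dI.
exists r => // z xz.
rewrite /conv -RintegralB//; try exact: (conv_integrable _ mpsi psiC ig).
have ib : leb.-integrable setT (EFin \o (fun y => psi (x - y) * g y - psi (z - y) * g y)).
  by apply: integrableB_EFin => //; exact: (conv_integrable _ mpsi psiC ig).
apply: (le_trans (le_normr_Rintegral measurableT ib)).
apply: (@le_trans _ _ (\int[leb]_y (d / (I + 1) * `|g y|))).
  apply: le_Rintegral => //.
  - exact: integrable_norm.
  - exact: integrableZ_EFin.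
  move=> y _; rewrite -mulrBl normrM ler_wpM2r//; apply: rP.
  by rewrite opprB addrA subrK.
rewrite RintegralZl// -/I mulrAC ler_pdivrMr ?ltr_wpDl// ler_wpM2l ?ltW//.
by rewrite ltrDl.
Qed.

(** Differentiation under the integral sign: the difference quotients are
    dominated by a multiple of the integrable factor [g]. *)
Lemma is_derive_conv psi g e i x : smooth psi -> support_in e psi ->
  leb.-integrable setT (EFin \o g) ->
  is_derive x (delta_mx 0 i) (conv psi g) (conv (partial i psi) g x).
Proof.
move=> spsi epsi ig.
have cpsi := smooth_continuous spsi.
have mpsi := continuous_measurable cpsi.
have [C _ psiC] := support_in_bounded cpsi epsi.
have [C' C'0 dpsiC] := support_in_bounded (smooth_continuous (smooth_partial i spsi))
  (support_in_partial i epsi).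
pose f (t : R) y := psi (t *: delta_mx 0 i + x - y) * g y.
have df (t : R) y : is_derive t (1 : R) (f ^~ y) (partial i psi (t *: delta_mx 0 i + x - y) * g y).
  have := smooth_is_derive i (t *: delta_mx 0 i + x - y) spsi.
  move=> /is_derive_line => d0.
  have dt : is_derive t (1 : R) (fun s : R => psi (s *: delta_mx 0 i + x - y))
      (partial i psi (t *: delta_mx 0 i + x - y)).
    rewrite (_ : (fun s : R => _) = (fun s : R => psi (s *: delta_mx 0 i + (t *: delta_mx 0 i + x - y))) \o (fun s : R => s - t)); last first.
      apply/funext => s /=; congr psi; rewrite scalerBl !addrA subrK//.
    rewrite -[X in is_derive _ _ _ X]mulr1; apply: is_derive1_comp; first by rewrite subrr.
    by apply: is_derive_eq; rewrite subr0.
  have dm := is_deriveM dt (is_derive_cst (g y) t (1 : R)).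
  suff <- : psi (t *: delta_mx 0 i + x - y) *: 0 + cst (g y) t *:
     partial i psi (t *: delta_mx 0 i + x - y) =
     partial i psi (t *: delta_mx 0 i + x - y) * g y by exact: dm.
  by rewrite scaler0 add0r /GRing.scale/= mulrC.
have d1f t y : partial1of2 f t y = partial i psi (t *: delta_mx 0 i + x - y) * g y.
  by rewrite partial1of2E; exact: derive_val.
have dF : h^-1 *: ((fun t : R => \int[leb]_y f t y) (h + 0) -
    (fun t : R => \int[leb]_y f t y) 0) @[h --> 0^'] --> \int[leb]_y partial1of2 f 0 y.
  apply: (@cvg_differentiation_under_integral R _ _ leb f setT measurableT 0 (-1) 1
    _ _ _ (fun y => C' * `|g y|)).
  - by rewrite /= in_itv/= ltrN10 ltr01.
  - by move=> t _; exact: (conv_integrable _ mpsi psiC ig).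
  - by move=> t y _ _; have [] := df t y.
  - by move=> y; rewrite mulr_ge0.
  - by apply: integrableZ_EFin => //; exact: integrable_norm.
  - by move=> t y _ _; rewrite d1f normrM ler_wpM2r.
apply/is_derive_line.
have Fcvg : h^-1 *: (((fun t : R => conv psi g (t *: delta_mx 0 i + x)) \o shift (0 : R)) (h *: (1 : R))
     - conv psi g ((0 : R) *: delta_mx 0 i + x)) @[h --> 0^'] --> conv (partial i psi) g x.
  rewrite (_ : conv (partial i psi) g x = \int[leb]_y partial1of2 f 0 y); last first.
    by apply: eq_Rintegral => y _; rewrite d1f scale0r add0r.
  rewrite [X in X @ _ --> _](_ : _ = (fun h : R =>
    h^-1 *: (\int[leb]_y f (h + 0) y - \int[leb]_y f 0 y))); first exact: dF.
  by apply/funext => h; rewrite /= [h *: 1]mulr1.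
split; first by apply/cvg_ex; exists (conv (partial i psi) g x).
exact/cvg_lim.
Qed.

Lemma partial_conv psi g e i : smooth psi -> support_in e psi ->
  leb.-integrable setT (EFin \o g) ->
  partial i (conv psi g) = conv (partial i psi) g.
Proof.
move=> spsi epsi ig; apply/funext => x; rewrite {1}/partial.
by have := is_derive_conv i x spsi epsi ig => d; exact: derive_val.
Qed.

Lemma conv_smooth psi g e : smooth psi -> support_in e psi ->
  leb.-integrable setT (EFin \o g) -> smooth (conv psi g).
Proof.
move=> spsi epsi ig; apply/smooth_uptoP => k; elim: k psi spsi epsi => [|k IH] psi spsi epsi.
  by split=> //; apply: (conv_continuous _ epsi ig); exact: smooth_continuous.
split; first by apply: (conv_continuous _ epsi ig); exact: smooth_continuous.
move=> i; exists (conv (partial i psi) g); first by move=> x; exact: (is_derive_conv _ _ spsi epsi ig).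
by apply: IH; [exact: smooth_partial|exact: support_in_partial].
Qed.

Lemma conv_eq0 psi g e x : support_in e psi ->
  (forall y, `|x - y| <= e -> g y = 0) -> conv psi g x = 0.
Proof.
move=> epsi g0; rewrite /conv (@eq_Rintegral _ _ _ _ _ (cst 0)).
  by rewrite Rintegral_cst// mul0r.
move=> y _ /=; have [xy|xy] := leP `|x - y| e; first by rewrite g0// mulr0.
by rewrite epsi// mul0r.
Qed.

(** By Fubini's theorem and a change of variables, the difference of the two
    integrals is an average over [s], weighted by the mollifier, of integrals of
    [b] times an increment of [a] by [s + h]. *)
Lemma conv_test a b h e d eps : 0 < e -> `|h| + e <= d ->
  measurable_fun setT a -> leb.-integrable setT (EFin \o b) ->
  leb.-integrable setT (EFin \o (fun x => a x * b x)) ->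
  (forall s, `|s| < d ->
    (\int[leb]_y (`|b y| * `|a (y + s)%R - a y|)%R%:E <= eps%:E)%E) ->
  leb.-integrable setT (EFin \o (fun x => a x * conv (moll e) b (x - h))) /\
  `|\int[leb]_x (a x * conv (moll e) b (x - h)) - \int[leb]_x (a x * b x)| <= eps.
Proof.
move=> e0 hed ma ib iab corr.
have mb : measurable_fun setT b by exact: integrable_measurable ib.
have mmoll := continuous_measurable (smooth_continuous (moll_smooth e)).
have [C C0 mollC] := support_in_bounded (smooth_continuous (moll_smooth e)) (@moll_support e).
(* [H] integrates to the first integral, [G] to the second, and [F] is their
   difference. *)
pose r (z : 'rV[R]_n * 'rV[R]_n) := moll e (z.1 - h - z.2).
pose H z := r z * (a z.1 * b z.2).
pose G z := r z * (a z.2 * b z.2).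
pose F z := r z * ((a z.1 - a z.2) * b z.2).
have msec (X : 'rV[R]_n * 'rV[R]_n -> R) y : measurable_fun setT X ->
    measurable_fun setT (fun x => X (x, y)).
  by move=> mX; apply: (measurableT_comp mX); exact: pair2_measurable.
have mz1 : measurable_fun setT (fun z : 'rV[R]_n * 'rV[R]_n => z.1) by exact: measurable_fst.
have mz2 : measurable_fun setT (fun z : 'rV[R]_n * 'rV[R]_n => z.2) by exact: measurable_snd.
have mr : measurable_fun setT r.
  apply: (measurableT_comp mmoll); apply: (@measurable_rV_add R).
    exact: (@measurable_rV_add R _ _ n (fun z => z.1) (fun=> - h)).
  exact: (@measurable_rV_opp R _ _ n (fun z => z.2)).
have ma1 : measurable_fun setT (fun z : 'rV[R]_n * 'rV[R]_n => a z.1) by exact: measurableT_comp.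
have ma2 : measurable_fun setT (fun z : 'rV[R]_n * 'rV[R]_n => a z.2) by exact: measurableT_comp.
have mb2 : measurable_fun setT (fun z : 'rV[R]_n * 'rV[R]_n => b z.2) by exact: measurableT_comp.
have mG : measurable_fun setT G by do 2 apply: measurable_funM => //.
have mF : measurable_fun setT F.
  by do 2 apply: measurable_funM => //; exact: measurable_funB.
have slice y : (\int[leb]_x (r (x, y))%:E = 1)%E.
  transitivity (\int[leb]_x (moll e (x + (- h - y))%R)%:E)%E.
    by apply: eq_integral => x _; rewrite /r/= addrA.
  apply: etrans (moll_integralE e0).
  exact: (@ge0_Rintegral_translate R n (moll e) (- h - y) mmoll (moll_ge0 e)).
pose leb2 := (lebesgue_rV_sf \x lebesgue_rV_sf)%E : {measure set ('rV[R]_n * 'rV[R]_n) -> \bar R}.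
have FE : (\int[leb]_y \int[leb]_x `|F (x, y)|%:E <= eps%:E)%E.
  rewrite (_ : (\int[leb]_y _)%E = (\int[leb]_y \int[leb]_s
      (moll e s * (`|b y| * `|a (y + (s + h))%R - a y|))%R%:E)%E); last first.
    apply: eq_integral => y _.
    have mFy : measurable_fun setT (fun x => `|F (x, y)|).
      by apply: measurableT_comp => //; exact: msec.
    have := @ge0_Rintegral_translate R n (fun x => `|F (x, y)|) (h + y) mFy (fun=> normr_ge0 _).
    move=> <-; apply: eq_integral => s _; congr EFin; rewrite /F /r/= (normrM (moll _ _)) (normrM (_ - _)).
    rewrite (ger0_norm (moll_ge0 _ _)) [`|b y| * _]mulrC.
    have e1 : s + (h + y) - h - y = s by rewrite -(addrA _ (- h)) -opprD addrK.
    have e2 : s + (h + y) = y + (s + h) by rewrite addrA addrC.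
    by rewrite e1 e2.
  have eps0 : 0 <= eps.
    have := corr 0; rewrite normr0 => /(_ (lt_le_trans _ hed)) E.
    rewrite -lee_fin; apply: le_trans (E _); last by rewrite ltr_wpDl.
    by apply: integral_ge0 => y _; rewrite lee_fin mulr_ge0.
  pose K (z : 'rV[R]_n * 'rV[R]_n) :=
    moll e z.2 * (`|b z.1| * `|a (z.1 + (z.2 + h)) - a z.1|).
  have K0 z : 0 <= K z by rewrite /K mulr_ge0 ?moll_ge0// mulr_ge0.
  have mK : measurable_fun setT K.
    apply: measurable_funM; first exact: (measurableT_comp mmoll mz2).
    apply: measurable_funM.
      by apply: measurableT_comp => //; exact: (measurableT_comp mb mz1).
    apply: measurableT_comp => //; apply: measurable_funB.
      apply: (measurableT_comp ma); apply: (@measurable_rV_add R) => //.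
      exact: (@measurable_rV_add R _ _ n (fun z => z.2) (fun=> h)).
    exact: (measurableT_comp ma mz1).
  have mEK : measurable_fun setT (fun z => (K z)%:E) by exact/measurable_EFinP.
  have EK0 z : (0 <= (K z)%:E)%E by rewrite lee_fin.
  rewrite [leLHS](lebesgue_tonelli mEK EK0).
  rewrite -[leRHS]mule1 -(moll_integralE e0) -ge0_integralM_EFin//; last by move=> s _; exact: moll_ge0.
  apply: ge0_le_integral => //.
  - by move=> s _; apply: integral_ge0 => y _; rewrite lee_fin.
  - exact: (@measurable_fun_fubini_tonelli_G _ _ _ _ _ lebesgue_rV_sf (fun z => (K z)%:E)).
  - by apply/measurable_EFinP; exact: measurable_funM.
  move=> s _; rewrite /K/= ge0_integralM_EFin ?moll_ge0//; last first.
    apply: measurable_funM; first exact: measurableT_comp.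
    exact: measurable_increment.
  have [se|es] := ltP `|s| e; last by rewrite moll_eq0// mul0e mulr0.
  rewrite (mulrC eps) (EFinM (moll e s)); apply: lee_wpmul2l; first by rewrite lee_fin moll_ge0.
  apply: corr; apply: le_lt_trans (ler_normD _ _) _.
  by apply: lt_le_trans hed; rewrite addrC ltrD2l.
have iF : leb2.-integrable setT (EFin \o F).
  apply/(@integrable21ltyP _ _ _ _ _ lebesgue_rV_sf lebesgue_rV_sf); first exact/measurable_EFinP.
  by apply: le_lt_trans FE _; exact: ltry.
have FE2 : (\int[leb2]_z `|(EFin \o F) z| <= eps%:E)%E.
  by rewrite (fubini_tonelli2 (fun z => `|(EFin \o F) z|%E))//; exact/measurableT_comp/measurable_EFinP.
have iG : leb2.-integrable setT (EFin \o G).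
  apply/(@integrable21ltyP _ _ _ _ _ lebesgue_rV_sf lebesgue_rV_sf); first exact/measurable_EFinP.
  rewrite (eq_integral (fun y => (`|a y * b y|)%:E)).
    by case/integrableP: iab.
  move=> y _ /=.
  transitivity (\int[leb]_x (`|a y * b y| * r (x, y))%:E)%E.
    apply: eq_integral => x _; congr EFin; rewrite /G/= (normrM (r _)) mulrC.
    by rewrite (ger0_norm (moll_ge0 _ _)).
  rewrite ge0_integralM_EFin//; try by [exact: msec|move=> x _; exact: moll_ge0].
  by rewrite slice mule1.
have HE : H = (fun z => F z + G z) by apply/funext => z; rewrite /H/F/G; ring.
have iH : leb2.-integrable setT (EFin \o H).
  by rewrite HE; exact: integrableD_EFin.
have HF x : (fubini_F lebesgue_rV_sf (EFin \o H) x = (a x * conv (moll e) b (x - h))%:E)%E.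
  rewrite /fubini_F/= /conv -RintegralZl//; last exact: (conv_integrable _ mmoll mollC ib).
  rewrite /Rintegral fineK; last first.
    apply: integrable_fin_num => //.
    by apply: integrableZ_EFin => //; exact: (conv_integrable _ mmoll mollC ib).
  apply: eq_integral => y _; congr EFin; rewrite /H/r/=; ring.
have iaconv : leb.-integrable setT (EFin \o (fun x => a x * conv (moll e) b (x - h))).
  have := integrable_fubini_F iH; rewrite (_ : fubini_F _ _ = EFin \o (fun x => a x * conv (moll e) b (x - h)))//.
  by apply/funext => x; rewrite HF.
split => //.
have GE : (\int[leb2]_z (G z)%:E = \int[leb]_y (a y * b y)%:E)%E.
  rewrite -(integral21_prod_meas1 iG); apply: eq_integral => y _.
  rewrite /fubini_G /=.
  have -> : (fun x : 'rV[R]_n => (G (x, y))%:E) = (fun x => ((a y * b y)%:E * (r (x, y))%:E)%E).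
    by apply/funext => x; rewrite /G/= mulrC EFinM.
  rewrite integralZl ?slice ?mule1//.
  apply/integrableP; split.
    by apply/measurable_EFinP; exact: msec.
  rewrite (eq_integral (fun x => (r (x, y))%:E)) ?slice ?ltry//.
  by move=> x _ /=; rewrite ger0_norm// moll_ge0.
have HH : (\int[leb2]_z (H z)%:E = \int[leb]_x (a x * conv (moll e) b (x - h))%:E)%E.
  by rewrite -(integral12_prod_meas1 iH); apply: eq_integral => x _; rewrite HF.
rewrite -lee_fin; apply: le_trans FE2.
rewrite (_ : _ - _ = \int[leb2]_z F z).
  apply: le_trans (le_abse_integral leb2 measurableT _); last by case/integrableP: iF.
  by rewrite (EFin_normr_Rintegral measurableT iF).
rewrite /Rintegral -HH -GE -/(Rintegral leb2 setT H) -/(Rintegral leb2 setT G).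
by rewrite -RintegralB//; apply: eq_Rintegral => z _; rewrite /H/G/F; ring.
Qed.

End mollifier.

(** * Euclidean norm *)

Section euclidean_norm.
Context {R : realType} {n : nat}.
Implicit Types (u v w : 'rV[R]_n) (k : R).

Lemma dotC v w : dot v w = dot w v.
Proof. by apply: eq_bigr => i _; rewrite mulrC. Qed.

Lemma dotDl u v w : dot (u + v) w = dot u w + dot v w.
Proof. by rewrite /dot -big_split; apply: eq_bigr => i _ /=; rewrite mxE mulrDl. Qed.

Lemma dotZl k v w : dot (k *: v) w = k * dot v w.
Proof. by rewrite /dot big_distrr; apply: eq_bigr => i _ /=; rewrite mxE mulrA. Qed.

Lemma dotDr u v w : dot u (v + w) = dot u v + dot u w.
Proof. by rewrite dotC dotDl !(dotC u). Qed.

Lemma dotZr k v w : dot v (k *: w) = k * dot v w.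
Proof. by rewrite dotC dotZl dotC. Qed.

Lemma dotvv_ge0 v : 0 <= dot v v.
Proof. by apply: sumr_ge0 => i _; rewrite -expr2 sqr_ge0. Qed.

Lemma enorm_ge0 v : 0 <= enorm v. Proof. exact: sqrtr_ge0. Qed.

Lemma enorm_sqr v : enorm v ^+ 2 = dot v v.
Proof. by rewrite sqr_sqrtr// dotvv_ge0. Qed.

Lemma enorm_coord v (i : 'I_n) : `|v 0 i| <= enorm v.
Proof.
rewrite -(ler_pXn2r (n := 2))// ?nnegrE ?enorm_ge0// enorm_sqr real_normK ?num_real//.
rewrite /dot (bigD1 i)//= -expr2 lerDl; apply: sumr_ge0 => j _.
by rewrite -expr2 sqr_ge0.
Qed.

Lemma enorm_le_sum v : enorm v <= \sum_i `|v 0 i|.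
Proof.
rewrite -(ler_pXn2r (n := 2))// ?nnegrE ?enorm_ge0 ?sumr_ge0//.
rewrite enorm_sqr /dot expr2 big_distrl; apply: ler_sum => i _ /=.
rewrite -expr2 -(real_normK (num_real (v 0 i))) expr2 ler_wpM2l//.
by rewrite (bigD1 i)//= lerDl sumr_ge0.
Qed.

Lemma enorm_eq0 v : enorm v = 0 -> v = 0.
Proof.
move=> v0; apply/rowP => i; rewrite mxE; apply/eqP.
by rewrite -normr_le0 -v0 enorm_coord.
Qed.

Lemma dot_le_enorm v w : dot v w <= enorm v * enorm w.
Proof.
have [v0|v0] := eqVneq (enorm v) 0.
  by rewrite v0 mul0r (enorm_eq0 v0) /dot big1// => i _; rewrite mxE mul0r.
have [w0|w0] := eqVneq (enorm w) 0.
  by rewrite w0 mulr0 (enorm_eq0 w0) /dot big1// => i _; rewrite mxE mulr0.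
have vp : 0 < enorm v by rewrite lt_neqAle eq_sym v0 enorm_ge0.
have wp : 0 < enorm w by rewrite lt_neqAle eq_sym w0 enorm_ge0.
have := dotvv_ge0 (enorm w *: v + (- enorm v) *: w).
rewrite dotDl !dotDr !dotZl !dotZr -!enorm_sqr (dotC w v) => h.
rewrite -(ler_pM2l (mulr_gt0 vp wp)); move: h; set x := dot v w; nra.
Qed.

Lemma enormD v w : enorm (v + w) <= enorm v + enorm w.
Proof.
rewrite -(ler_pXn2r (n := 2))// ?nnegrE ?addr_ge0 ?enorm_ge0//.
rewrite enorm_sqr dotDl !dotDr -!enorm_sqr (dotC w v) sqrrD.
have := dot_le_enorm v w; lra.
Qed.

Lemma enormZ k v : enorm (k *: v) = `|k| * enorm v.
Proof. by rewrite /enorm dotZl dotZr mulrA -expr2 sqrtrM ?sqr_ge0// sqrtr_sqr. Qed.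

Lemma enorm0 : enorm (0 : 'rV[R]_n) = 0.
Proof. by rewrite -(scale0r 0) enormZ normr0 mul0r. Qed.

Lemma enorm_sum I (s : seq I) (F : I -> 'rV[R]_n) :
  enorm (\sum_(i <- s) F i) <= \sum_(i <- s) enorm (F i).
Proof.
elim: s => [|i s IH]; first by rewrite !big_nil enorm0.
by rewrite !big_cons (le_trans (enormD _ _))// lerD2l.
Qed.

End euclidean_norm.

(** * Integrals over a subset *)

Section integral_indic_tools.
Context d (T : measurableType d) (R : realType) (mu : {measure set T -> \bar R}).
Implicit Types (D : set T) (f : T -> R).

Lemma restrict_indicE D f x : (f \_ D) x = f x * \1_D x.
Proof. by rewrite patchE indicE; case: ifPn => _; rewrite ?mulr1 ?mulr0. Qed.

Lemma Rintegral_indic D f : \int[mu]_(x in D) f x = \int[mu]_x (f x * \1_D x).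
Proof. by rewrite Rintegral_mkcond; apply: eq_Rintegral => x _; rewrite restrict_indicE. Qed.

Lemma measurable_mul_indic D f : measurable D -> measurable_fun D f ->
  measurable_fun setT (fun x => f x * \1_D x).
Proof.
move=> mD /(measurable_restrictT f mD); congr measurable_fun.
by apply/funext => x; rewrite restrict_indicE.
Qed.

Lemma integrable_mul_indic D f : measurable D ->
  mu.-integrable D (EFin \o f) <->
  mu.-integrable setT (EFin \o (fun x => f x * \1_D x)).
Proof.
move=> mD; rewrite (integrable_mkcond _ mD) restrict_EFin.
suff -> : f \_ D = (fun x => f x * \1_D x) by [].
by apply/funext => x; rewrite restrict_indicE.
Qed.

Lemma Rintegral_subset D E f : E `<=` D ->
  \int[mu]_(x in D) (f x * \1_E x) = \int[mu]_(x in E) f x.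
Proof.
move=> ED; rewrite (Rintegral_indic D) (Rintegral_indic E); apply: eq_Rintegral => x _.
rewrite -mulrA; congr (_ * _); rewrite !indicE; have [xE|xE] := pselect (E x).
  by rewrite (mem_set xE) (mem_set (ED _ xE)) mulr1.
by rewrite (memNset xE) mul0r.
Qed.

Lemma sqr_mul_indic D f : (fun x => (f x * \1_D x) ^+ 2) = (fun x => f x ^+ 2 * \1_D x).
Proof.
apply/funext => x; rewrite exprMn; congr (_ * _).
by rewrite indicE; case: (_ \in _); rewrite ?expr1n ?expr0n.
Qed.

Lemma Rintegral_sum D I (s : seq I) (F : I -> T -> R) : measurable D ->
  (forall i, mu.-integrable D (EFin \o F i)) ->
  mu.-integrable D (EFin \o (fun x => \sum_(i <- s) F i x)) /\
  \int[mu]_(x in D) (\sum_(i <- s) F i x) = \sum_(i <- s) \int[mu]_(x in D) F i x.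
Proof.
move=> mD iF; elim: s => [|i s [IH1 IH2]].
  rewrite big_nil; under eq_fun do rewrite big_nil; split.
    exact: integrable0.
  by rewrite Rintegral_cst// mul0r.
under eq_fun do rewrite big_cons; split; first exact: integrableD_EFin.
by rewrite RintegralD// IH2 big_cons.
Qed.

Lemma square_integrable_integrable D f : measurable D -> (mu D < +oo)%E ->
  measurable_fun D f -> mu.-integrable D (EFin \o (fun x => f x ^+ 2)) ->
  mu.-integrable D (EFin \o f).
Proof.
move=> mD Doo mf if2.
apply: (@dominated_integrable _ _ _ _ _ _ (fun x => 1 + f x ^+ 2)) => //.
  apply: integrableD_EFin => //.
  apply/integrableP; split; first exact/measurable_EFinP.
  rewrite (eq_integral (fun=> 1%:E)); last by move=> x _ /=; rewrite normr1.
  by rewrite integral_cst// mul1e.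
move=> x _; have := sqr_ge0 (`|f x| - 1); rewrite sqrrB1 real_normK ?num_real//.
have := normr_ge0 (f x); lra.
Qed.

Lemma integrable_prod_square D f (g : T -> R) : measurable D ->
  measurable_fun D f -> measurable_fun D g ->
  mu.-integrable D (EFin \o (fun x => f x ^+ 2)) ->
  mu.-integrable D (EFin \o (fun x => g x ^+ 2)) ->
  mu.-integrable D (EFin \o (fun x => f x * g x)).
Proof.
move=> mD mf mg if2 ig2.
apply: (@dominated_integrable _ _ _ _ _ _ (fun x => f x ^+ 2 + g x ^+ 2)) => //.
- exact: measurable_funM.
- exact: integrableD_EFin.
move=> x _; rewrite normrM -[f x ^+ 2]real_normK ?num_real// -[g x ^+ 2]real_normK ?num_real//.
have := sqr_ge0 (`|f x| - `|g x|); have := sqr_ge0 (`|f x|); have := sqr_ge0 `|g x|; nra.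
Qed.

End integral_indic_tools.

(** * One piece of the regularized field *)

Section piece.
Context {R : realType} {n : nat}.
Hypothesis n_gt0 : (0 < n)%N.
Local Notation leb := (@lebesgue_rV R n).
Variables (D : set 'rV[R]_n) (z : 'rV[R]_n -> 'rV[R]_n) (f : 'rV[R]_n -> R).
Hypothesis D_open : open D.
Hypothesis D_bounded : bounded_set D.
Hypothesis mz : forall i, measurable_fun setT (fun x => z x 0 i).
Hypothesis z_le1 : forall x, enorm (z x) <= 1.
Hypothesis z_out : forall x, ~ D x -> z x = 0.
Hypothesis f_L2 : in_L2 D f.
Hypothesis div_z : distributional_div D z f.

Variable eta : 'rV[R]_n -> R.
Hypothesis eta_smooth : smooth eta.
Hypothesis eta_ge0 : forall x, 0 <= eta x.
Variable M : R.
Hypothesis eta_support : support_in M eta.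

Let mD : measurable D. Proof. exact: mx_open_measurable. Qed.

Let D_finite : (leb D < +oo)%E. Proof. exact: lebesgue_bounded_lty. Qed.

Let z_coord_le1 x i : `|z x 0 i| <= 1.
Proof. exact: le_trans (enorm_coord _ _) (z_le1 x). Qed.

Let c_eta : continuous eta. Proof. exact: smooth_continuous. Qed.

Let m_eta : measurable_fun setT eta. Proof. exact: continuous_measurable. Qed.

Let eta_integrable : leb.-integrable setT (EFin \o eta).
Proof. exact: continuous_support_integrable eta_support. Qed.

(** The divergence of a cut-off field is integrable, but a mollification of it
    near the boundary of [D] would see the jump of the field across that boundary.
    Hence the extra translation in [piece]. *)
Definition cut_field i x : R := eta x * z x 0 i.

Lemma cut_field_measurable i : measurable_fun setT (cut_field i).
Proof. exact: measurable_funM. Qed.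

Lemma cut_field_le i x : `|cut_field i x| <= eta x.
Proof. by rewrite /cut_field normrM (ger0_norm (eta_ge0 x)) ler_piMr. Qed.

Lemma cut_field_integrable i : leb.-integrable setT (EFin \o cut_field i).
Proof.
apply: (dominated_integrable measurableT (cut_field_measurable i) eta_integrable).
by move=> x _; exact: cut_field_le.
Qed.

Definition piece e h i x : R := conv (moll e) (cut_field i) (x - h).

Lemma piece_smooth e h i : smooth (piece e h i).
Proof.
apply: (smooth_translate (- h) (f := conv (moll e) (cut_field i))).
by apply: (conv_smooth (moll_smooth e) (@moll_support _ _ n_gt0 e)); exact: cut_field_integrable.
Qed.

Lemma piece_support e h i x : piece e h i x != 0 ->
  exists2 y, D y & `|x - y| <= `|h| + e.
Proof.
move=> px; apply: contrapT => nP; move/negP: px; apply; apply/eqP.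
apply: (conv_eq0 (@moll_support _ _ n_gt0 e)) => y xy.
rewrite /cut_field; have [Dy|nDy] := pselect (D y); last by rewrite z_out// mxE mulr0.
exfalso; apply: nP; exists y => //.
rewrite (_ : x - y = h + (x - h - y)); last by rewrite addrA (addrC h) subrK.
by rewrite (le_trans (ler_normD _ _))// lerD2l.
Qed.

Lemma moll_conv_integrable e g x : leb.-integrable setT (EFin \o g) ->
  leb.-integrable setT (EFin \o (fun y => moll e (x - y) * g y)).
Proof.
have cm := smooth_continuous (@moll_smooth R n e).
have [C C0 mC] := support_in_bounded cm (@moll_support _ _ n_gt0 e).
by apply: conv_integrable mC; exact: continuous_measurable.
Qed.

(** Minkowski's inequality for integrals, obtained by testing the vector [q]
    against itself. *)
Lemma piece_enorm e h x :
  enorm (\row_i piece e h i x) <= conv (moll e) eta (x - h).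
Proof.
set q := \row_i piece e h i x.
have conv_ge0 : 0 <= conv (moll e) eta (x - h).
  by apply: Rintegral_ge0 => y _; rewrite mulr_ge0// moll_ge0.
suff : enorm q ^+ 2 <= enorm q * conv (moll e) eta (x - h).
  have [->|q0] := eqVneq (enorm q) 0; first by [].
  by rewrite expr2 ler_pM2l// lt_neqAle eq_sym q0 enorm_ge0.
have ip i : leb.-integrable setT (EFin \o (fun y => q 0 i * (moll e (x - h - y) * cut_field i y))).
  by apply: integrableZ_EFin => //; exact: moll_conv_integrable (cut_field_integrable i).
have -> : enorm q ^+ 2 = \int[leb]_y \sum_i (q 0 i * (moll e (x - h - y) * cut_field i y)).
  rewrite enorm_sqr (Rintegral_sum _ _ ip).2//; apply: eq_bigr => i _.
  rewrite RintegralZl//; last exact: moll_conv_integrable (cut_field_integrable i).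
  by congr (_ * _); rewrite mxE.
rewrite /conv -RintegralZl//; last exact: moll_conv_integrable.
apply: le_Rintegral => //; first exact: (Rintegral_sum _ _ ip).1.
  by apply: integrableZ_EFin => //; exact: moll_conv_integrable.
move=> y _.
rewrite (_ : \sum_i _ = moll e (x - h - y) * eta y * dot q (z y)).
  rewrite mulrC ler_wpM2r//; first by apply: mulr_ge0; [exact: moll_ge0|].
  by rewrite (le_trans (dot_le_enorm _ _))// ler_piMr// enorm_ge0.
by rewrite /dot big_distrr; apply: eq_bigr => i _; rewrite /cut_field/=; ring.
Qed.

(** The divergence of [eta] times [z] inside [D], by the product rule. *)
Definition cut_div x : R := \sum_i z x 0 i * partial i eta x + eta x * (f x * \1_D x).

Let f_measurable : measurable_fun setT (fun x => f x * \1_D x).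
Proof. by apply: measurable_mul_indic => //; case: f_L2. Qed.

Let f_square : leb.-integrable setT (EFin \o (fun x => (f x * \1_D x) ^+ 2)).
Proof.
rewrite sqr_mul_indic; apply/(integrable_mul_indic _ _ mD); exact: f_L2.2.
Qed.

Let f_integrable : leb.-integrable setT (EFin \o (fun x => f x * \1_D x)).
Proof.
apply: (integrable_mul_indic _ _ mD).1; apply: square_integrable_integrable => //.
- by case: f_L2.
- exact: f_L2.2.
Qed.

Let partial_integrable i : leb.-integrable setT (EFin \o (fun x => z x 0 i * partial i eta x)).
Proof.
have cp := smooth_continuous (smooth_partial i eta_smooth).
under eq_fun do rewrite mulrC; apply: (integrableM_bounded (C := 1)) => //.
by apply: (continuous_support_integrable cp); exact: support_in_partial eta_support.
Qed.

Let eta_f_integrable : leb.-integrable setT (EFin \o (fun x => eta x * (f x * \1_D x))).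
Proof.
have [C _ eC] := support_in_bounded c_eta eta_support.
by under eq_fun do rewrite mulrC; exact: (integrableM_bounded (C := C)).
Qed.

Lemma cut_div_integrable : leb.-integrable setT (EFin \o cut_div).
Proof.
apply: integrableD_EFin => //.
exact: (Rintegral_sum _ measurableT partial_integrable).1.
Qed.

(** Integrating by parts against the test function
    [y |-> moll e (x - h - y) * eta y], which is supported in [D]. *)
Lemma piece_div e h x : 0 < e ->
  ((exists2 y, eta y != 0 & `|x - h - y| < e) ->
    forall y, `|x - h - y| <= e -> D y) ->
  \sum_i partial i (piece e h i) x = conv (moll e) cut_div (x - h).
Proof.
move=> e0 xD.
pose psi y := moll e (x - h - y) * eta y.
pose rho y : R := moll e (y + (h - x)).
have rhoE y : moll e (x - h - y) = rho y.
  by rewrite /rho -mollN; congr (moll e _); rewrite opprD opprK opprB addrC.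
have srho : smooth rho by exact: smooth_translate (moll_smooth e).
have psiE : psi = (fun y => rho y * eta y) by apply/funext => y; rewrite /psi rhoE.
have spsi : smooth psi by rewrite psiE; exact: smoothM.
have drho i y : partial i rho y = - partial i (moll e) (x - h - y).
  rewrite partial_translate; last exact: moll_smooth.
  have -> : x - h - y = - (y + (h - x)) by rewrite opprD opprB addrC.
  by rewrite partial_mollN opprK.
have dpsi i y : partial i psi y =
    moll e (x - h - y) * partial i eta y - partial i (moll e) (x - h - y) * eta y.
  by rewrite psiE partialM// drho -rhoE mulrN mulrC [eta y * _]mulrC.
have tpsi : test_function D psi.
  have [ex|nex] := pselect (exists2 y, eta y != 0 & `|x - h - y| < e).
    have sub : closure [set y | psi y != 0] `<=` [set y | `|x - h - y| <= e].
      have cl : closed [set y : 'rV[R]_n | `|x - h - y| <= e].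
        rewrite (_ : [set _ | _] = (fun y : 'rV[R]_n => `|x - h - y|) @^-1` [set t | t <= e])//.
        apply: closed_comp; last exact: closed_le.
        move=> y _; apply: (@continuous_comp _ _ _ (fun y : 'rV[R]_n => x - h - y) (fun y => `|y|)); last exact: norm_continuous.
        exact: (@cvgB R 'rV[R]_n 'rV[R]_n (nbhs y) (nbhs_filter y) (fun=> x - h)
          (fun y => y) (x - h) y (@cvg_cst _ _ _ _ _) (@cvg_id _ _)).
      rewrite [X in _ `<=` X](closure_id _).1//; apply: closure_subset => y /= py.
      by rewrite leNgt; apply: contra py => /ltW ey; rewrite /psi moll_eq0// mul0r.
    split=> //; last by move=> y /sub; exact: xD.
    apply: bounded_closed_compact; last exact: closed_closure.
    exists (`|x - h| + e); split; first exact: num_real.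
    move=> r hr y /sub /= ye; apply: ltW; apply: le_lt_trans hr.
    by rewrite -[y in `|y|](subKr (x - h)) (le_trans (ler_normB _ _))// lerD2l.
  have psi0 y : psi y = 0.
    rewrite /psi; have [->|ey] := eqVneq (eta y) 0; first by rewrite mulr0.
    rewrite moll_eq0 ?mul0r// leNgt; apply/negP => ye.
    by apply: nex; exists y.
  have supp0 : [set y | psi y != 0] = set0.
    by apply/seteqP; split=> // y /=; rewrite psi0 eqxx.
  by split=> //; rewrite supp0 closure0//; exact: compact0.
have := div_z tpsi; rewrite 2!(Rintegral_indic _ D).
have -> : (fun y => f y * psi y * \1_D y) = (fun y => moll e (x - h - y) * (eta y * (f y * \1_D y))).
  by apply/funext => y; rewrite /psi; ring.
have -> : (fun y => dot (z y) (grad psi y) * \1_D y) = (fun y =>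
    \sum_i (moll e (x - h - y) * (z y 0 i * partial i eta y)) -
    \sum_i (partial i (moll e) (x - h - y) * cut_field i y)).
  apply/funext => y; rewrite -sumrB /dot indicE.
  have [Dy|nDy] := pselect (D y).
    rewrite mem_set// mulr1; apply: eq_bigr => i _.
    by rewrite mxE dpsi /cut_field; ring.
  rewrite memNset// mulr0 big1// => i _.
  by rewrite /cut_field z_out// mxE !(mulr0, mul0r) subrr.
have i1 i : leb.-integrable setT (EFin \o (fun y => moll e (x - h - y) * (z y 0 i * partial i eta y))).
  exact: moll_conv_integrable.
have i2 i : leb.-integrable setT (EFin \o (fun y => partial i (moll e) (x - h - y) * cut_field i y)).
  have cm := smooth_continuous (smooth_partial i (@moll_smooth R n e)).
  have [C C0 mC] := support_in_bounded cm (support_in_partial i (@moll_support _ _ n_gt0 e)).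
  by apply: conv_integrable mC (cut_field_integrable i); exact: continuous_measurable.
have [I1 E1] := Rintegral_sum (index_enum 'I_n) measurableT i1.
have [I2 E2] := Rintegral_sum (index_enum 'I_n) measurableT i2.
rewrite RintegralB// E1 E2 => E.
have -> : \sum_i partial i (piece e h i) x = \sum_i \int[leb]_y (partial i (moll e) (x - h - y) * cut_field i y).
  apply: eq_bigr => i _; rewrite /piece partial_translate; last first.
    by apply: (conv_smooth (moll_smooth e) (@moll_support _ _ n_gt0 e)); exact: cut_field_integrable.
  by rewrite (partial_conv i (moll_smooth e) (@moll_support _ _ n_gt0 e) (cut_field_integrable i)).
rewrite /conv /cut_div.
have -> : (fun y => moll e (x - h - y) * (\sum_i z y 0 i * partial i eta y + eta y * (f y * \1_D y))) =
  (fun y => \sum_i (moll e (x - h - y) * (z y 0 i * partial i eta y)) + moll e (x - h - y) * (eta y * (f y * \1_D y))).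
  by apply/funext => y; rewrite mulrDr big_distrr.
rewrite RintegralD//; last exact: moll_conv_integrable.
by rewrite E1; move: E; lra.
Qed.

(** The mollification scale [c * t] is a fixed multiple of the translation length
    [t], as the inner cones require; both tend to [0], and then the uniform
    continuity of [eta] keeps the size of the field under control. *)
Lemma conv_eta_le (v : 'rV[R]_n) (c : R) eps : 0 < c -> 0 < eps ->
  \forall t \near 0^'+, forall x,
    conv (moll (c * t)) eta (x + t *: v) <= eta x + eps.
Proof.
move=> c0 eps0.
have [d d0 dP] := support_in_uniform_continuous c_eta eta_support eps0.
have K0 : 0 < `|v| + c by rewrite ltr_wpDl.
near=> t.
have t0 : 0 < t by [].
have td : t * (`|v| + c) < d by rewrite -ltr_pdivlMr//; near: t; apply: nbhs_right_lt; rewrite divr_gt0.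
move=> x; have ct0 : 0 < c * t by rewrite mulr_gt0.
have im := moll_reflect_integrable n_gt0 (c * t) (x + t *: v).
rewrite -[leRHS]mulr1 -(moll_integral_reflect n_gt0 (x + t *: v) ct0) -RintegralZl//.
apply: le_Rintegral => //; [exact: moll_conv_integrable|exact: integrableZ_EFin|].
move=> y _; rewrite mulrC.
have [xy|xy] := ltP `|x + t *: v - y| (c * t); last by rewrite moll_eq0// !mulr0.
rewrite ler_wpM2r ?moll_ge0//.
suff : `|eta y - eta x| <= eps by rewrite ler_norml => /andP[_]; lra.
apply: dP; apply: le_lt_trans td.
rewrite (_ : y - x = t *: v - (x + t *: v - y)); last first.
  by apply/rowP => i; rewrite !mxE; ring.
apply: le_trans (ler_normB _ _) _; rewrite normrZ (gtr0_norm t0) mulrDr lerD2l mulrC.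
exact: ltW.
Unshelve. all: by end_near. Qed.

Lemma piece_test (v : 'rV[R]_n) (c : R) i a eps : 0 < c -> 0 < eps ->
  leb.-integrable setT (EFin \o a) ->
  \forall t \near 0^'+,
    leb.-integrable setT (EFin \o (fun x => a x * piece (c * t) (- (t *: v)) i x)) /\
    `|\int[leb]_x (a x * piece (c * t) (- (t *: v)) i x) -
      \int[leb]_x (a x * cut_field i x)| <= eps.
Proof.
move=> c0 eps0 ia.
have [C C0 eC] := support_in_bounded c_eta eta_support.
have cC x : `|cut_field i x| <= C.
  by apply: le_trans (cut_field_le i x) _; rewrite (le_trans (ler_norm _)).
have ma : measurable_fun setT a by exact: integrable_measurable ia.
have [d d0 dP] := corr_tc_bounded ia (cut_field_measurable i) cC eps0.
have K0 : 0 < `|v| + c by rewrite ltr_wpDl.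
near=> t.
have t0 : 0 < t by [].
have := @conv_test _ _ n_gt0 a (cut_field i) (- (t *: v)) (c * t) d eps; apply => //.
- by rewrite mulr_gt0.
- rewrite normrN normrZ (gtr0_norm t0) [c * t]mulrC -mulrDr -ler_pdivlMr//.
  by near: t; apply: nbhs_right_le; rewrite divr_gt0.
- exact: cut_field_integrable.
- by apply: (integrableM_bounded (C := C)) => //; exact: cut_field_measurable.
Unshelve. all: by end_near. Qed.

Lemma cut_div_square : leb.-integrable setT (EFin \o (fun x => cut_div x ^+ 2)).
Proof.
have [C C0 eC] := support_in_bounded c_eta eta_support.
have mcut : measurable_fun setT cut_div.
  exact: integrable_measurable cut_div_integrable.
have /choice[K KP] i : exists K : R, 0 <= K /\ forall x, `|partial i eta x| <= K.
  have [K K0 pK] := support_in_bounded (smooth_continuous (smooth_partial i eta_smooth))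
    (support_in_partial i eta_support).
  by exists K.
pose S := \sum_i K i.
have S0 : 0 <= S by apply: sumr_ge0 => i _; case: (KP i).
pose q x := \sum_i z x 0 i * partial i eta x.
have qS x : `|q x| <= S.
  rewrite (le_trans (ler_norm_sum _ _ _))//; apply: ler_sum => i _.
  by rewrite normrM -[K i]mul1r ler_pM//; case: (KP i).
have iq : leb.-integrable setT (EFin \o q).
  exact: (Rintegral_sum _ measurableT partial_integrable).1.
apply: (@dominated_integrable _ _ _ _ _ _ (fun x => 2 * (S * `|q x|) + 2 * (C ^+ 2 * (f x * \1_D x) ^+ 2))) => //.
- exact: measurable_funX.
- apply: integrableD_EFin => //; apply: integrableZ_EFin => //; apply: integrableZ_EFin => //.
  exact: integrable_norm.
move=> x _; rewrite ger0_norm ?sqr_ge0// /cut_div -/(q x).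
set g := f x * \1_D x.
have h1 : q x ^+ 2 <= S * `|q x|.
  by rewrite -real_normK ?num_real// expr2 ler_wpM2r.
have h2 : (eta x * g) ^+ 2 <= C ^+ 2 * g ^+ 2.
  rewrite exprMn ler_wpM2r ?sqr_ge0// -real_normK ?num_real//.
  by rewrite ler_pXn2r ?nnegrE.
have := sqr_ge0 (q x - eta x * g); move: h1 h2; nra.
Qed.

Lemma piece_div_test (v : 'rV[R]_n) (c : R) w eps : 0 < c -> 0 < eps ->
  leb.-integrable setT (EFin \o w) ->
  leb.-integrable setT (EFin \o (fun x => w x ^+ 2)) ->
  \forall t \near 0^'+,
    leb.-integrable setT (EFin \o
      (fun x => w x * conv (moll (c * t)) cut_div (x + t *: v))) /\
    `|\int[leb]_x (w x * conv (moll (c * t)) cut_div (x + t *: v)) -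
      \int[leb]_x (w x * cut_div x)| <= eps.
Proof.
move=> c0 eps0 iw iw2.
have mw : measurable_fun setT w by exact: integrable_measurable iw.
have mcut : measurable_fun setT cut_div.
  exact: integrable_measurable cut_div_integrable.
have [d d0 dP] := corr_tc_L2 iw iw2 mcut cut_div_square eps0.
have K0 : 0 < `|v| + c by rewrite ltr_wpDl.
near=> t.
have t0 : 0 < t by [].
have := @conv_test _ _ n_gt0 w cut_div (- (t *: v)) (c * t) d eps.
rewrite opprK; apply => //.
- by rewrite mulr_gt0.
- rewrite normrN normrZ (gtr0_norm t0) [c * t]mulrC -mulrDr -ler_pdivlMr//.
  by near: t; apply: nbhs_right_le; rewrite divr_gt0.
- exact: cut_div_integrable.
- apply: integrable_prod_square => //.
  exact: cut_div_square.
Unshelve. all: by end_near. Qed.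

End piece.

(** * Smooth partitions of unity *)

Section partition_of_unity.
Context {R : realType} {n : nat}.
Hypothesis n_gt0 : (0 < n)%N.
Local Notation leb := (@lebesgue_rV R n).

(** Mollifying the indicators of a partition of a neighbourhood of [K] into
    small sets gives a partition of unity on [K], because mollification is
    linear and preserves constants. *)
Lemma smooth_partition (K : set 'rV[R]_n) (d : R) : compact K -> 0 < d ->
  exists N (p : 'I_N -> 'rV[R]_n) (eta : 'I_N -> 'rV[R]_n -> R) (M : 'I_N -> R),
  [/\ forall j, K (p j),
      forall j, [/\ smooth (eta j), forall x, 0 <= eta j x & support_in (M j) (eta j)],
      forall j x, eta j x != 0 -> `|x - p j| < d,
      forall x, \sum_j eta j x <= 1 &
      forall x, K x -> \sum_j eta j x = 1].
Proof.
move=> cK d0.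
have d4 : 0 < d / 4 by rewrite divr_gt0.
have [s sK Ks] := compact_finite_net cK (fun _ _ => d4).
pose N := size s.
pose p j := nth 0 s j.
pose B j : set 'rV[R]_n := ball (p j) (d / 2).
pose U k := \big[setU/set0]_(i < k) B i.
pose u k : 'rV[R]_n -> R := \1_(U k).
pose g k x : R := u k.+1 x - u k x.
have mB j : measurable (B j) by apply: mx_open_measurable; exact: ball_open.
have mU k : measurable (U k) by exact: bigsetU_measurable.
have u0 x : u 0%N x = 0 by rewrite /u /U big_ord0 indicE memNset.
have gB k x : 0 <= g k x <= \1_(B k) x.
  rewrite /g /u !indicE; have : U k `<=` U k.+1 by rewrite /U big_ord_recr/=; exact: subsetUl.
  have [xU|xU] := pselect (U k x) => UU.
    by rewrite (mem_set xU) (mem_set (UU _ xU)) subrr lexx ler0n.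
  rewrite (memNset xU) subr0 ler0n/= ler_nat.
  have [xB|xB] := pselect (B k x); first by rewrite (mem_set xB) leq_b1.
  by rewrite memNset// /U big_ord_recr/= => -[].
have g0 k x : 0 <= g k x by case/andP: (gB k x).
have gnB k x : ~ B k x -> g k x = 0.
  by move=> xB; apply/eqP; rewrite eq_le g0 andbT; case/andP: (gB k x); rewrite indicE memNset.
have mg k : measurable_fun setT (g k).
  by apply: measurable_funB; exact: measurable_indic.
have ig k : leb.-integrable setT (EFin \o g k).
  apply: (@bounded_support_integrable _ _ _ (`|p k| + d / 2) 1) => //.
    move=> x; rewrite ger0_norm//; case/andP: (gB k x) => _ /le_trans; apply.
    by rewrite indicE lern1 leq_b1.
  move=> x px; apply: gnB; rewrite /B -ball_normE/= => xp.
  have := ler_normD (x - p k) (p k); rewrite subrK (distrC x); move: xp px; lra.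
pose e := d / 4.
have smoll := @moll_smooth R n e.
have emoll := @moll_support R n n_gt0 e.
have ce : continuous (@moll R n e) by exact: smooth_continuous.
have [C C0 mC] := support_in_bounded ce emoll.
have mm := continuous_measurable ce.
have etaS (j : 'I_N) x : conv (moll e) (g j) x != 0 -> `|x - p j| < d.
  move=> ex; rewrite ltNge; apply/negP => dx; move/negP: ex; apply; apply/eqP.
  apply: (conv_eq0 emoll) => y xy; apply: gnB; rewrite /B -ball_normE/= => yp.
  have := ler_distD y x (p j); rewrite (distrC y); move: xy yp dx; rewrite /e; lra.
have sumE x : \sum_(j < N) conv (moll e) (g j) x = \int[leb]_y (moll e (x - y) * u N y).
  have [I1 E1] := Rintegral_sum (index_enum 'I_N) measurableT
     (fun j : 'I_N => conv_integrable x mm mC (ig j)).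
  rewrite -E1; apply: eq_Rintegral => y _; rewrite -big_distrr/=; congr (_ * _).
  rewrite /g -(big_mkord xpredT (fun j => u j.+1 y - u j y)) telescope_sumr//.
  by rewrite u0 subr0.
have iu x : leb.-integrable setT (EFin \o (fun y => moll e (x - y) * u N y)).
  have := (Rintegral_sum (index_enum 'I_N) measurableT
     (fun j : 'I_N => conv_integrable x mm mC (ig j))).1.
  congr (_.-integrable); apply/funext => y /=; rewrite -big_distrr/=; congr ((_ * _)%:E).
  rewrite /g -(big_mkord xpredT (fun j => u j.+1 y - u j y)) telescope_sumr//.
  by rewrite u0 subr0.
have im x := moll_reflect_integrable n_gt0 e x.
have e0 : 0 < e by [].
exists N, (fun j => p j), (fun j => conv (moll e) (g j)), (fun j => `|p j| + d); split.
- by move=> j; apply: sK; exact: mem_nth.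
- move=> j; split.
  + exact: conv_smooth smoll emoll (ig j).
  + by move=> x; apply: Rintegral_ge0 => y _; rewrite mulr_ge0// moll_ge0.
  + move=> x dx; apply/eqP; apply/negPn/negP => /etaS xp.
    have := ler_normD (x - p j) (p j); rewrite subrK; move: xp dx; lra.
- exact: etaS.
- move=> x; rewrite sumE -(moll_integral_reflect n_gt0 x e0).
  apply: le_Rintegral => // y _; rewrite ler_piMr ?moll_ge0//.
  by rewrite /u indicE lern1 leq_b1.
- move=> x Kx; rewrite sumE -(moll_integral_reflect n_gt0 x e0).
  apply: eq_Rintegral => y _; have [xy|xy] := ltP `|x - y| e; last by rewrite moll_eq0// mul0r.
  have [q qs xq] := Ks x Kx.
  rewrite /u indicE mem_set ?mulr1// /U -bigcup_mkord.
  exists (index q s); first by rewrite /= index_mem.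
  rewrite /B /p nth_index// -ball_normE/=.
  have := ler_distD x q y; move: xq xy; rewrite -ball_normE/= /e; lra.
Qed.

End partition_of_unity.

(** * Regularization of bounded fields with prescribed divergence *)

Section regularization.
Context {R : realType} {n : nat}.
Hypothesis n_gt0 : (0 < n)%N.
Local Notation leb := (@lebesgue_rV R n).
Implicit Types (D B : set 'rV[R]_n).

(** From each point of [D] that lies in [B], a truncated open cone of fixed
    shape stays in [D]: the form in which the Lipschitz boundary is used. *)
Definition inner_cone D B : Prop := exists (v : 'rV[R]_n) (c : R), 0 < c /\
  forall x t b, D x -> B x -> 0 < t -> t < c -> `|b| <= c * t ->
    D (x + t *: v + b).

Lemma inner_coneS D A B : A `<=` B -> inner_cone D B -> inner_cone D A.
Proof.
move=> AB [v [c [c0 H]]]; exists v, c; split=> // x t b Dx Ax.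
by apply: H => //; exact: AB.
Qed.

Lemma compact_closure_bounded D : bounded_set D -> compact (closure D).
Proof.
move=> [M [_ DM]]; apply: bounded_closed_compact; last exact: closed_closure.
exists (M + 1); split; first exact: num_real.
have cl : closed [set y : 'rV[R]_n | `|y| <= M + 1].
  by apply: compact_closed; [exact: norm_hausdorff|exact: compact_normr_le].
have sub : closure D `<=` [set y : 'rV[R]_n | `|y| <= M + 1].
  rewrite [X in _ `<=` X](closure_id _).1//.
  by apply: closure_subset => y Dy; apply: DM => //; rewrite ltrDl.
by move=> r Mr x /sub/le_trans; apply; exact: ltW.
Qed.

Variables (D : set 'rV[R]_n) (z : 'rV[R]_n -> 'rV[R]_n) (f : 'rV[R]_n -> R).
Hypothesis D_open : open D.
Hypothesis D_bounded : bounded_set D.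
Hypothesis D_cone : forall x, closure D x -> exists2 r : R, 0 < r & inner_cone D (ball x r).
Hypothesis mz : forall i, measurable_fun setT (fun x => z x 0 i).
Hypothesis z_le1 : forall x, enorm (z x) <= 1.
Hypothesis z_out : forall x, ~ D x -> z x = 0.
Hypothesis f_L2 : in_L2 D f.
Hypothesis div_z : distributional_div D z f.

(** The pieces of the field are translated outwards before mollification, so
    that on [D] the divergence only sees the distributional divergence of the
    field inside [D]. *)
Lemma regularized_field (eps : R) (a : 'I_n -> 'rV[R]_n -> R) (w : 'rV[R]_n -> R) :
  0 < eps -> (forall i, leb.-integrable setT (EFin \o a i)) ->
  leb.-integrable setT (EFin \o w) ->
  leb.-integrable setT (EFin \o (fun x => w x ^+ 2)) ->
  (forall x, ~ D x -> w x = 0) ->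
  exists Z : 'I_n -> 'rV[R]_n -> R,
  [/\ forall i, smooth (Z i),
      forall i x, Z i x != 0 -> exists2 y, D y & `|x - y| <= eps,
      forall x, enorm (\row_i Z i x) <= 1 + eps,
      `|\int[leb]_x (w x * \sum_i partial i (Z i) x) - \int[leb]_x (w x * (f x * \1_D x))| <= eps &
      forall i, `|\int[leb]_x (a i x * Z i x) - \int[leb]_x (a i x * z x 0 i)| <= eps].
Proof.
move=> eps0 ia iw iw2 wout.
have cD := compact_closure_bounded D_bounded.
have [d d0 dP] := lebesgue_number cD (@inner_coneS D) D_cone.
have d2 : 0 < d / 2 by rewrite divr_gt0.
have [N [p [eta [M [pD etaP etaS eta1 etaD]]]]] := smooth_partition n_gt0 cD d2.
have /choice[vc vcP] j : exists vc : 'rV[R]_n * R, 0 < vc.2 /\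
    forall x t b, D x -> ball (p j) d x -> 0 < t -> t < vc.2 -> `|b| <= vc.2 * t ->
    D (x + t *: vc.1 + b).
  by have [v [c H]] := dP _ (pD j); exists (v, c).
pose v j := (vc j).1; pose c j := (vc j).2.
have c0 j : 0 < c j by case: (vcP j).
(* The error allowed for each of the [N] pieces. *)
pose eN := eps / N.+1%:R.
have eN0 : 0 < eN by rewrite divr_gt0.
have eNN : N%:R * eN <= eps.
  by rewrite /eN mulrCA ger_pMr// ler_pdivrMr// mul1r ler_nat.
have sm j : smooth (eta j) by case: (etaP j).
have ge j : forall x, 0 <= eta j x by case: (etaP j).
have sp j : support_in (M j) (eta j) by case: (etaP j).
have near1 : \forall t \near (0 : R)^'+, forall j x,
    conv (moll (c j * t)) (eta j) (x + t *: v j) <= eta j x + eN.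
  by apply: filter_forall => j; exact: conv_eta_le (sm j) _ (sp j) _ _ _ (c0 j) eN0.
have near2 : \forall t \near (0 : R)^'+, forall j i,
    leb.-integrable setT (EFin \o (fun x => a i x * piece z (eta j) (c j * t) (- (t *: v j)) i x)) /\
    `|\int[leb]_x (a i x * piece z (eta j) (c j * t) (- (t *: v j)) i x) -
      \int[leb]_x (a i x * cut_field z (eta j) i x)| <= eN.
  apply: filter_forall => j; apply: filter_forall => i.
  exact: (piece_test n_gt0 mz z_le1 (sm j) (ge j) (sp j) (v j) i (c0 j) eN0 (ia i)).
have near3 : \forall t \near (0 : R)^'+, forall j,
    leb.-integrable setT (EFin \o (fun x => w x *
       conv (moll (c j * t)) (cut_div D z f (eta j)) (x + t *: v j))) /\
    `|\int[leb]_x (w x * conv (moll (c j * t)) (cut_div D z f (eta j)) (x + t *: v j)) -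
      \int[leb]_x (w x * cut_div D z f (eta j) x)| <= eN.
  apply: filter_forall => j.
  exact: (piece_div_test n_gt0 D_open D_bounded mz z_le1 f_L2 (sm j) (sp j) (v j) (c0 j) eN0 iw iw2).
have near4 : \forall t \near (0 : R)^'+, forall j,
    t < c j /\ t * (`|v j| + c j) < Num.min eps (d / 2).
  apply: filter_forall => j; near=> t; split; first by near: t; exact: nbhs_right_lt.
  have K0 : 0 < `|v j| + c j by rewrite ltr_wpDl.
  rewrite -ltr_pdivlMr//; near: t; apply: nbhs_right_lt.
  by apply: divr_gt0; [rewrite lt_min eps0|rewrite ltr_wpDl].
have [t [t0 T1 T2 T3 T4]] : exists t : R, [/\ 0 < t, forall j x,
    conv (moll (c j * t)) (eta j) (x + t *: v j) <= eta j x + eN,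
    forall j i,
    leb.-integrable setT (EFin \o (fun x => a i x * piece z (eta j) (c j * t) (- (t *: v j)) i x)) /\
    `|\int[leb]_x (a i x * piece z (eta j) (c j * t) (- (t *: v j)) i x) -
      \int[leb]_x (a i x * cut_field z (eta j) i x)| <= eN, forall j,
    leb.-integrable setT (EFin \o (fun x => w x *
       conv (moll (c j * t)) (cut_div D z f (eta j)) (x + t *: v j))) /\
    `|\int[leb]_x (w x * conv (moll (c j * t)) (cut_div D z f (eta j)) (x + t *: v j)) -
      \int[leb]_x (w x * cut_div D z f (eta j) x)| <= eN &
    forall j, t < c j /\ t * (`|v j| + c j) < Num.min eps (d / 2)].
  near (0 : R)^'+ => t; exists t; split; near: t => //.
  exact: nbhs_right_gt.
pose Zj (j : 'I_N) i := piece z (eta j) (c j * t) (- (t *: v j)) i.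
have normtv j : `|- (t *: v j)| + c j * t = t * (`|v j| + c j).
  by rewrite normrN normrZ gtr0_norm// mulrDr [c j * t]mulrC.
have sZ j i : smooth (Zj j i) by exact: (piece_smooth n_gt0 mz z_le1 (sm j) (ge j) (sp j)).
exists (fun i x => \sum_j Zj j i x); split.
- by move=> i; exact: smooth_sum.
- move=> i x Zx; have [j Zjx] : exists j, Zj j i x != 0.
    apply: contrapT => nP; move/negP: Zx; apply; apply/eqP; rewrite big1// => j _.
    by apply/eqP/negPn/negP => Zjx; apply: nP; exists j.
  have [y Dy xy] := piece_support n_gt0 z_out Zjx; exists y => //.
  apply: le_trans xy _; rewrite normtv; have [_] := T4 j.
  by rewrite lt_min => /andP[/ltW].
- move=> x.
  rewrite (_ : \row_i _ = \sum_j \row_i Zj j i x); last first.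
    by apply/rowP => i; rewrite mxE summxE; apply: eq_bigr => j _; rewrite mxE.
  apply: le_trans (enorm_sum _ _) _.
  apply: (@le_trans _ _ (\sum_j (eta j x + eN))).
    apply: ler_sum => j _.
    apply: le_trans (piece_enorm n_gt0 mz z_le1 (sm j) (ge j) (sp j) _ _ _) _.
    by rewrite opprK; exact: T1.
  by rewrite big_split/= lerD// sumr_const card_ord -mulr_natl.
(* The first-order terms of the cut-off functions cancel in the sum, because
   the cut-off functions add up to [1] on [D]. *)
- have divE x : D x -> \sum_i partial i (fun y => \sum_j Zj j i y) x =
      \sum_j conv (moll (c j * t)) (cut_div D z f (eta j)) (x + t *: v j).
    move=> Dx; under eq_bigr do rewrite partial_sum//.
    rewrite exchange_big/=; apply: eq_bigr => j _.
    rewrite -[t *: v j]opprK.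
    apply: (piece_div n_gt0 D_open D_bounded mz z_le1 z_out f_L2 div_z (sm j) (ge j) (sp j)).
      by rewrite mulr_gt0.
    have [tc] := T4 j; rewrite lt_min => /andP[_ td].
    move=> [y0 ey0 xy0] y xy.
    rewrite (_ : y = x + t *: v j + (y - (x + t *: v j))); last by rewrite addrC subrK.
    apply: (vcP j).2 => //; last by rewrite distrC; move: xy; rewrite opprK.
    rewrite -ball_normE/=; have py0 := etaS j y0 ey0.
    rewrite (_ : p j - x = (t *: v j) - ((x - - (t *: v j) - y0) + (y0 - p j))); last first.
      by apply/rowP => i; rewrite !mxE; ring.
    apply: le_lt_trans (ler_normB _ _) _; apply: le_lt_trans (lerD (lexx _) (ler_normD _ _)) _.
    have := normtv j; rewrite normrN => E; move: td; rewrite -E; move: py0 xy0; lra.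
  have sumcut x : D x -> \sum_j cut_div D z f (eta j) x = f x * \1_D x.
    move=> Dx; rewrite /cut_div big_split/= -big_distrl/= etaD ?mul1r; last exact: subset_closure.
    rewrite exchange_big/= big1 ?add0r// => i _; rewrite -big_distrr/=.
    rewrite -partial_sum//; rewrite (_ : partial i _ x = 0) ?mulr0//.
    rewrite /partial; apply: etrans (derive_cst (1 : R) x (delta_mx 0 i)).
    apply: near_eq_derive; near=> y; apply: etaD; apply: subset_closure.
    by near: y; exact: open_nbhs_nbhs.
  have E1 := Rintegral_sum (index_enum 'I_N) measurableT (fun j => (T3 j).1).
  have iwc j : leb.-integrable setT (EFin \o (fun x => w x * cut_div D z f (eta j) x)).
    have mw : measurable_fun setT w by exact: integrable_measurable iw.
    have icd := cut_div_integrable D_open D_bounded mz z_le1 f_L2 (sm j) (sp j).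
    apply: integrable_prod_square => //.
      exact: integrable_measurable icd.
    exact: (cut_div_square D_open D_bounded mz z_le1 f_L2 (sm j) (sp j)).
  have E2 := Rintegral_sum (index_enum 'I_N) measurableT iwc.
  rewrite (_ : \int[leb]_x _ = \sum_j \int[leb]_x (w x * conv (moll (c j * t)) (cut_div D z f (eta j)) (x + t *: v j))); last first.
    rewrite -E1.2; apply: eq_Rintegral => x _; rewrite -big_distrr/=.
    by have [Dx|nDx] := pselect (D x); [rewrite divE|rewrite wout// !mul0r].
  rewrite (_ : \int[leb]_x (w x * _) = \sum_j \int[leb]_x (w x * cut_div D z f (eta j) x)); last first.
    rewrite -E2.2; apply: eq_Rintegral => x _; rewrite -big_distrr/=.
    by have [Dx|nDx] := pselect (D x); [rewrite sumcut|rewrite wout// !mul0r].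
  rewrite -sumrB (le_trans (ler_norm_sum _ _ _))//; apply: le_trans eNN.
  rewrite -[N in N%:R]card_ord -sumr_const mulr_suml.
  by apply: ler_sum => j _; rewrite mul1r; case: (T3 j).
move=> i.
have ic j : leb.-integrable setT (EFin \o (fun x => a i x * cut_field z (eta j) i x)).
  have [C C0 eC] := support_in_bounded (smooth_continuous (sm j)) (sp j).
  have mcf := cut_field_measurable mz (sm j) i.
  apply: (integrableM_bounded (C := C)) => // x _.
  by apply: le_trans (cut_field_le z_le1 (ge j) i x) _; exact: le_trans (ler_norm _) (eC x).
have E1 := Rintegral_sum (index_enum 'I_N) measurableT (fun j => (T2 j i).1).
have E2 := Rintegral_sum (index_enum 'I_N) measurableT ic.
rewrite (_ : \int[leb]_x _ = \sum_j \int[leb]_x (a i x * Zj j i x)); last first.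
  by rewrite -E1.2; apply: eq_Rintegral => x _; rewrite -big_distrr.
rewrite (_ : \int[leb]_x (a i x * z x 0 i) = \sum_j \int[leb]_x (a i x * cut_field z (eta j) i x)); last first.
  rewrite -E2.2; apply: eq_Rintegral => x _; rewrite -big_distrr/= /cut_field -big_distrl/=.
  have [Dx|nDx] := pselect (D x); last by rewrite z_out// mxE !mulr0.
  by rewrite etaD ?mul1r//; exact: subset_closure.
rewrite -sumrB (le_trans (ler_norm_sum _ _ _))//; apply: le_trans eNN.
rewrite -[N in N%:R]card_ord -sumr_const mulr_suml.
by apply: ler_sum => j _; rewrite mul1r; case: (T2 j i).
Unshelve. all: by end_near. Qed.

End regularization.

(** * Integrals against charges *)

Section finite_measure_integral.
Context d (T : measurableType d) (R : realType) (m : {finite_measure set T -> \bar R}).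
Implicit Types (A : set T) (phi : T -> R).

Lemma finite_measure_lty A : measurable A -> (m A < +oo)%E.
Proof. by move=> mA; rewrite ltey_eq fin_num_measure. Qed.

Lemma finite_measure_bounded_integrable A phi (C : R) : measurable A ->
  measurable_fun A phi -> (forall x, A x -> `|phi x| <= C) ->
  m.-integrable A (EFin \o phi).
Proof.
move=> mA mphi phiC; apply: measurable_bounded_integrable => //.
  exact: finite_measure_lty.
exists C; split; first exact: num_real.
by move=> r Cr x Ax; apply: le_trans (phiC x Ax) _; exact: ltW.
Qed.

Lemma Rintegral_simple A N (c : 'I_N -> R) (E : 'I_N -> set T) : measurable A ->
  (forall k, measurable (E k)) -> (forall k, E k `<=` A) ->
  m.-integrable A (EFin \o (fun x => \sum_k c k * \1_(E k) x)) /\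
  \int[m]_(x in A) (\sum_k c k * \1_(E k) x) = \sum_k c k * fine (m (E k)).
Proof.
move=> mA mE EA.
have i1 k : m.-integrable A (EFin \o (\1_(E k) : T -> R)).
  apply: (@finite_measure_bounded_integrable _ _ 1) => //.
  by move=> x _; exact: normr_indic_le1.
have [I1 E1] := Rintegral_sum (index_enum 'I_N) mA (fun k => integrableZ_EFin (c k) mA (i1 k)).
split => //; rewrite E1; apply: eq_bigr => k _; rewrite RintegralZl//; congr (_ * _).
by rewrite /Rintegral integral_indic// setIidl.
Qed.

Lemma Rintegral_close A phi psi (e : R) : measurable A ->
  m.-integrable A (EFin \o phi) -> m.-integrable A (EFin \o psi) ->
  (forall x, A x -> `|phi x - psi x| <= e) ->
  `|\int[m]_(x in A) phi x - \int[m]_(x in A) psi x| <= e * fine (m A).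
Proof.
move=> mA iphi ipsi pp; rewrite -RintegralB//.
have ib := integrableB_EFin mA iphi ipsi.
apply: le_trans (le_normr_Rintegral mA ib) _; rewrite -Rintegral_cst//.
apply: le_Rintegral => //; first exact: integrable_norm.
exact: finite_measure_integrable_cst.
Qed.

End finite_measure_integral.

Section charge_integral.
Context d (T : measurableType d) (R : realType) (nu : {charge set T -> \bar R}).
Implicit Types (A : set T) (phi : T -> R).
Local Notation pos := (jordan_pos (svalP (hahn_pair nu))).
Local Notation neg := (jordan_neg (svalP (hahn_pair nu))).

Definition charge_tv A : R := fine (pos A) + fine (neg A).

Lemma charge_tv_ge0 A : 0 <= charge_tv A.
Proof. by rewrite addr_ge0// fine_ge0. Qed.

Lemma fine_charge A : measurable A -> fine (nu A) = fine (pos A) - fine (neg A).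
Proof.
move=> mA; rewrite (jordan_decomp (svalP (hahn_pair nu)) mA) /cadd/= /cscale EFinN mulN1e.
by rewrite fineD ?fineN// ?fin_numN fin_num_measure.
Qed.

(** A charge integrates simple functions exactly, so a uniform approximation by
    a simple function gives the integral up to the total mass. *)
Lemma charge_Rintegral_simple A phi (C : R) N (c : 'I_N -> R) (E : 'I_N -> set T) e :
  measurable A -> measurable_fun A phi -> (forall x, A x -> `|phi x| <= C) ->
  (forall k, measurable (E k)) -> (forall k, E k `<=` A) ->
  (forall x, A x -> `|phi x - \sum_k c k * \1_(E k) x| <= e) ->
  `|charge_Rintegral nu A phi - \sum_k c k * fine (nu (E k))| <= e * charge_tv A.
Proof.
move=> mA mphi phiC mE EA phiE.
have [Ip Ep] := Rintegral_simple pos c mA mE EA.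
have [In En] := Rintegral_simple neg c mA mE EA.
have cp := Rintegral_close mA (finite_measure_bounded_integrable pos mA mphi phiC) Ip phiE.
have cn := Rintegral_close mA (finite_measure_bounded_integrable neg mA mphi phiC) In phiE.
rewrite Ep in cp; rewrite En in cn.
rewrite (_ : \sum_k c k * fine (nu (E k)) =
    \sum_k c k * fine (pos (E k)) - \sum_k c k * fine (neg (E k))); last first.
  by rewrite -sumrB; apply: eq_bigr => k _; rewrite fine_charge// mulrBr.
rewrite /charge_Rintegral /charge_tv mulrDr.
set a := Rintegral _ _ _ in cp *; set b := Rintegral _ _ _ in cn *.
set a' := \sum_k _ in cp *; set b' := \sum_k _ in cn *.
rewrite (_ : a - b - _ = (a - a') - (b - b')); last by ring.
by apply: le_trans (ler_normB _ _) _; exact: lerD.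
Qed.

Lemma charge_Rintegral_le A phi (C : R) : measurable A -> measurable_fun A phi ->
  (forall x, A x -> `|phi x| <= C) ->
  `|charge_Rintegral nu A phi| <= C * charge_tv A.
Proof.
move=> mA mphi phiC.
have := @charge_Rintegral_simple A phi C 0 (fun=> 0) (fun=> set0) C mA mphi phiC.
rewrite big_ord0 subr0; apply => [[]//|? ? []//|x Ax].
by rewrite big_ord0 subr0 phiC.
Qed.

Lemma charge_RintegralU A B phi (C : R) : measurable A -> measurable B ->
  measurable_fun (A `|` B) phi -> (forall x, (A `|` B) x -> `|phi x| <= C) ->
  [disjoint A & B] ->
  charge_Rintegral nu (A `|` B) phi = charge_Rintegral nu A phi + charge_Rintegral nu B phi.
Proof.
move=> mA mB mphi phiC AB; have mAB := measurableU _ _ mA mB.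
rewrite /charge_Rintegral !Rintegral_setU//;
  try exact: (finite_measure_bounded_integrable _ mAB mphi phiC).
ring.
Qed.

Lemma charge_tv_tail (E : (set T)^nat) : (forall k, measurable (E k)) ->
  (forall x, exists k0, forall k, (k0 <= k)%N -> ~ E k x) ->
  forall e : R, 0 < e -> exists k0, forall k, (k0 <= k)%N -> charge_tv (E k) <= e.
Proof.
move=> mE Etail e e0.
have tail (m : {finite_measure set T -> \bar R}) : exists k0, forall k, (k0 <= k)%N ->
    fine (m (E k)) <= e / 2.
  have i1 : m.-integrable setT (EFin \o (fun=> 1)).
    by apply: (@finite_measure_bounded_integrable _ _ _ m _ _ 1) => // x _; rewrite normr1.
  have e2 : 0 < e / 2 by rewrite divr_gt0.
  have [k0 k0P] := integral_tail_small i1 mE Etail e2.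
  exists k0 => k /k0P; rewrite (eq_integral (fun x => (\1_(E k) x)%:E)); last first.
    by move=> x _; rewrite normr1 mul1r.
  rewrite integral_indic// setIT => mEe; rewrite -lee_fin fineK//.
  exact: fin_num_measure.
have [k1 H1] := tail pos; have [k2 H2] := tail neg.
exists (maxn k1 k2) => k; rewrite geq_max => /andP[/H1 h1 /H2 h2].
by rewrite /charge_tv [e]splitr lerD.
Qed.

End charge_integral.

Section variation_bound.
Context {R : realType} {n : nat}.
Implicit Types (A : set 'rV[R]_n) (nu : 'I_n -> {charge set 'rV[R]_n -> \bar R}).

Lemma vmeasure0 nu : vmeasure nu set0 = 0.
Proof. by apply/rowP => i; rewrite !mxE charge0. Qed.

Lemma vmeasure_variation_ge0 nu A : measurable A -> (0 <= vmeasure_variation nu A)%E.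
Proof.
move=> mA; apply: le_trans (_ : \sum_(k <oo) (enorm (vmeasure nu (if k == 0%N then A else set0)))%:E <= _)%E.
  by apply: nneseries_ge0 => k _ _; rewrite lee_fin enorm_ge0.
apply: ereal_sup_ubound; exists (fun k => if k == 0%N then A else set0) => //; split.
- by move=> k; case: ifP.
- by apply/trivIsetP => -[|i] [|j] //= _ _ _; rewrite ?setI0 ?set0I.
- by apply/seteqP; split=> [x [[|k] _]|x Ax] //; exists 0%N.
Qed.

(** The values of [Z] lie in a compact ball; a finite net of that ball induces a
    finite Borel partition of [A] on whose sets [Z] is almost constant, and such
    a partition is one of those in the definition of the variation. *)
Lemma charge_integral_le_variation nu A (Z : 'I_n -> 'rV[R]_n -> R) (c : R) :
  measurable A -> 0 < c -> (forall i, measurable_fun setT (Z i)) ->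
  (forall x, enorm (\row_i Z i x) <= c) ->
  ((\sum_i charge_Rintegral (nu i) A (Z i))%:E <= c%:E * vmeasure_variation nu A)%E.
Proof.
move=> mA c0 mZ Zc.
have Zi i x : `|Z i x| <= c.
  by have := enorm_coord (\row_i Z i x) i; rewrite mxE => /le_trans; apply.
have := vmeasure_variation_ge0 nu mA.
case VE : (vmeasure_variation nu A) => [r| |//]; last first.
  by move=> _; rewrite gt0_muley ?lte_fin// leey.
rewrite lee_fin => r0; rewrite -EFinM lee_fin.
pose tv := \sum_i charge_tv (nu i) A.
have tv0 : 0 <= tv by apply: sumr_ge0 => i _; exact: charge_tv_ge0.
suff main e : 0 < e -> \sum_i charge_Rintegral (nu i) A (Z i) <= (c + n%:R * e) * r + e * tv.
  apply/ler_addgt0Pr => e e0.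
  have K0 : 0 < n%:R * r + tv + 1 by rewrite ltr_wpDl// addr_ge0// mulr_ge0.
  have := main (e / (n%:R * r + tv + 1)) (divr_gt0 e0 K0).
  move=> /le_trans; apply; rewrite mulrDl -addrA lerD2l.
  rewrite (_ : _ + _ = e / (n%:R * r + tv + 1) * (n%:R * r + tv)); last by ring.
  by rewrite mulrAC ler_pdivrMr// ler_wpM2l ?ltW// ltrDl.
move=> e0.
have [s sC Cs] := compact_finite_net (@compact_normr_le R n c) (fun _ _ => e0).
pose N := size s.
pose Zv x : 'rV[R]_n := \row_i Z i x.
have mZv : measurable_fun setT Zv.
  by apply/measurable_fun_rVP => i; rewrite (_ : (fun x => _) = Z i)//; apply/funext => x; rewrite mxE.
pose p k : 'rV[R]_n := nth 0 s k.
pose B k : set 'rV[R]_n := A `&` Zv @^-1` ball (p k) e.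
have mB k : measurable (B k).
  apply: measurableI => //; rewrite -[X in measurable X]setTI; apply: mZv => //.
  by apply: mx_open_measurable; exact: ball_open.
pose E := seqDU B.
have mE k : measurable (E k) by exact: seqDU_measurable.
have tE : trivIset setT E by exact: trivIset_seqDU.
have Zle x : `|Zv x| <= c.
  rewrite [X in X <= _]/Num.Def.normr/= mx_normrE.
  apply/bigmax_leP; split; first exact: ltW.
  by move=> [i j] _ /=; rewrite (ord1 i) mxE.
have Bcover x : A x -> exists2 k, (k < N)%N & B k x.
  move=> Ax; have [y ys xy] := Cs (Zv x) (Zle x).
  exists (index y s); first by rewrite index_mem.
  by split => //=; rewrite /p nth_index.
have EB k : E k `<=` B k by exact: subset_seqDU.
have EA k : E k `<=` A by move=> x /EB[].
have Ecover x : A x -> exists2 k : 'I_N, E k x & forall l : 'I_N, l != k -> ~ E l x.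
  move=> /Bcover[k kN Bk].
  have : (\big[setU/set0]_(l < N) B l) x by rewrite -bigcup_mkord; exists k.
  rewrite bigsetU_seqDU -bigcup_mkord => -[l /= lN El]; exists (Ordinal lN) => // j jl Ej.
  move/negP: jl; apply; apply/eqP/val_inj => /=.
  by apply: (tE j l) => //; exists x.
have EN k : (N <= k)%N -> E k = set0.
  move=> Nk; apply/seteqP; split=> // x Ek.
  have [l El _] := Ecover x (EA _ _ Ek).
  have kl : k = l :> nat by apply: (tE k l) => //; exists x.
  by have := ltn_ord l; rewrite -kl ltnNge Nk.
have cover : \bigcup_k E k = A.
  apply/seteqP; split=> [x [k _ /EA]//|x /Ecover[k Ek _]].
  by exists (nat_of_ord k).
have approx i x : A x -> `|Z i x - \sum_(k < N) p k 0 i * \1_(E k) x| <= e.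
  move=> Ax; have [k Ek Enk] := Ecover x Ax.
  rewrite (bigD1 k)//= big1 ?addr0; last by move=> l /Enk nE; rewrite indicE memNset ?mulr0.
  rewrite indicE (mem_set Ek) mulr1.
  have [_] := EB _ _ Ek; rewrite /= -ball_normE/= => /ltW pk.
  apply: le_trans pk; have := normr_coord_le (p k - Zv x) i.
  by rewrite !mxE distrC.
have step i : charge_Rintegral (nu i) A (Z i) <=
    \sum_(k < N) p k 0 i * fine (nu i (E k)) + e * charge_tv (nu i) A.
  have := charge_Rintegral_simple (nu i) mA (measurable_funTS (mZ i)) (fun x _ => Zi i x)
    (fun k : 'I_N => mE k) (fun k : 'I_N => EA k) (approx i).
  by rewrite ler_norml => /andP[_]; lra.
apply: (@le_trans _ _ (\sum_i (\sum_(k < N) p k 0 i * fine (nu i (E k)) + e * charge_tv (nu i) A))).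
  by apply: ler_sum => i _.
rewrite big_split/= -big_distrr/= -/tv lerD2r exchange_big/=.
have cne : 0 <= c + n%:R * e by apply: addr_ge0; [exact: ltW|apply: mulr_ge0; [exact: ler0n|exact: ltW]].
apply: (@le_trans _ _ (\sum_(k < N) (c + n%:R * e) * enorm (vmeasure nu (E k)))).
  apply: ler_sum => k _.
  rewrite (_ : \sum_i _ = dot (p k) (vmeasure nu (E k))); last first.
    by apply: eq_bigr => i _; rewrite mxE.
  have [[x Ek]|nE] := pselect (exists x, E k x); last first.
    rewrite (_ : E k = set0) ?vmeasure0 ?enorm0 ?mulr0.
      by rewrite dotC /dot big1// => i _; rewrite mxE mul0r.
    by apply/seteqP; split=> // x Ek; apply: nE; exists x.
  apply: le_trans (dot_le_enorm _ _) _; rewrite ler_wpM2r ?enorm_ge0//.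
  rewrite -[p k](subrK (Zv x)) addrC; apply: le_trans (enormD _ _) _.
  apply: lerD; first exact: Zc.
  apply: le_trans (enorm_le_sum _) _.
  rewrite -[n in n%:R]card_ord -sumr_const mulr_suml; apply: ler_sum => i _; rewrite mul1r.
  have [_] := EB _ _ Ek; rewrite /= -ball_normE/= => /ltW pk.
  by apply: le_trans pk; exact: normr_coord_le.
rewrite -big_distrr/= ler_wpM2l// -lee_fin -VE.
apply: le_trans (_ : \sum_(k <oo) (enorm (vmeasure nu (E k)))%:E <= _)%E; last first.
  by apply: ereal_sup_ubound; exists E.
rewrite -sumEFin -(big_mkord xpredT (fun k => (enorm (vmeasure nu (E k)))%:E)).
by apply: nneseries_lim_ge => k _ _; rewrite lee_fin enorm_ge0.
Qed.

End variation_bound.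

(** * Weak duality *)

Section integral_ae.
Context d (T : measurableType d) (R : realType) (mu : {measure set T -> \bar R}).
Implicit Types (D : set T) (f g : T -> R).

Lemma Rintegral_ae_eq D f g : measurable D -> measurable_fun D f -> measurable_fun D g ->
  {ae mu, forall x, D x -> f x = g x} ->
  \int[mu]_(x in D) f x = \int[mu]_(x in D) g x.
Proof.
move=> mD mf mg fg; congr fine; apply: ae_eq_integral => //.
- exact/measurable_EFinP.
- exact/measurable_EFinP.
- by apply: filterS fg => x fg Dx; rewrite fg.
Qed.

End integral_ae.

Section measurable_fields.
Context {R : realType} {n : nat}.
Implicit Types (D : set 'rV[R]_n) (g h : 'rV[R]_n -> 'rV[R]_n).

Lemma measurable_dot D g h : measurable D ->
  (forall i, measurable_fun D (fun x => g x 0 i)) ->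
  (forall i, measurable_fun D (fun x => h x 0 i)) ->
  measurable_fun D (fun x => dot (g x) (h x)).
Proof. by move=> mD mg mh; apply: measurable_sum => i; exact: measurable_funM. Qed.

Lemma measurable_enorm D g : measurable D ->
  (forall i, measurable_fun D (fun x => g x 0 i)) ->
  measurable_fun D (fun x => enorm (g x)).
Proof.
move=> mD mg; apply: (@measurableT_comp _ _ _ _ _ _ (@Num.sqrt R)); last exact: measurable_dot.
by apply: continuous_measurable_fun; exact: sqrt_continuous.
Qed.

Lemma smooth_measurable (phi : 'rV[R]_n -> R) : smooth phi -> measurable_fun setT phi.
Proof. by move=> sphi; apply: continuous_measurable; exact: smooth_continuous. Qed.

Lemma test_function_smooth D (phi : 'rV[R]_n -> R) : test_function D phi -> smooth phi.
Proof. by case. Qed.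

Lemma test_function_support D (phi : 'rV[R]_n -> R) : test_function D phi ->
  exists M, support_in M phi.
Proof.
move=> [_ /compact_bounded[M [_ /(_ (M + 1))]]].
rewrite ltrDl ltr01 => /(_ isT) HM _; exists (M + 2) => x Mx.
apply/eqP/negPn/negP => px; have /= : `|x| <= M + 1.
  by apply: HM; exact: subset_closure.
by move: Mx; lra.
Qed.

Lemma test_function_bounded D (phi : 'rV[R]_n -> R) : test_function D phi ->
  exists C, forall x, `|phi x| <= C.
Proof.
move=> tphi; have [M HM] := test_function_support tphi.
have cphi : continuous phi by exact: smooth_continuous (test_function_smooth tphi).
by have [C _ HC] := support_in_bounded cphi HM; exists C.
Qed.

Lemma partial_measurable i (phi : 'rV[R]_n -> R) : smooth phi ->
  measurable_fun setT (partial i phi).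
Proof. by move=> sphi; apply: smooth_measurable; exact: smooth_partial. Qed.

Lemma partial_bounded D i (phi : 'rV[R]_n -> R) : test_function D phi ->
  exists C, forall x, `|partial i phi x| <= C.
Proof.
move=> tphi; have [M HM] := test_function_support tphi.
have cphi : continuous (partial i phi).
  by apply: smooth_continuous; apply: smooth_partial; exact: (test_function_smooth tphi).
by have [C _ HC] := support_in_bounded cphi (support_in_partial i HM); exists C.
Qed.

End measurable_fields.

Section normalization.
Context {R : realType} {n : nat}.
Local Notation leb := (@lebesgue_rV R n).
Variables (D : set 'rV[R]_n) (f : 'rV[R]_n -> R) (z : 'rV[R]_n -> 'rV[R]_n).
Hypothesis mD : measurable D.
Hypothesis z_S : S_infty D f z.

(** Neither the divergence nor the norm in [L^oo] sees the values on a null set or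
    outside [D]. *)
Lemma S_infty_normalized : exists z',
  [/\ distributional_div D z' f, forall i, measurable_fun setT (fun x => z' x 0 i),
      forall x, enorm (z' x) <= 1, forall x, ~ D x -> z' x = 0 &
      {ae leb, forall x, D x -> z' x = z x}].
Proof.
have [[mz z1] dz] := z_S.
pose E := D `&` (fun x => enorm (z x)) @^-1` [set` `]-oo, 1]].
have mE : measurable E by apply: (measurable_enorm mD mz).
have zE x : (\1_E x *: z x) = if x \in E then z x else 0.
  by rewrite indicE; case: (x \in E); rewrite ?scale1r ?scale0r.
have mz' i : measurable_fun setT (fun x : 'rV[R]_n => (\1_E x *: z x) 0 i).
  rewrite (_ : (fun x => _) = (fun x => z x 0 i * \1_E x)); last first.
    by apply/funext => x; rewrite mxE mulrC.
  by apply: measurable_mul_indic => //; apply: measurable_funS (mz i) => // x [].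
have zz' : {ae leb, forall x, D x -> \1_E x *: z x = z x}.
  apply: filterS z1 => x z1 Dx; rewrite zE ifT//; apply/mem_set; split => //=.
  by rewrite in_itv/= z1.
exists (fun x => \1_E x *: z x); split => //.
- move=> phi tphi; rewrite -dz//.
  have mg i : measurable_fun D (fun x => grad phi x 0 i).
    rewrite (_ : (fun x => _) = partial i phi); last by apply/funext => x; rewrite mxE.
    by apply: measurable_funTS; apply: partial_measurable; exact: (test_function_smooth tphi).
  apply: Rintegral_ae_eq => //; [| |by apply: filterS zz' => x zz' Dx; rewrite zz'].
  - by apply: measurable_dot => // i; exact: measurable_funTS.
  - exact: measurable_dot.
- move=> x; rewrite zE; case: ifPn => [/set_mem[_ /=]|_]; first by rewrite in_itv.
  by rewrite enorm0 ler01.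
- by move=> x nD; rewrite zE ifF//; apply/negP => /set_mem[].
Qed.

End normalization.

Section collar.
Context {R : realType} {n : nat}.
Variables D Ds : set 'rV[R]_n.

(** All that a field supported at distance [1 / (k + 1)] from [D] can see outside
    [closure D]. *)
Definition collar k : set 'rV[R]_n :=
  (Ds `\` closure D) `&` \bigcup_(y in D) ball y (2 / k.+1%:R).

Lemma collar_measurable k : open Ds -> measurable (collar k).
Proof.
move=> Ds_open; apply: measurableI; [apply: measurableD; first exact: mx_open_measurable|apply: mx_open_measurable].
- exact: closure_measurable.
- by apply: bigcup_open => y _; exact: ball_open.
Qed.

Lemma collar_tail x : exists k0, forall k, (k0 <= k)%N -> ~ collar k x.
Proof.
have [Dx|nDx] := pselect (closure D x); first by exists 0%N => k _ [[_ /(_ Dx)]].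
have : nbhs x (~` closure D) by apply: open_nbhs_nbhs; split => //; exact/closed_openC/closed_closure.
move=> /nbhs_ballP[r /= r0 rD].
have [k0 _ Hk0] := near_infty_natSinv_lt (PosNum (divr_gt0 r0 (ltr0Sn R 1))).
exists k0 => k /Hk0 /= kr [_ [y Dy]]; rewrite -ball_normE/= => yx.
apply: (rD y); last exact: subset_closure.
rewrite -ball_normE/= distrC; apply: lt_trans yx _.
by rewrite mulrC -ltr_pdivlMr.
Qed.

End collar.

Section weak_duality.
Context {R : realType} {n : nat}.
Hypothesis n_gt0 : (0 < n)%N.
Local Notation leb := (@lebesgue_rV R n).
Variables (D Ds : set 'rV[R]_n) (f u0 : 'rV[R]_n -> R) (g0 : 'rV[R]_n -> 'rV[R]_n).
Hypothesis D_open : open D.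
Hypothesis D_bounded : bounded_set D.
Hypothesis D_cone : forall x, closure D x -> exists2 r : R, 0 < r & inner_cone D (ball x r).
Hypothesis Ds_open : open Ds.
Hypothesis DDs : closure D `<=` Ds.
Hypothesis f_L2 : in_L2 D f.
Hypothesis u0_W11 : in_W11 Ds u0 g0.
Hypothesis u0_L2 : in_L2 Ds u0.

Let mD : measurable D. Proof. exact: mx_open_measurable. Qed.
Let mDs : measurable Ds. Proof. exact: mx_open_measurable. Qed.
Let D_Ds : D `<=` Ds. Proof. by move=> x Dx; apply: DDs; exact: subset_closure. Qed.
Let mcD : measurable (closure D). Proof. exact: closure_measurable. Qed.

Lemma test_function_near : exists2 d : R, 0 < d & forall eps phi, 0 < eps -> eps < d ->
  smooth phi -> (forall x, phi x != 0 -> exists2 y, D y & `|x - y| <= eps) ->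
  test_function Ds phi.
Proof.
have cD := compact_closure_bounded D_bounded.
have [||d d0 dP] := @lebesgue_number _ _ _ (fun B => B `<=` Ds) cD.
- by move=> A B AB BD; exact: subset_trans BD.
- move=> x /DDs Dx; have /nbhs_ballP[r /= r0 rD] := open_nbhs_nbhs (conj Ds_open Dx).
  by exists r.
exists (d / 2) => [|eps phi eps0 epsd sphi phiD]; first by rewrite divr_gt0.
split => //.
- have [M [_ HM]] := compact_bounded cD.
  apply: compact_closure_bounded; exists (M + 1 + eps); split; first exact: num_real.
  move=> r Mr x /phiD[y Dy xy] /=.
  have /= := HM (M + 1) _ y (subset_closure Dy); rewrite ltrDl ltr01 => /(_ isT).
  have := ler_normD (x - y) y; rewrite subrK; move: xy Mr; lra.
- move=> x cx; have [x' [/phiD[y Dy x'y]]] := cx _ (nbhsx_ballx x eps eps0).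
  rewrite -ball_normE/= => xx'; apply: (dP y); first exact: subset_closure.
  rewrite -ball_normE/= distrC; have := ler_distD x' x y; move: epsd xx' x'y; lra.
Qed.

Section test.
Variables (u : 'rV[R]_n -> R) (nu : 'I_n -> {charge set 'rV[R]_n -> \bar R}).
Hypothesis u_BV : in_BV_dirichlet D Ds u0 u nu.
Hypothesis u_L2 : in_L2 Ds u.

Let w x := (u x - u0 x) * \1_D x.

Let iu : leb.-integrable Ds (EFin \o u). Proof. by case: u_BV => -[]. Qed.
Let iu0 : leb.-integrable Ds (EFin \o u0). Proof. by case: u0_W11. Qed.
Let mu : measurable_fun Ds u. Proof. by case: u_L2. Qed.
Let mu0 : measurable_fun Ds u0. Proof. by case: u0_L2. Qed.

Let iw : leb.-integrable setT (EFin \o w).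
Proof.
apply/(integrable_mul_indic _ _ mD); apply: (integrableS mDs) => //.
exact: integrableB_EFin.
Qed.

Let iw2 : leb.-integrable setT (EFin \o (fun x => w x ^+ 2)).
Proof.
rewrite /w (sqr_mul_indic D (fun x => u x - u0 x)).
apply/(integrable_mul_indic _ _ mD); apply: (integrableS mDs) => //.
have i2 : leb.-integrable Ds (EFin \o (fun x => 2 * u x ^+ 2 + 2 * u0 x ^+ 2)).
  by apply: integrableD_EFin => //; apply: integrableZ_EFin => //; [case: u_L2|case: u0_L2].
apply: (dominated_integrable mDs _ i2) => [|x _].
  by apply: measurable_funX; exact: measurable_funB.
rewrite ger0_norm ?sqr_ge0//; have := sqr_ge0 (u x + u0 x); nra.
Qed.

(** Integration by parts of [u - u0], which vanishes outside [D]. *)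
Lemma dirichlet_by_parts phi i : test_function Ds phi ->
  \int[leb]_x (w x * partial i phi x) =
  \int[leb]_x (g0 x 0 i * \1_Ds x * phi x) - charge_Rintegral (nu i) Ds phi.
Proof.
move=> tphi; have [[_ uP] uae] := u_BV; have [_ ig0 u0P] := u0_W11.
have [C HC] := partial_bounded i tphi.
have sphi := test_function_smooth tphi.
have mp : measurable_fun Ds (partial i phi).
  by apply: measurable_funTS; exact: partial_measurable.
have := uP phi tphi i; have := u0P phi tphi i.
have iup := integrableM_bounded mDs iu mp (fun x _ => HC x).
have iup0 := integrableM_bounded mDs iu0 mp (fun x _ => HC x).
move=> e1 e2; have := RintegralB mDs iup iup0; rewrite e1 e2 opprK.
rewrite (_ : \int[leb]_(x in Ds) (_ - _) = \int[leb]_x (w x * partial i phi x)).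
  move=> ->; rewrite addrC; congr (_ - _).
  by rewrite Rintegral_indic; apply: eq_Rintegral => x _; rewrite mulrAC.
rewrite (Rintegral_indic _ Ds); apply: Rintegral_ae_eq => //.
- apply: measurable_mul_indic => //; apply: measurable_funB; exact: measurable_funM.
- apply: measurable_funM; last exact: partial_measurable.
  exact: integrable_measurable iw.
- apply: filterS uae => x uae _; rewrite /w -mulrBl !indicE.
  have [xD|xD] := pselect (D x); first by rewrite (mem_set xD) (mem_set (D_Ds xD)) !mulr1.
  rewrite (memNset xD) mulr0 mul0r; have [xDs|xDs] := pselect (Ds x).
    by rewrite uae ?subrr ?mul0r.
  by rewrite (memNset xDs) mulr0.
Qed.

(** The part of [nu] outside [closure D] only sees the collar, whose total
    variation is arbitrarily small. *)
Lemma charge_collar_le i k phi : test_function Ds phi ->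
  (forall x, phi x != 0 -> exists2 y, D y & `|x - y| <= k.+1%:R^-1) ->
  (forall x, `|phi x| <= 2) ->
  charge_Rintegral (nu i) Ds phi <=
  charge_Rintegral (nu i) (closure D) phi + 2 * charge_tv (nu i) (collar D Ds k).
Proof.
move=> tphi phiD phi2.
have mphi := smooth_measurable (test_function_smooth tphi).
have mE := @collar_measurable _ _ D Ds k Ds_open.
pose E := collar D Ds k; pose F := (Ds `\` closure D) `\` E.
have mF : measurable F by apply: measurableD => //; exact: measurableD.
have EF : (Ds `\` closure D) = E `|` F.
  by apply/seteqP; split=> x; [have [|] := pselect (E x); [left|right]|case=> -[]].
have DE : Ds = closure D `|` (E `|` F).
  by rewrite -EF; apply/seteqP; split=> x; [have [|] := pselect (closure D x); [left|right]|case=> [/DDs|[]]].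
have F0 : charge_Rintegral (nu i) F phi = 0.
  have := @charge_Rintegral_le _ _ _ (nu i) F phi 0 mF (measurable_funTS mphi).
  rewrite mul0r normr_le0 => H; apply/eqP; apply: H => x [[Dx nDx] nE].
  rewrite normr_le0; apply/negPn/negP => /phiD[y Dy xy]; apply: nE; split => //.
  exists y => //; rewrite -ball_normE/= distrC; apply: le_lt_trans xy _.
  by rewrite mulr_natl mulr2n ltrDl invr_gt0.
have dEF : [disjoint E & F] by apply/disj_set2P/seteqP; split=> x // [Ex [_ /(_ Ex)]].
have dDE : [disjoint closure D & E `|` F].
  by apply/disj_set2P; rewrite -EF setIDA; apply/seteqP; split=> x // [[]].
have mEF := measurableU _ _ mE mF.
rewrite [in X in X <= _]DE.
rewrite (charge_RintegralU (nu i) mcD mEF (measurable_funTS mphi) (fun x _ => phi2 x) dDE).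
rewrite (charge_RintegralU (nu i) mE mF (measurable_funTS mphi) (fun x _ => phi2 x) dEF).
rewrite F0 addr0.
have := charge_Rintegral_le (nu i) mE (measurable_funTS mphi) (fun x _ => phi2 x).
by rewrite ler_norml => /andP[]; lra.
Qed.

(** The field [z] is replaced by a smooth one, which may be tested against both
    [Du] and the gradient of [u0]: this gives the inequality up to the
    regularization error and to the mass of [Du] on a thin collar around
    [closure D]. *)
Lemma weak_duality z : S_infty D f z ->
  ((\int[leb]_(x in D) dot (z x) (g0 x))%:E <=
   vmeasure_variation nu (closure D) + (\int[leb]_(x in D) (f x * (u x - u0 x)))%:E)%E.
Proof.
move=> zS; have [_ ig0 _] := u0_W11.
have mg0 i : measurable_fun D (fun x => g0 x 0 i).
  by apply: (measurable_funS mDs) => //; exact: integrable_measurable (ig0 i).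
have [z' [dz mz z1 z0 zz']] := S_infty_normalized mD zS.
have -> : \int[leb]_(x in D) dot (z x) (g0 x) = \int[leb]_(x in D) dot (z' x) (g0 x).
  have [[mzD _] _] := zS; apply: Rintegral_ae_eq => //.
  - exact: measurable_dot.
  - by apply: measurable_dot => // i; exact: measurable_funTS.
  - by apply: filterS zz' => x zz' Dx; rewrite zz'.
have := vmeasure_variation_ge0 nu mcD.
case VE : (vmeasure_variation nu (closure D)) => [V| |//]; last by move=> _; rewrite addye// leey.
rewrite lee_fin => V0; rewrite -EFinD lee_fin.
pose a i x := g0 x 0 i * \1_Ds x.
have ia i : leb.-integrable setT (EFin \o a i) by apply/(integrable_mul_indic _ _ mDs); exact: ig0.
have iaz i : leb.-integrable setT (EFin \o (fun x => a i x * z' x 0 i)).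
  apply: (integrableM_bounded (C := 1)) => // x _.
  exact: le_trans (enorm_coord _ _) (z1 x).
have LHS : \int[leb]_(x in D) dot (z' x) (g0 x) = \sum_i \int[leb]_x (a i x * z' x 0 i).
  have [_ <-] := Rintegral_sum (index_enum 'I_n) measurableT iaz.
  rewrite Rintegral_indic; apply: eq_Rintegral => x _.
  rewrite /dot mulr_suml; apply: eq_bigr => i _; rewrite /a.
  have [xD|xD] := pselect (D x).
    by rewrite !indicE (mem_set xD) (mem_set (D_Ds xD)) !mulr1 mulrC.
  by rewrite z0// mxE !mul0r mulr0.
have RHS : \int[leb]_(x in D) (f x * (u x - u0 x)) = \int[leb]_x (w x * (f x * \1_D x)).
  rewrite Rintegral_indic; apply: eq_Rintegral => x _; rewrite /w indicE.
  by case: (_ \in _); rewrite ?mulr1 ?mulr0// mulrC.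
have [d d0 dP] := test_function_near.
apply/ler_addgt0Pr => e e0.
(* All errors add up to at most [K] times the largest of them: [V] comes from
   the norm bound of [Z], [n] from testing against the gradient of [u0],
   [2 n] from the collar and [1] from the divergence. *)
pose K := V + n%:R + 2 * n%:R + 1.
have K0 : 0 < K by rewrite /K; have := ler0n R n; lra.
have eK : 0 < e / K by rewrite divr_gt0.
have /choice[k0 k0P] i : exists k0, forall k, (k0 <= k)%N ->
    charge_tv (nu i) (collar D Ds k) <= e / K.
  apply: charge_tv_tail => //; first by move=> k; exact: collar_measurable.
  exact: collar_tail.
have [k1 _ Hk1] := near_infty_natSinv_lt (PosNum d0).
have [k2 _ Hk2] := near_infty_natSinv_lt (PosNum eK).
pose k := maxn (\max_i k0 i) (maxn k1 k2).
have tvk i : charge_tv (nu i) (collar D Ds k) <= e / K.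
  by apply: k0P; rewrite /k leq_max leq_bigmax.
have kd : k.+1%:R^-1 < d by apply: Hk1; rewrite /= /k !leq_max leqnn orbT.
have ke : k.+1%:R^-1 < e / K by apply: Hk2; rewrite /= /k !leq_max leqnn !orbT.
have kk1 : k.+1%:R^-1 <= 1 :> R by rewrite invf_le1// ler1n.
have kp : 0 < k.+1%:R^-1 :> R by rewrite invr_gt0.
have wout x : ~ D x -> w x = 0 by move=> xD; rewrite /w indicE (memNset xD) mulr0.
have [Z [sZ ZD Z1 Zdiv Za]] := regularized_field n_gt0 D_open D_bounded D_cone mz z1 z0 f_L2 dz
  kp ia iw iw2 wout.
have tZ i : test_function Ds (Z i) by exact: dP kp kd (sZ i) (ZD i).
have Z2 i x : `|Z i x| <= 2.
  have := enorm_coord (\row_i Z i x) i; rewrite mxE => /le_trans; apply.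
  by apply: le_trans (Z1 x) _; rewrite -[leRHS]/(1 + 1) lerD2l.
have ipart i : leb.-integrable setT (EFin \o (fun x => w x * partial i (Z i) x)).
  have [C HC] := partial_bounded i (tZ i).
  by apply: (integrableM_bounded (C := C)) => //; exact: partial_measurable.
have divE : \int[leb]_x (w x * \sum_i partial i (Z i) x) =
    \sum_i \int[leb]_x (a i x * Z i x) - \sum_i charge_Rintegral (nu i) Ds (Z i).
  rewrite -sumrB -(eq_bigr _ (fun i _ => dirichlet_by_parts i (tZ i))).
  have [_ <-] := Rintegral_sum (index_enum 'I_n) measurableT ipart.
  by apply: eq_Rintegral => x _; rewrite big_distrr.
have var : \sum_i charge_Rintegral (nu i) (closure D) (Z i) <= (1 + k.+1%:R^-1) * V.
  rewrite -lee_fin EFinM -VE; apply: charge_integral_le_variation => // i.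
  exact: smooth_measurable.
have s1 : \sum_i charge_Rintegral (nu i) Ds (Z i) <=
    \sum_i charge_Rintegral (nu i) (closure D) (Z i) + n%:R * (2 * (e / K)).
  rewrite mulr_natl -[n in _ *+ n]card_ord -sumr_const -big_split/=; apply: ler_sum => i _.
  apply: le_trans (charge_collar_le i (tZ i) (ZD i) (Z2 i)) _.
  by rewrite lerD2l ler_pM2l// tvk.
have s2 : \sum_i \int[leb]_x (a i x * z' x 0 i) <=
    \sum_i \int[leb]_x (a i x * Z i x) + n%:R * k.+1%:R^-1.
  rewrite mulr_natl -[n in _ *+ n]card_ord -sumr_const -big_split/=; apply: ler_sum => i _.
  by rewrite -lerBlDl; apply: le_trans (ler_norm _) _; rewrite distrC.
rewrite LHS RHS; move: Zdiv; rewrite divE ler_norml => /andP[_].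
have eKE : K * (e / K) = e by rewrite mulrC divfK ?gt_eqF.
have q1 : k.+1%:R^-1 * V <= (e / K) * V by rewrite ler_wpM2r// ltW.
have q2 : n%:R * k.+1%:R^-1 <= n%:R * (e / K) by rewrite ler_wpM2l// ltW.
move: eKE s1 s2 var q1 q2 ke; rewrite /K.
set A1 := \sum_i _; set A2 := \sum_i _; set A3 := \sum_i _; set A4 := \sum_i _.
set I1 := Rintegral _ _ _.
set t := e / _; set r := k.+1%:R^-1; set N := n%:R.
by move=> *; nra.
Qed.

End test.
End weak_duality.

(** * Lipschitz boundaries *)

Section lipschitz_cone.
Context {R : realType} {n : nat}.
Local Notation leb := (@lebesgue_rV R n).
Implicit Types D : set 'rV[R]_n.

Lemma normr_rV_le m (v : 'rV[R]_m) (c : R) : 0 <= c -> (forall j, `|v 0 j| <= c) -> `|v| <= c.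
Proof.
move=> c0 vc; rewrite [X in X <= _]/Num.Def.normr/= mx_normrE.
by apply/bigmax_leP; split=> // -[i j] _ /=; rewrite (ord1 i).
Qed.

Lemma normr_mulmx_le m (Q : 'M[R]_(n, m)) :
  exists2 K : R, 0 < K & forall b : 'rV[R]_n, `|b *m Q| <= K * `|b|.
Proof.
exists (1 + \sum_k \sum_j `|Q k j|) => [|b].
  by rewrite ltr_wpDr// sumr_ge0// => k _; exact: sumr_ge0.
apply: normr_rV_le => [|j].
  by rewrite mulr_ge0// addr_ge0// sumr_ge0// => k _; exact: sumr_ge0.
rewrite mxE mulrDl mul1r; apply: le_trans (ler_norm_sum _ _ _) _.
apply: (@le_trans _ _ (\sum_k (\sum_j `|Q k j|) * `|b|)).
  apply: ler_sum => k _; rewrite normrM mulrC; apply: ler_pM => //; last exact: normr_coord_le.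
  by rewrite (bigD1 j)//= lerDl sumr_ge0.
by rewrite -mulr_suml lerDr.
Qed.

Lemma lipschitz_bound m (gamma : 'rV[R]_m -> R) : lipschitz gamma ->
  exists2 L : R, 0 < L & forall a b, `|gamma a - gamma b| <= L * `|a - b|.
Proof.
move=> [M [Mreal HM]]; exists (Num.max (M + 1) 1) => [|a b].
  by rewrite lt_max ltr01 orbT.
by apply: (HM (Num.max (M + 1) 1) _ (a, b)) => //; rewrite lt_max ltrDl ltr01.
Qed.

(** Above the graph of a function with Lipschitz constant [L], moving up by [t]
    leaves room for any perturbation of size less than [t / (1 + L)]. *)
Lemma lipschitz_inner_cone D x : open D -> lipschitz_boundary D -> closure D x ->
  exists2 r : R, 0 < r & inner_cone D (ball x r).
Proof.
move=> oD lD cDx; have [Dx|nDx] := pselect (D x).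
  have /nbhs_ballP[r /= r0 rD] := open_nbhs_nbhs (conj oD Dx).
  exists (r / 2); first by rewrite divr_gt0.
  exists 0, (Num.min 1 (r / 2)); split; first by rewrite lt_min ltr01 divr_gt0.
  move=> y t b Dy; rewrite -ball_normE/= => xy t0; rewrite lt_min => /andP[t1 tr] bt.
  rewrite scaler0 addr0; apply: rD; rewrite -ball_normE/= opprD addrA.
  have mr : Num.min 1 (r / 2) <= r / 2 by rewrite ge_min lexx orbT.
  apply: le_lt_trans (ler_normB _ _) _.
  have : `|b| <= r / 2.
    by apply: le_trans bt _; apply: le_trans (ler_wpM2r (ltW t0) mr) _; rewrite ger_pMr ?divr_gt0// ltW.
  by move: xy; lra.
have [Q [i [gamma [QQ lg near_x]]]] := lD x cDx nDx.
have QQ' := mulmx1C QQ.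
have [L L0 HL] := lipschitz_bound lg.
have [K K0 HK] := normr_mulmx_le Q.
have /nbhs_ballP[r /= r0 rD] := near_x.
(* The vertical direction in the rotated coordinates. *)
pose v := delta_mx 0 i *m Q^T : 'rV[R]_n.
have vQ : v *m Q = delta_mx 0 i by rewrite /v -mulmxA QQ' mulmx1.
(* The first bound keeps the perturbed point in the ball where the boundary is a
   graph, the second keeps it above the graph. *)
pose V := `|v| + 1.
have V0 : 0 < V by rewrite ltr_wpDl.
pose c := Num.min 1 (Num.min (r / 2 / (V + 1)) (((1 + L) * K + 1)^-1)).
have c0 : 0 < c.
  have W0 : 0 < (1 + L) * K + 1 by rewrite addr_gt0// mulr_gt0// addr_gt0.
  by rewrite !lt_min ltr01 invr_gt0 W0 andbT/= !divr_gt0// addr_gt0.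
have c1 : c <= 1 by rewrite ge_min lexx.
have cr : c * (V + 1) <= r / 2.
  have : c <= r / 2 / (V + 1) by rewrite /c !ge_min lexx orbT.
  by rewrite ler_pdivlMr// addr_gt0.
have cK : c * ((1 + L) * K + 1) <= 1.
  have : c <= ((1 + L) * K + 1)^-1 by rewrite /c !ge_min lexx !orbT.
  by rewrite -div1r ler_pdivlMr// addr_gt0// mulr_gt0// addr_gt0.
exists (r / 2); first by rewrite divr_gt0.
exists v, c; split => // y t b Dy; rewrite -ball_normE/= => xy t0 tc bt.
have nt : `|t *: v| <= t * V.
  by rewrite normrZ gtr0_norm// ler_wpM2l ?ltW// /V ltrDl.
have bc : `|b| <= t by apply: le_trans bt _; rewrite ger_pMl.
have yD : ball x r (y + t *: v + b).
  rewrite -ball_normE/= -addrA opprD addrA; apply: le_lt_trans (ler_normB _ _) _.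
  have := ler_normD (t *: v) b.
  have : t * (V + 1) < c * (V + 1) by rewrite ltr_pM2r// addr_gt0.
  move: xy nt bc cr; lra.
have yr : ball x r y.
  by rewrite -ball_normE/=; apply: lt_trans xy _; rewrite ltr_pdivrMr// ltr_pMr// ltr1n.
apply/(rD _ yD); have /(rD _ yr) Dy' := Dy.
rewrite !mulmxDl -scalemxAl vQ.
have ci : col' i (y *m Q + t *: delta_mx 0 i + b *m Q) = col' i (y *m Q) + col' i (b *m Q).
  apply/rowP => j; have /negbTE nij : lift i j != i by rewrite eq_sym neq_lift.
  by rewrite !mxE nij andbF mulr0 addr0.
rewrite ci !mxE !eqxx mulr1.
have bQ := HK b.
have b1 : `|(b *m Q) 0 i| <= K * `|b| by apply: le_trans (normr_coord_le _ _) _.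
have b2 : `|col' i (b *m Q)| <= K * `|b|.
  apply: normr_rV_le => [|j]; first by rewrite mulr_ge0// ltW.
  by rewrite mxE; apply: le_trans (normr_coord_le _ _) _.
have := HL (col' i (y *m Q) + col' i (b *m Q)) (col' i (y *m Q)).
rewrite [X in _ * `|X|]addrAC subrr add0r => h.
have h' : L * `|col' i (b *m Q)| <= L * (K * `|b|) by rewrite ler_pM2l.
have h2 : (1 + L) * K * `|b| < t.
  apply: (@le_lt_trans _ _ ((1 + L) * K * (c * t))).
    by rewrite ler_wpM2l// mulr_ge0 ?addr_ge0// ltW.
  by move: cK c0 t0; set W := (1 + L) * K => *; nra.
have := ler_norm (gamma (col' i (y *m Q) + col' i (b *m Q)) - gamma (col' i (y *m Q))).
have := ler_norm (- (b *m Q) 0 i); rewrite normrN.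
move: Dy' h h' b1 h2; rewrite !mxE; set A1 := gamma _; set A2 := gamma _.
set B1 := \sum_j _; set B2 := \sum_j _.
set bb := `|b|; lra.
Qed.

(** Pushing a piece [G] of the boundary inwards along the cone direction by
    infinitely many distances gives disjoint copies of [G] inside [D], which
    has finite measure. *)
Lemma boundary_null D : open D -> bounded_set D ->
  (forall x, closure D x -> exists2 r : R, 0 < r & inner_cone D (ball x r)) ->
  leb (closure D `\` D) = 0%E.
Proof.
move=> oD bD cone; have mD : measurable D by exact: mx_open_measurable.
have mcD := @closure_measurable R n D.
have cD := compact_closure_bounded bD.
have [d d0 dP] := lebesgue_number cD (@inner_coneS _ _ D) cone.
have [s sC Cs] := compact_finite_net cD (fun _ _ => d0).
pose G k := (closure D `\` D) `&` ball (nth 0 s k) d.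
have mG k : measurable (G k).
  apply: measurableI; first exact: measurableD.
  by apply: mx_open_measurable; exact: ball_open.
have G0 k : (k < size s)%N -> leb (G k) = 0%E.
  move=> ks; have [v [c [c0 Hv]]] := dP _ (sC _ (mem_nth 0 ks)).
  have push y t : G k y -> 0 < t -> t < c -> D (y + t *: v).
    move=> [[cDy nDy] yB] t0 tc.
    have yn : nbhs y (ball (nth 0 s k) d `&` ball y (c * t)).
      apply: filterI; last by apply: nbhsx_ballx; rewrite mulr_gt0.
      by apply: open_nbhs_nbhs; split => //; exact: ball_open.
    have [y' [Dy' [By' yy']]] := cDy _ yn.
    rewrite (_ : y + _ = y' + t *: v + (y - y')); last by rewrite [RHS]addrC addrA subrK.
    by apply: Hv => //; move: yy'; rewrite -ball_normE/= => /ltW.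
  (* The differences of these distances are also admissible, so two copies
     cannot meet: otherwise a point of the boundary would be pushed onto another
     one instead of into [D]. *)
  pose t j : R := c / j.+2%:R.
  have t0 j : 0 < t j by rewrite divr_gt0.
  have tc j : t j < c by rewrite ltr_pdivrMr// ltr_pMr// ltr1n.
  have tlt i j : (i < j)%N -> t j < t i.
    by move=> ij; rewrite ltr_pM2l// ltf_pV2 ?posrE// ltr_nat.
  pose T j : set 'rV[R]_n := +%R^~ (- (t j *: v)) @^-1` G k.
  have mT j : measurable (T j).
    by rewrite -[X in measurable X]setTI; exact: measurable_rV_addr.
  have tT : trivIset setT T.
    have key i j x : (i < j)%N -> T i x -> T j x -> False.
      move=> ij Ti [[_ + ] _]; apply.
      rewrite (_ : x - t j *: v = (x - t i *: v) + (t i - t j) *: v); last first.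
        by rewrite scalerBl addrA subrK.
      apply: push => //; first by rewrite subr_gt0 tlt.
      by apply: lt_trans (tc i); rewrite ltrBlDr ltrDl.
    move=> i j _ _ [x [Ti Tj]]; case: (ltngtP i j) => // ij.
      by case: (key _ _ _ ij Ti Tj).
    by case: (key _ _ _ ij Tj Ti).
  have TD N : \big[setU/set0]_(j < N) T j `<=` D.
    rewrite -bigcup_mkord => x [j _ Tj]; rewrite -[x](subrK (t j *: v)).
    exact: push.
  have Dfin := lebesgue_bounded_lty mD bD.
  have GN N : (\sum_(j < N) leb (G k) <= leb D)%E.
    have <- : leb (\big[setU/set0]_(j < N) T j) = (\sum_(j < N) leb (G k))%E.
      rewrite measure_bigsetU//; apply: eq_bigr => j _; exact: lebesgue_translate.
    apply: le_measure; rewrite ?inE//; exact: bigsetU_measurable.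
  have Gfin : leb (G k) \is a fin_num.
    by rewrite ge0_fin_numE//; apply: le_lt_trans Dfin; have := GN 1%N; rewrite big_ord1.
  have Dfin' : leb D \is a fin_num by rewrite ge0_fin_numE.
  apply/eqP; rewrite eq_le measure_ge0 andbT -(fineK Gfin) lee_fin.
  rewrite leNgt; apply/negP => g0.
  have := GN (Num.truncn (fine (leb D) / fine (leb (G k)))).+1.
  rewrite -(fineK Gfin) -(fineK Dfin') sumEFin lee_fin sumr_const card_ord -mulr_natl -ler_pdivlMr//.
  by rewrite leNgt truncnS_gt.
apply: (@subset_measure0 _ _ _ leb _ (\big[setU/set0]_(k < size s) G k)) => //.
- exact: measurableD.
- exact: bigsetU_measurable.
- move=> x [cDx nDx]; have [y ys xy] := Cs x cDx.
  have sy : (index y s < size s)%N by rewrite index_mem.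
  by rewrite -bigcup_mkord; exists (index y s) => //; split=> //; rewrite nth_index.
- apply/eqP; rewrite eq_le measure_ge0 andbT.
  apply: le_trans (Boole_inequality _ _) _ => //.
  by rewrite big1// => k _; exact: G0.
Qed.

End lipschitz_cone.

(** * The Hahn-Banach theorem *)

Section hahn_banach.
Context {R : realType} {V : lmodType R}.
Variable S : set V.
Hypothesis S0 : S 0.
Hypothesis SD : forall x y, S x -> S y -> S (x + y).
Hypothesis SZ : forall (a : R) x, S x -> S (a *: x).
Implicit Types (p q : V -> R) (x y v : V).

(** Only the values on the subspace [S] matter. *)
Definition sublinear q : Prop :=
  (forall x y, S x -> S y -> q (x + y) <= q x + q y) /\
  (forall (s : R) x, 0 < s -> S x -> q (s *: x) <= s * q x).

Lemma subspaceN x : S x -> S (- x).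
Proof. by move=> Sx; rewrite -scaleN1r; exact: SZ. Qed.

Lemma sublinear0 q : sublinear q -> q 0 = 0.
Proof.
move=> [_ qZ].
have h1 := qZ 2 0 (ltr0Sn R 1) S0; have := qZ (2^-1) 0 _ S0; rewrite invr_gt0 => /(_ (ltr0Sn R 1)).
by rewrite !scaler0 in h1 * => h2; apply/eqP; rewrite eq_le; apply/andP; split; lra.
Qed.

Lemma sublinearZ q (s : R) x : sublinear q -> 0 <= s -> S x -> q (s *: x) = s * q x.
Proof.
move=> sq; rewrite le_eqVlt => /predU1P[<-|s0] Sx; first by rewrite scale0r mul0r sublinear0.
have [_ qZ] := sq; apply/eqP; rewrite eq_le qZ//=.
have := qZ s^-1 (s *: x); rewrite invr_gt0 => /(_ s0 (SZ _ Sx)).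
by rewrite scalerA mulVf ?gt_eqF// scale1r ler_pdivlMl.
Qed.

Lemma sublinear_ge q x : sublinear q -> S x -> - q (- x) <= q x.
Proof.
move=> sq Sx; have := sq.1 x (- x) Sx (subspaceN Sx); rewrite subrr sublinear0//; lra.
Qed.

(** The largest sublinear minorant of [q] that is linear along [v]. *)
Definition linearize_along q v x : R :=
  inf [set q (x + t *: v) - t * q v | t in [set t : R | 0 <= t]].

Section linearize.
Variables (q : V -> R) (v : V).
Hypothesis q_sub : sublinear q.
Hypothesis Sv : S v.

Lemma linearize_along_le x t : S x -> 0 <= t ->
  linearize_along q v x <= q (x + t *: v) - t * q v.
Proof.
move=> Sx t0; apply: ge_inf; last by exists t.
exists (- q (- x)) => _ [s /= s0 <-].
have -> : s * q v = q ((x + s *: v) + (- x)) by rewrite addrAC subrr add0r sublinearZ.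
have := q_sub.1 (x + s *: v) (- x) (SD Sx (SZ _ Sv)) (subspaceN Sx); lra.
Qed.

Lemma linearize_along_ge x (m : R) :
  (forall t, 0 <= t -> m <= q (x + t *: v) - t * q v) -> m <= linearize_along q v x.
Proof.
move=> H; apply: lb_le_inf; last by move=> _ [t /= t0 <-]; exact: H.
by exists (q (x + 0 *: v) - 0 * q v), 0 => /=.
Qed.

Lemma linearize_along_sublinear : sublinear (linearize_along q v).
Proof.
split=> [x y Sx Sy|s x s0 Sx].
- rewrite -lerBlDr; apply: linearize_along_ge => t t0.
  rewrite lerBlDr -lerBlDl; apply: linearize_along_ge => t' t'0.
  rewrite lerBlDl; apply: le_trans (linearize_along_le (SD Sx Sy) (addr_ge0 t0 t'0)) _.
  rewrite scalerDl addrACA mulrDl.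
  have := q_sub.1 _ _ (SD Sx (SZ t Sv)) (SD Sy (SZ t' Sv)); lra.
- rewrite -ler_pdivrMl//; apply: linearize_along_ge => t t0.
  rewrite ler_pdivrMl//.
  apply: le_trans (linearize_along_le (SZ s Sx) (mulr_ge0 (ltW s0) t0)) _.
  rewrite -scalerA -scalerDr (sublinearZ q_sub (ltW s0)); last by apply: SD => //; exact: SZ.
  by rewrite mulrBr mulrA.
Qed.

Lemma linearize_along_minorant x : S x -> linearize_along q v x <= q x.
Proof.
by move=> Sx; have := linearize_along_le Sx (lexx 0); rewrite scale0r addr0 mul0r subr0.
Qed.

Lemma linearize_alongN : linearize_along q v (- v) <= - q v.
Proof.
have := linearize_along_le (subspaceN Sv) ler01.
by rewrite scale1r addNr mul1r sublinear0// sub0r.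
Qed.

End linearize.

(** A minimal sublinear functional is linear, since otherwise linearizing it
    along some vector would give a smaller one. *)
Lemma sublinear_dominates_linear p : sublinear p ->
  exists l : V -> R, [/\ forall x y, S x -> S y -> l (x + y) = l x + l y,
    forall (a : R) x, S x -> l (a *: x) = a * l x & forall x, S x -> l x <= p x].
Proof.
move=> sp.
pose T := {q : V -> R | sublinear q /\ forall x, S x -> q x <= p x}.
pose r (q1 q2 : T) : bool := `[< forall x, S x -> sval q2 x <= sval q1 x >].
have Tp : sublinear p /\ forall x, S x -> p x <= p x by [].
have [||A totA|[q [sq qp]] qmin] := @ZL_preorder T (exist _ p Tp) r.
- by move=> t; apply/asboolP.
- move=> q1 q2 q3 /asboolP h12 /asboolP h23; apply/asboolP => x Sx.
  by apply: le_trans (h23 x Sx) (h12 x Sx).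
- have [[a0 Aa0]|nA] := pselect (A !=set0); last first.
    by exists (exist _ p Tp) => s As; exfalso; apply: nA; exists s.
  pose q x := inf [set sval a x | a in A].
  have ge x a : S x -> A a -> q x <= sval a x.
    move=> Sx Aa; apply: ge_inf; last by exists a.
    exists (- p (- x)) => _ [b Ab <-]; have [sb bp] := svalP b.
    apply: le_trans (sublinear_ge sb Sx); rewrite lerN2; apply: bp; exact: subspaceN.
  have le x (m : R) : (forall a, A a -> m <= sval a x) -> m <= q x.
    by move=> H; apply: lb_le_inf; [exists (sval a0 x), a0|move=> _ [a Aa <-]; exact: H].
  have sq : sublinear q.
    split=> [x y Sx Sy|s x s0 Sx].
    + rewrite -lerBlDr; apply: (le x) => a Aa; rewrite lerBlDr -lerBlDl.
      apply: (le y) => b Ab; rewrite lerBlDl; have [[aD _] _] := svalP a; have [[bD _] _] := svalP b.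
      have [/asboolP ab|/asboolP ba] := totA a b Aa Ab.
        apply: le_trans (ge _ _ (SD Sx Sy) Ab) _; apply: le_trans (bD _ _ Sx Sy) _.
        by rewrite lerD2r ab.
      apply: le_trans (ge _ _ (SD Sx Sy) Aa) _; apply: le_trans (aD _ _ Sx Sy) _.
      by rewrite lerD2l ba.
    + rewrite -ler_pdivrMl//; apply: le => a Aa; rewrite ler_pdivrMl//.
      have [[_ aZ] _] := svalP a.
      by apply: le_trans (ge _ _ (SZ s Sx) Aa) _; exact: aZ.
  have qp x : S x -> q x <= p x.
    by move=> Sx; have [_ ap] := svalP a0; apply: le_trans (ge x a0 Sx Aa0) (ap x Sx).
  exists (exist _ q (conj sq qp)) => a Aa; apply/asboolP => x Sx /=; exact: ge.
have qN v : S v -> q (- v) = - q v.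
  move=> Sv; apply/eqP; rewrite eq_le.
  have sl := linearize_along_sublinear sq Sv.
  have lp x : S x -> linearize_along q v x <= p x.
    by move=> Sx; apply: le_trans (linearize_along_minorant sq Sv Sx) (qp x Sx).
  have := qmin (exist _ _ (conj sl lp)).
  have rl : r (exist _ q (conj sq qp)) (exist _ (linearize_along q v) (conj sl lp)).
    by apply/asboolP => x Sx /=; exact: linearize_along_minorant.
  move=> /(_ rl) /asboolP /(_ _ (subspaceN Sv)) /= h.
  rewrite (le_trans h (linearize_alongN sq Sv))/=.
  by have := sublinear_ge sq Sv; rewrite lerNl.
exists q; split => //.
- move=> x y Sx Sy; apply/eqP; rewrite eq_le sq.1//=.
  have := sq.1 (x + y) (- y) (SD Sx Sy) (subspaceN Sy).
  by rewrite addrK qN// lerBrDr.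
- move=> a x Sx; have [a0|a0] := leP 0 a; first exact: sublinearZ.
  have := sublinearZ (s := - a) sq _ Sx; rewrite oppr_ge0 => /(_ (ltW a0)).
  rewrite scaleNr qN; last exact: SZ.
  by rewrite mulNr => /oppr_inj.
Qed.

(** Linearizing [p] along [v] first forces the linear functional below it to touch
    [p] at [v]. *)
Lemma hahn_banach p v : sublinear p -> S v ->
  exists l : V -> R, [/\ forall x y, S x -> S y -> l (x + y) = l x + l y,
    forall (a : R) x, S x -> l (a *: x) = a * l x, forall x, S x -> l x <= p x & l v = p v].
Proof.
move=> sp Sv; have [l [lD lZ lp]] := sublinear_dominates_linear (linearize_along_sublinear sp Sv).
have lep x : S x -> l x <= p x.
  by move=> Sx; apply: le_trans (lp x Sx) (linearize_along_minorant sp Sv Sx).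
exists l; split => //; apply/eqP; rewrite eq_le lep//=.
have := le_trans (lp _ (subspaceN Sv)) (linearize_alongN sp Sv).
by rewrite -scaleN1r lZ// mulN1r lerN2.
Qed.

End hahn_banach.

(** * The dual of the space of integrable functions *)

Section positive_integrand.
Context d (T : measurableType d) (R : realType) (mu : {measure set T -> \bar R}).

Lemma Rintegral0_eq A (h : T -> R) : (forall x, A x -> h x = 0) -> \int[mu]_(x in A) h x = 0.
Proof. by move=> h0; rewrite /Rintegral integral0_eq// => x Ax; rewrite h0. Qed.

Lemma Rintegral_gt0_null A (h : T -> R) : measurable A -> mu.-integrable A (EFin \o h) ->
  (forall x, A x -> 0 < h x) -> \int[mu]_(x in A) h x <= 0 -> mu A = 0%E.
Proof.
move=> mA ih h0 hle.
have mh : measurable_fun A (EFin \o h) by case/integrableP: ih.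
have fin := integrable_fin_num mA ih.
have int0 : (\int[mu]_(x in A) `|(h x)%:E| = 0)%E.
  apply/eqP; rewrite eq_le integral_ge0// andbT.
  rewrite (eq_integral (EFin \o h)); last first.
    by move=> x /set_mem Ax; rewrite /= ger0_norm// ltW// h0.
  by rewrite -(fineK fin) lee_fin.
apply: (@measure_negligible _ _ _ mu _ mA).
have [N [mN N0 sN]] := (ae_eq_integral_abs mu mA mh).1 int0.
exists N; split => // x Ax; apply: sN => /= /(_ Ax)/eqP.
by rewrite eqe gt_eqF// h0.
Qed.

End positive_integrand.

Section L1_dual.
Context d (T : measurableType d) (R : realType) (mu : {sigma_finite_measure set T -> \bar R}).
Variables (D : set T) (F : (T -> R) -> R).
Hypothesis mD : measurable D.
Hypothesis D_lty : (mu D < +oo)%E.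
Local Notation L1 h := (mu.-integrable D (EFin \o h)).
Hypothesis FD : forall h k : T -> R, L1 h -> L1 k -> F (fun x => h x + k x) = F h + F k.
Hypothesis FZ : forall (a : R) (h : T -> R), L1 h -> F (fun x => a * h x) = a * F h.
Hypothesis F_le : forall h : T -> R, L1 h -> F h <= \int[mu]_(x in D) `|h x|.

Let indic_L1 A : measurable A -> L1 (\1_A : T -> R).
Proof.
move=> mA; apply: measurable_bounded_integrable => //.
exists 1; split; first exact: num_real.
by move=> r r1 x Dx; rewrite /= indicE; case: (_ \in _); rewrite ?normr1 ?normr0 ltW// (lt_trans ltr01).
Qed.

Lemma dual_norm_le h : L1 h -> `|F h| <= \int[mu]_(x in D) `|h x|.
Proof.
move=> ih; rewrite ler_norml F_le// andbT lerNl.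
have := F_le (integrableZ_EFin (-1) mD ih); rewrite FZ// mulN1r => /le_trans; apply.
by rewrite le_eqVlt; apply/orP; left; apply/eqP/eq_Rintegral => x _; rewrite mulN1r normrN.
Qed.

Lemma dual_dist_le h k : L1 h -> L1 k ->
  `|F h - F k| <= \int[mu]_(x in D) `|h x - k x|.
Proof.
move=> ih ik; have ib := integrableB_EFin mD ih ik.
apply: le_trans (dual_norm_le ib).
have -> : F (fun x => h x - k x) = F h - F k.
  rewrite -[- F k]mulN1r -FZ// -FD//; last exact: integrableZ_EFin.
  by congr F; apply/funext => x; rewrite mulN1r.
exact: lexx.
Qed.

Lemma dual_ae_eq h k : L1 h -> L1 k -> (forall x, D x -> h x = k x) -> F h = F k.
Proof.
move=> ih ik hk; apply/eqP; rewrite -subr_eq0 -normr_le0.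
apply: le_trans (dual_dist_le ih ik) _.
by rewrite Rintegral0_eq// => x Dx; rewrite hk// subrr normr0.
Qed.

Definition dual_charge (A : set T) : \bar R := (F (\1_A : T -> R))%:E.

Let dual_charge0 : dual_charge set0 = 0%E.
Proof.
congr EFin; have i0 : L1 (\1_set0 : T -> R) by exact: indic_L1.
rewrite (dual_ae_eq i0 (integrableZ_EFin 0 mD i0)); first by rewrite FZ// mul0r.
by move=> x _; rewrite mul0r indicE in_set0.
Qed.

Let dual_charge_fin A : measurable A -> dual_charge A \is a fin_num.
Proof. by []. Qed.

Let dual_chargeU A B : measurable A -> measurable B -> A `&` B = set0 ->
  F (\1_(A `|` B) : T -> R) = F (\1_A : T -> R) + F (\1_B : T -> R).
Proof.
move=> mA mB AB; rewrite -FD; try exact: indic_L1.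
congr F; apply/funext => x; rewrite !indicE in_setU.
case: (boolP (x \in A)) => [xA|]; case: (boolP (x \in B)) => [xB|] //=; rewrite ?addr0 ?add0r//.
have : (A `&` B) x by split; exact/set_mem.
by rewrite AB.
Qed.

(* The remainders are bounded by the measure of the tails of the union. *)
Let dual_charge_sigma_additive : semi_sigma_additive dual_charge.
Proof.
move=> A mA tA mU.
pose U k := \big[setU/set0]_(i < k) A i.
have mUk k : measurable (U k) by exact: bigsetU_measurable.
have sumE k : (\sum_(0 <= i < k) dual_charge (A i) = (F (\1_(U k) : T -> R))%:E)%E.
  elim: k => [|k IH]; first by rewrite big_nil /U big_ord0 -dual_charge0.
  rewrite big_nat_recr//= IH /U big_ord_recr/= -/(U k) dual_chargeU//.
  apply/seteqP; split => // x; rewrite /U -bigcup_mkord => -[[j /= jk Aj] Ak].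
  by have := tA j k I I; rewrite (_ : j = k) ?ltnn// in jk *; apply: tA => //; exists x.
under eq_cvg do rewrite sumE.
apply/cvg_EFin; first by apply: nearW => k.
apply/cvgrPdist_le => e e0.
have i1 : mu.-integrable setT (EFin \o (fun x => 1 * \1_D x : R)).
  apply/(integrable_mul_indic mu (fun=> 1) mD).
  have := indic_L1 measurableT; apply: eq_integrable => // x _ /=.
  by rewrite indicE in_setT.
pose E k := \bigcup_i A i `\` U k.
have mE k : measurable (E k) by exact: measurableD.
have [|k0 k0P] := integral_tail_small i1 mE _ e0.
  move=> x; have [[i _ Ai]|nA] := pselect ((\bigcup_i A i) x); last by exists 0%N => k _ [].
  exists i.+1 => k ik [_]; apply; rewrite /U -bigcup_mkord; by exists i.
exists k0 => // k /= /k0P; rewrite -/(U k) => le_e.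
apply: le_trans (dual_dist_le _ _) _; try exact: indic_L1.
rewrite -lee_fin; apply: le_trans le_e.
rewrite Rintegral_indic /Rintegral fineK.
  rewrite le_eqVlt; apply/orP; left; apply/eqP/eq_integral => x _; congr EFin.
  have D0 : `|\1_D x| = \1_D x :> R by rewrite indicE ger0_norm.
  rewrite mul1r D0 mulrC; congr (_ * _).
  rewrite !indicE /E in_setD.
  have : U k `<=` \bigcup_i A i by rewrite /U -bigcup_mkord => y [j _ Aj]; exists j.
  have [xU|xU] := pselect (U k x).
    by move=> /(_ _ xU) xA; rewrite (mem_set xU) (mem_set xA) subrr normr0.
  by rewrite (memNset xU) subr0 andbT ger0_norm.
apply: integrable_fin_num => //; apply/(integrable_mul_indic mu _ mD).
have := integrable_norm (integrableB_EFin mD (indic_L1 mU) (indic_L1 (mUk k))).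
by apply: eq_integrable.
Qed.

HB.instance Definition _ := isCharge.Build _ _ _ dual_charge
  dual_charge0 dual_charge_fin dual_charge_sigma_additive.

Lemma dual_charge_dominated : dual_charge `<< mu.
Proof.
apply/null_content_dominatesP => A mA A0; congr EFin.
apply/eqP; rewrite -normr_le0; apply: le_trans (dual_norm_le (indic_L1 mA)) _.
rewrite (_ : \int[mu]_(x in D) _ = \int[mu]_(x in D) \1_A x); last first.
  by apply: eq_Rintegral => x _; rewrite ger0_norm.
have AD0 : mu (A `&` D) = 0%E.
  by apply: (subset_measure0 _ mA _ A0) => //; exact: measurableI.
suff -> : \int[mu]_(x in D) \1_A x = fine (mu (A `&` D)) by rewrite AD0.
by rewrite /Rintegral integral_indic.
Qed.

(** The value of [F] on the indicator of a set is a charge dominated by [mu]; its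
    Radon-Nikodym derivative is at most [1] in absolute value because [F] is
    bounded by the mean. *)
Lemma dual_density : exists zeta : T -> R,
  [/\ measurable_fun setT zeta, forall x, `|zeta x| <= 1 &
      forall A, measurable A -> F (\1_A : T -> R) = \int[mu]_(x in D) (zeta x * \1_A x)].
Proof.
have dom := dual_charge_dominated.
pose rho := Radon_Nikodym dual_charge mu.
pose z0 x := fine (rho x).
have rhoE x : rho x = (z0 x)%:E by rewrite /z0 fineK//; exact: Radon_Nikodym_fin_num.
have irho : mu.-integrable setT (EFin \o z0).
  apply: eq_integrable (Radon_Nikodym_integrable dom) => // x _.
have mz0 : measurable_fun setT z0 by exact: integrable_measurable irho.
have FE A : measurable A -> F (\1_A : T -> R) = \int[mu]_(x in A) z0 x.
  move=> mA; have := Radon_Nikodym_integral dom mA; rewrite /Rintegral => E.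
  rewrite -[LHS]/(fine (dual_charge A)) E; congr fine.
  by apply: eq_integral => x _; exact: rhoE.
have AE A : measurable A -> A `<=` D -> \int[mu]_(x in D) `|(\1_A : T -> R) x| = \int[mu]_(x in A) 1.
  move=> mA AD; rewrite (Rintegral_indic _ D) (Rintegral_indic _ A); apply: eq_Rintegral => x _.
  rewrite mul1r ger0_norm// -[RHS]mulr1 !indicE; have [xA|xA] := pselect (A x).
    by rewrite (mem_set xA) (mem_set (AD _ xA)).
  by rewrite (memNset xA) !mul0r.
have i1 A : measurable A -> A `<=` D -> mu.-integrable A (EFin \o (fun=> 1 : R)).
  move=> mA AD; apply: (integrableS mD) => //; have := indic_L1 measurableT.
  by apply: eq_integrable => // x _ /=; rewrite indicE in_setT.
pose P := D `&` z0 @^-1` [set` `]1, +oo[].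
pose N := D `&` z0 @^-1` [set` `]-oo, (-1)[].
have mP : measurable P by apply: (measurable_funTS mz0).
have mN : measurable N by apply: (measurable_funTS mz0).
have PD : P `<=` D by move=> x [].
have ND : N `<=` D by move=> x [].
have iz A : measurable A -> mu.-integrable A (EFin \o z0) by move=> mA; exact: integrableS irho.
have P0 : mu P = 0%E.
  apply: (@Rintegral_gt0_null _ _ _ _ _ (fun x => z0 x - 1)) => //.
  - by apply: integrableB_EFin => //; [exact: iz|exact: i1].
  - by move=> x [_ /=]; rewrite in_itv/= andbT subr_gt0.
  rewrite RintegralB//; [|exact: iz|exact: i1].
  rewrite subr_le0 -FE// -AE//; apply: F_le; exact: indic_L1.
have N0 : mu N = 0%E.
  apply: (@Rintegral_gt0_null _ _ _ _ _ (fun x => - 1 * z0 x - 1)) => //.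
  - apply: integrableB_EFin => //; [|exact: i1].
    by apply: integrableZ_EFin => //; exact: iz.
  - by move=> x [_ /=]; rewrite in_itv/=; lra.
  rewrite RintegralB//; [|by apply: integrableZ_EFin => //; exact: iz|exact: i1].
  rewrite RintegralZl//; last exact: iz.
  rewrite subr_le0 -FE// -AE// mulN1r.
  by apply: le_trans (dual_norm_le (indic_L1 mN)); rewrite -normrN; exact: ler_norm.
pose E := z0 @^-1` [set` `[(-1), 1]].
have mE : measurable E by rewrite -[E]setTI; exact: mz0.
exists (fun x => z0 x * \1_E x); split.
- by apply: measurable_mul_indic => //; exact: measurable_funTS.
- move=> x; rewrite indicE; have [xE|xE] := pselect (E x).
    by rewrite (mem_set xE) mulr1 ler_norml; move: xE; rewrite /E/= in_itv.
  by rewrite (memNset xE) mulr0 normr0.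
- move=> A mA; have mAD := measurableI _ _ mA mD.
  rewrite (@dual_ae_eq _ (\1_(A `&` D) : T -> R)); [|exact: indic_L1|exact: indic_L1|]; last first.
    by move=> x Dx; rewrite indicI/= [X in _ * X]indicE (mem_set Dx) mulr1.
  rewrite FE// (Rintegral_indic _ (A `&` D)) (Rintegral_indic _ D).
  apply: Rintegral_ae_eq => //.
  + by apply: measurable_mul_indic => //; exact: measurable_funTS.
  + apply: measurable_mul_indic => //; apply: measurable_funTS.
    by apply: measurable_funM; [apply: measurable_mul_indic => //; exact: measurable_funTS|exact: measurable_indic].
  have : mu.-negligible (P `|` N).
    by apply: negligibleU; [exists P|exists N]; split.
  move=> H; have {}H : {ae mu, forall x, ~ (P `|` N) x}.
    by apply: negligibleS H => x /= /contrapT.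
  apply: filterS H => x nPN _.
  rewrite indicI/=; have [Dx|Dx] := pselect (D x); last by rewrite [X in _ * (_ * X)]indicE [X in _ = _ * X]indicE (memNset Dx) !mulr0.
  rewrite -!mulrA; congr (_ * _); rewrite [X in _ = X * _]indicE mem_set ?mul1r//.
  rewrite /E/= in_itv/= !leNgt; apply/andP; split; apply/negP => zx; apply: nPN.
    by right; split => //=; rewrite in_itv.
  by left; split => //=; rewrite in_itv/= andbT.
Qed.

(** Both sides are continuous in the mean, and simple functions are dense. *)
Theorem L1_dual : exists zeta : T -> R,
  [/\ measurable_fun setT zeta, forall x, `|zeta x| <= 1 &
      forall h, L1 h -> F h = \int[mu]_(x in D) (zeta x * h x)].
Proof.
have [zeta [mz z1 zE]] := dual_density; exists zeta; split => //.
have izh h : L1 h -> L1 (fun x => zeta x * h x).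
  move=> ih; have : L1 (fun x => h x * zeta x).
    by apply: (integrableM_bounded (C := 1)) => //; exact: measurable_funTS.
  by apply: eq_integrable => // x _ /=; rewrite mulrC.
have F0 : F (fun=> 0) = 0.
  have i0 := indic_L1 (@measurable0 _ T).
  transitivity (F (fun x => 0 * \1_set0 x : R)); last by rewrite FZ// mul0r.
  by congr F; apply/funext => x; rewrite mul0r.
have sE (s : seq R) (E : R -> set T) : (forall y, measurable (E y)) ->
    F (fun x => \sum_(y <- s) y * \1_(E y) x) =
    \int[mu]_(x in D) (zeta x * \sum_(y <- s) y * \1_(E y) x).
  move=> mE; have isum := (Rintegral_sum _ mD (fun y => integrableZ_EFin y mD (indic_L1 (mE y)))).
  elim: s => [|y s IH].
    under [in LHS]eq_fun do rewrite big_nil; rewrite F0 Rintegral0_eq// => x _.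
    by rewrite big_nil mulr0.
  under [in LHS]eq_fun do rewrite big_cons.
  have [i1 _] := isum s.
  rewrite FD//; last by apply: integrableZ_EFin => //; exact: indic_L1.
  rewrite IH FZ; last exact: indic_L1.
  rewrite zE// -RintegralZl//; last by apply: izh; exact: indic_L1.
  rewrite -RintegralD//.
  - by apply: eq_Rintegral => x _; rewrite big_cons mulrDr mulrCA.
  - by apply: integrableZ_EFin => //; apply: izh; exact: indic_L1.
  - exact: izh.
move=> h ih; apply/eqP; rewrite -subr_eq0 -normr_le0; apply/ler_addgt0Pr => e e0; rewrite add0r.
have e2 : 0 < e / 2 by rewrite divr_gt0.
have [g [ig _ /(_ [set y | (y < (e / 2)%:E)%E])]] := approximation_sfun_integrable mD ih.
case; first by apply: open_nbhs_nbhs; split; [exact: open_ereal_lt_ereal|rewrite /= lte_fin].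
move=> N _ /(_ N (leqnn N)) /ltW gN.
have iN : L1 (g N : T -> R) by exact: ig.
have gE : F (g N : T -> R) = \int[mu]_(x in D) (zeta x * g N x).
  have gsum : (g N : T -> R) = fun x => \sum_(y <- finmap.enum_fset (fset_set (range (g N))))
      y * \1_(g N @^-1` [set y]) x.
    by apply/funext => x; rewrite fimfunE fsbig_finite.
  by rewrite gsum sE// => y; exact: measurable_sfunP.
have dist : \int[mu]_(x in D) `|h x - g N x| <= e / 2.
  rewrite -lee_fin /Rintegral fineK; first by apply: le_trans gN; rewrite le_eqVlt; apply/orP; left; apply/eqP/eq_integral.
  by apply: integrable_fin_num => //; exact: integrable_norm (integrableB_EFin mD ih iN).
rewrite (_ : _ - _ = (F h - F (g N : T -> R)) + (F (g N : T -> R) - \int[mu]_(x in D) (zeta x * h x))); last by ring.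
rewrite [e]splitr; apply: le_trans (ler_normD _ _) _; apply: lerD.
  by apply: le_trans (dual_dist_le ih iN) _.
rewrite gE -RintegralB//; [|exact: izh|exact: izh].
have ib := integrableB_EFin mD (izh _ iN) (izh _ ih).
apply: le_trans (le_normr_Rintegral mD ib) _; apply: le_trans dist.
apply: le_Rintegral => //.
- exact: integrable_norm.
- exact: integrable_norm (integrableB_EFin mD ih iN).
move=> x Dx; rewrite -mulrBr normrM distrC ler_piMl//.
Qed.

End L1_dual.

(** * Test functions and measures with a density *)

Section test_function_space.
Context {R : realType} {n : nat}.
Local Notation leb := (@lebesgue_rV R n).
Implicit Types (D : set 'rV[R]_n) (phi psi : 'rV[R]_n -> R).

Lemma test_function0 D : test_function D (fun=> 0).
Proof.
have s0 : closure [set x : 'rV[R]_n | (0 : R) != 0] = set0.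
  rewrite (_ : [set x | _] = set0) ?closure0//.
  by apply/seteqP; split => // x /=; rewrite eqxx.
by split; rewrite ?s0//; [exact: smooth_cst|exact: compact0].
Qed.

Lemma test_functionD D phi psi : test_function D phi -> test_function D psi ->
  test_function D (fun x => phi x + psi x).
Proof.
move=> [s1 c1 D1] [s2 c2 D2].
have sub : closure [set x | phi x + psi x != 0] `<=`
    closure [set x | phi x != 0] `|` closure [set x | psi x != 0].
  rewrite -closureU; apply: closure_subset => x /= H.
  have [p0|p0] := eqVneq (phi x) 0; last by left.
  by right; move: H; rewrite p0 add0r.
split; first exact: smoothD.
- by apply: (subclosed_compact _ _ sub); [exact: closed_closure|exact: compactU].
- by move=> x /sub[/D1|/D2].
Qed.

Lemma test_functionZ D (k : R) phi : test_function D phi ->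
  test_function D (fun x => k * phi x).
Proof.
move=> [s1 c1 D1].
have sub : closure [set x | k * phi x != 0] `<=` closure [set x | phi x != 0].
  by apply: closure_subset => x /=; apply: contraNneq => ->; rewrite mulr0.
split; first by apply: smoothM => //; exact: smooth_cst.
- by apply: (subclosed_compact _ _ sub) => //; exact: closed_closure.
- exact: subset_trans D1.
Qed.

Lemma test_function_out D phi x : test_function D phi -> ~ D x -> phi x = 0.
Proof.
move=> [_ _ sD] nD; apply/eqP/negPn/negP => px; apply: nD; apply: sD.
exact: subset_closure.
Qed.

Lemma gradD phi psi x : smooth phi -> smooth psi ->
  grad (fun x => phi x + psi x) x = grad phi x + grad psi x.
Proof. by move=> s1 s2; apply/rowP => i; rewrite !mxE partialD. Qed.

Lemma gradZ (k : R) phi x : smooth phi -> grad (fun x => k * phi x) x = k *: grad phi x.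
Proof. by move=> s1; apply/rowP => i; rewrite !mxE partialZ. Qed.

Lemma grad0 x : grad (fun=> 0 : R) x = 0 :> 'rV[R]_n.
Proof.
by apply/rowP => i; rewrite !mxE; apply: derive_val; exact: is_derive_cst.
Qed.

Lemma partial_in_L1 D E i phi : measurable E -> test_function D phi ->
  in_L1 E (partial i phi).
Proof.
move=> mE tphi; have [M HM] := test_function_support tphi.
apply: (integrableS measurableT mE (@subsetT _ _)).
apply: (continuous_support_integrable (M := M)); last exact: support_in_partial.
by apply: smooth_continuous; apply: smooth_partial; exact: test_function_smooth tphi.
Qed.

Lemma continuous_reflect phi : continuous phi -> continuous (fun x : 'rV[R]_n => phi (- x)).
Proof.
move=> cphi x; apply: (@continuous_comp _ _ _ (fun y : 'rV[R]_n => - y) phi); last exact: cphi.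
exact: (@cvgN R 'rV[R]_n 'rV[R]_n (nbhs x) (nbhs_filter x) (fun x => x) x (@cvg_id _ _)).
Qed.

Lemma smooth_reflect phi : smooth phi -> smooth (fun x : 'rV[R]_n => phi (- x)).
Proof.
move=> /smooth_uptoP sphi; apply/smooth_uptoP => k.
elim: k phi {sphi}(sphi k) => [|k IH] phi [cphi dphi].
  by split=> //; exact: continuous_reflect.
split; first exact: continuous_reflect.
move=> i; have [d dd sd] := dphi i; exists (fun x => -1 * d (- x)).
  by move=> x; rewrite mulN1r; exact: is_derive_reflect.
by apply: smooth_uptoM; [exact: smooth_upto_cst|exact: IH].
Qed.

(** The convolution of the reflected function with the indicator of a large ball is
    constant near the origin, and its derivative there is minus the integral. *)
Lemma Rintegral_partial0 phi M i : smooth phi -> support_in M phi ->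
  \int[leb]_x partial i phi x = 0.
Proof.
move=> sphi phiM.
pose B : set 'rV[R]_n := ball 0 (`|M| + 2).
have inB y : B y <-> `|y| < `|M| + 2 by rewrite /B -ball_normE/= sub0r normrN.
have mB : measurable B by apply: mx_open_measurable; exact: ball_open.
have iB : leb.-integrable setT (EFin \o (\1_B : 'rV[R]_n -> R)).
  apply: (@bounded_support_integrable _ _ _ (`|M| + 2) 1) => //.
  - by move=> x; exact: normr_indic_le1.
  - by move=> x Mx; rewrite indicE memNset// => /inB; rewrite ltNge ltW.
pose psi x := phi (- x).
have spsi : smooth psi by exact: smooth_reflect.
have psiM : support_in M psi by move=> x Mx; apply: phiM; rewrite normrN.
have dpsi x : partial i psi x = - partial i phi (- x).
  by apply: derive_val; apply: is_derive_reflect; exact: smooth_is_derive.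
have D1 := @derive_val _ _ _ _ _ _ _ (is_derive_conv i 0 spsi psiM iB).
have D2 : 'D_(delta_mx 0 i) (conv psi \1_B) 0 = 0.
  rewrite -(@derive_val _ _ _ _ _ _ _ (is_derive_cst (\int[leb]_x phi x) (0 : 'rV[R]_n) (delta_mx 0 i))).
  apply: near_eq_derive; apply/nbhs_ballP; exists 1 => //= x.
  rewrite -ball_normE/= sub0r normrN => x1.
  have iphi : leb.-integrable setT (EFin \o phi).
    by apply: continuous_support_integrable phiM; exact: smooth_continuous.
  rewrite -(Rintegral_translate (- x) iphi); apply: eq_Rintegral => y _.
  rewrite /psi opprB indicE; have [yB|yB] := pselect (B y); first by rewrite (mem_set yB) mulr1.
  rewrite (memNset yB) mulr0 phiM//.
  have : `|M| + 2 <= `|y| by rewrite leNgt; apply/negP => /inB.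
  have := ler_normD (y - x) x; rewrite subrK; have := ler_norm M; move: x1; lra.
have : - (\int[leb]_x partial i phi x) = 0.
  rewrite -D2 D1 -mulN1r -RintegralZl//; last first.
    apply: (continuous_support_integrable (M := M)); last exact: support_in_partial.
    by apply: smooth_continuous; exact: smooth_partial.
  apply: eq_Rintegral => y _; rewrite dpsi sub0r opprK indicE mulN1r.
  have [yB|yB] := pselect (B y); first by rewrite (mem_set yB) mulr1.
  rewrite (memNset yB) mulr0 (support_in_partial i phiM) ?oppr0//.
  have : `|M| + 2 <= `|y| by rewrite leNgt; apply/negP => /inB.
  by have := ler_norm M; lra.
by move/eqP; rewrite oppr_eq0 => /eqP.
Qed.

Lemma test_by_parts D E phi psi i : test_function D phi -> test_function E psi ->
  \int[leb]_x (phi x * partial i psi x) = - \int[leb]_x (partial i phi x * psi x).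
Proof.
move=> tphi tpsi.
have [s1 s2] := (test_function_smooth tphi, test_function_smooth tpsi).
have [M HM] := test_function_support tphi.
have [C HC] := test_function_bounded tpsi; have [C' HC'] := partial_bounded i tpsi.
have i1 : leb.-integrable setT (EFin \o phi).
  by apply: continuous_support_integrable HM; exact: smooth_continuous.
have i2 := partial_in_L1 i measurableT tphi.
have i3 := integrableM_bounded measurableT i1 (partial_measurable i s2) (fun x _ => HC' x).
have i4 := integrableM_bounded measurableT i2 (smooth_measurable s2) (fun x _ => HC x).
apply/eqP; rewrite -addr_eq0 -RintegralD//.
have HM' : support_in M (fun x => phi x * psi x) by move=> x /HM ->; rewrite mul0r.
rewrite -(Rintegral_partial0 i (smoothM s1 s2) HM'); apply/eqP/eq_Rintegral => x _.
by rewrite partialM// [X in _ = _ + X]mulrC.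
Qed.

End test_function_space.

Section induced_charges.
Context d (T : measurableType d) (R : realType) (mu : {measure set T -> \bar R}).

(** The values are rounded down to a grid of step [e]. *)
Lemma bounded_simple_approx (A : set T) (phi : T -> R) (C e : R) : measurable A ->
  measurable_fun A phi -> (forall x, A x -> `|phi x| <= C) -> 0 < e ->
  exists N (c : 'I_N -> R) (E : 'I_N -> set T), [/\ forall k, measurable (E k),
    forall k, E k `<=` A & forall x, A x -> `|phi x - \sum_k c k * \1_(E k) x| <= e].
Proof.
move=> mA mphi phiC e0.
pose cell (k : nat) : interval R := `[- C + k%:R * e, - C + k.+1%:R * e[.
pose N := (Num.truncn (2 * C / e)).+1.
exists N, (fun k : 'I_N => - C + k%:R * e), (fun k : 'I_N => A `&` phi @^-1` [set` cell k]).
split=> [k|k|x Ax]; [exact: mphi|by move=> x []|].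
have /andP[Cphi phiC'] : - C <= phi x <= C by rewrite -ler_norml phiC.
pose k0 := Num.truncn ((phi x + C) / e).
have q0 : 0 <= (phi x + C) / e by apply: divr_ge0; [lra|exact: ltW].
have /andP[k0l k0u] : k0%:R <= (phi x + C) / e < k0.+1%:R by exact: truncn_itv.
rewrite ler_pdivlMr// in k0l; rewrite ltr_pdivrMr// in k0u.
have k0N : (k0 < N)%N.
  rewrite ltnS; apply: le_truncn; rewrite ler_pM2r ?invr_gt0//; lra.
have cellx k : phi x \in cell k -> k = k0.
  rewrite in_itv/= => /andP[l u].
  have h1 : k%:R * e < k0.+1%:R * e by move: l u k0l k0u; lra.
  have h2 : k0%:R * e < k.+1%:R * e by move: l u k0l k0u; lra.
  by move: h1 h2; rewrite !ltr_pM2r// !ltr_nat !ltnS => h1 h2; apply/eqP; rewrite eqn_leq h1.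
rewrite (bigD1 (Ordinal k0N))//= big1 ?addr0; last first.
  move=> k /eqP nk; rewrite indicE memNset ?mulr0// => -[_ /= /cellx kk].
  by apply: nk; apply: val_inj.
rewrite indicE mem_set; last first.
  by split => //=; rewrite in_itv/=; apply/andP; split; move: k0l k0u; lra.
rewrite mulr1 ler_norml; move: k0l k0u; rewrite -[k0.+1]addn1 natrD mulrDl mul1r; lra.
Qed.

Variables (f : T -> R).
Hypothesis intf : mu.-integrable setT (EFin \o f).

(** Both sides are stable under uniform approximation of [phi] and are explicit
    finite sums when [phi] is simple. *)
Lemma charge_Rintegral_induced (A : set T) (phi : T -> R) (C : R) : measurable A ->
  measurable_fun A phi -> (forall x, A x -> `|phi x| <= C) ->
  charge_Rintegral (induced_charge intf) A phi = \int[mu]_(x in A) (f x * phi x).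
Proof.
move=> mA mphi phiC; pose nu := induced_charge intf.
have ifA : mu.-integrable A (EFin \o f) by exact: integrableS intf.
have iabs := integrable_norm ifA.
pose K := charge_tv nu A + \int[mu]_(x in A) `|f x| + 1.
have K0 : 0 < K.
  by rewrite ltr_wpDl// addr_ge0 ?charge_tv_ge0// Rintegral_ge0.
apply/eqP; rewrite -subr_eq0 -normr_le0; apply/ler_addgt0Pr => e e0; rewrite add0r.
have eK : 0 < e / K by rewrite divr_gt0.
have [N [c [E [mE EA cE]]]] := bounded_simple_approx mA mphi phiC eK.
have h1 := charge_Rintegral_simple nu mA mphi phiC mE EA cE.
have i1 k : mu.-integrable A (EFin \o (fun x => f x * \1_(E k) x)).
  apply: (integrableM_bounded (C := 1)) => // x _; exact: normr_indic_le1.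
have [isum sumE] := Rintegral_sum (index_enum 'I_N) mA (fun k => integrableZ_EFin (c k) mA (i1 k)).
have nuE : \sum_k c k * fine (nu (E k)) = \int[mu]_(x in A) (f x * \sum_k c k * \1_(E k) x).
  transitivity (\sum_k \int[mu]_(x in A) (c k * (f x * \1_(E k) x))); last first.
    by rewrite -sumE; apply: eq_Rintegral => x _; rewrite big_distrr/=; apply: eq_bigr => k _; rewrite mulrCA.
  apply: eq_bigr => k _; rewrite RintegralZl//; congr (_ * _).
  by rewrite Rintegral_subset.
have ifs : mu.-integrable A (EFin \o (fun x => f x * \sum_k c k * \1_(E k) x)).
  by apply: eq_integrable isum => // x _ /=; rewrite big_distrr/=; congr EFin; apply: eq_bigr => k _; rewrite mulrCA.
have ifp := integrableM_bounded mA ifA mphi phiC.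
have h2 : `|\int[mu]_(x in A) (f x * \sum_k c k * \1_(E k) x) - \int[mu]_(x in A) (f x * phi x)| <=
    e / K * \int[mu]_(x in A) `|f x|.
  rewrite -RintegralB//; apply: le_trans (le_normr_Rintegral mA (integrableB_EFin mA ifs ifp)) _.
  rewrite -RintegralZl//; apply: le_Rintegral => //.
  - exact: integrable_norm (integrableB_EFin mA ifs ifp).
  - exact: integrableZ_EFin.
  by move=> x Ax; rewrite -mulrBr normrM mulrC distrC ler_wpM2r// cE.
rewrite nuE in h1.
have eKE : e / K * charge_tv nu A + e / K * \int[mu]_(x in A) `|f x| + e / K = e.
  by rewrite -[X in _ + _ + X]mulr1 -!mulrDr -/K divfK ?gt_eqF.
set I0 := Rintegral _ _ (fun x => f x * phi x) in h2 *.
set I1 := Rintegral _ _ _ in h1 h2.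
rewrite (_ : _ - I0 = charge_Rintegral nu A phi - I1 + (I1 - I0)); last by rewrite addrA subrK.
apply: le_trans (ler_normD _ _) _; apply: le_trans (lerD h1 h2) _.
by rewrite -[leRHS]eKE lerDl ltW.
Qed.

End induced_charges.

Section integrable_fields.
Context {R : realType} {n : nat}.
Local Notation leb := (@lebesgue_rV R n).
Implicit Types (A : set 'rV[R]_n) (g h : 'rV[R]_n -> 'rV[R]_n).

Definition field_L1 A g : Prop := forall i, in_L1 A (fun x => g x 0 i).

Lemma enorm_in_L1 A g : measurable A -> field_L1 A g -> in_L1 A (fun x => enorm (g x)).
Proof.
move=> mA ig.
have [isum _] := Rintegral_sum (index_enum 'I_n) mA (fun i => integrable_norm (ig i)).
apply: (dominated_integrable mA _ isum) => [|x _].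
  by apply: measurable_enorm => // i; exact: integrable_measurable (ig i).
by rewrite ger0_norm ?enorm_ge0// enorm_le_sum.
Qed.

Lemma field_L1D A g h : measurable A -> field_L1 A g -> field_L1 A h -> field_L1 A (g + h).
Proof.
move=> mA ig ih i; rewrite /in_L1; under eq_fun do rewrite mxE.
by apply: integrableD_EFin => //; [exact: ig|exact: ih].
Qed.

Lemma field_L1Z A (a : R) g : measurable A -> field_L1 A g -> field_L1 A (a *: g).
Proof.
move=> mA ig i; rewrite /in_L1; under eq_fun do rewrite mxE.
by apply: integrableZ_EFin => //; exact: ig.
Qed.

Lemma field_L1_grad A D phi : measurable A -> test_function D phi -> field_L1 A (grad phi).
Proof.
move=> mA tphi i; rewrite /in_L1; under eq_fun do rewrite mxE.
exact: partial_in_L1 tphi.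
Qed.

(** The integral vector is tested against itself. *)
Lemma enorm_Rintegral_le A g : measurable A -> field_L1 A g ->
  enorm (\row_i \int[leb]_(x in A) g x 0 i) <= \int[leb]_(x in A) enorm (g x).
Proof.
move=> mA ig; set v := \row_i _; have ie := enorm_in_L1 mA ig.
have [v0|v0] := eqVneq (enorm v) 0; first by rewrite v0 Rintegral_ge0// => x _; exact: enorm_ge0.
have vp : 0 < enorm v by rewrite lt_neqAle eq_sym v0 enorm_ge0.
rewrite -(ler_pM2l vp) -expr2 enorm_sqr -RintegralZl//.
have iz i : leb.-integrable A (EFin \o (fun x => v 0 i * g x 0 i)) by apply: integrableZ_EFin => //; exact: ig.
have [isum sumE] := Rintegral_sum (index_enum 'I_n) mA iz.
rewrite (_ : dot v v = \int[leb]_(x in A) dot v (g x)); last first.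
  rewrite /dot sumE; apply: eq_bigr => i _; rewrite RintegralZl//; last exact: ig.
  by congr (_ * _); rewrite mxE.
apply: le_Rintegral => //; first exact: integrableZ_EFin.
by move=> x _; exact: dot_le_enorm.
Qed.

Lemma variation_density_le A (g : 'I_n -> 'rV[R]_n -> R)
    (ig : forall i, leb.-integrable setT (EFin \o g i)) : measurable A ->
  (vmeasure_variation (fun i => induced_charge (ig i)) A <=
   (\int[leb]_(x in A) enorm (\row_i g i x))%:E)%E.
Proof.
move=> mA; apply: ub_ereal_sup => _ [E [mE tE UE] <-].
have igA B : measurable B -> field_L1 B (fun x => \row_i g i x).
  move=> mB i; rewrite /in_L1; under eq_fun do rewrite mxE.
  exact: integrableS (ig i).
have ie B mB := enorm_in_L1 mB (igA B mB).
have EA k : E k `<=` A by rewrite -UE; exact: bigcup_sup.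
rewrite /Rintegral fineK; last exact: integrable_fin_num (ie A mA).
rewrite -{1}UE ge0_integral_bigcup//; last 2 first.
- by rewrite UE; case/integrableP: (ie A mA).
- by move=> x _; rewrite lee_fin enorm_ge0.
apply: lee_nneseries => [k _|k _]; first by rewrite lee_fin enorm_ge0.
rewrite -[leRHS]fineK; last exact: integrable_fin_num (ie _ (mE k)).
rewrite lee_fin; apply: le_trans (enorm_Rintegral_le (mE k) (igA _ (mE k))).
rewrite le_eqVlt; apply/orP; left; apply/eqP; congr enorm.
apply/rowP => i; rewrite !mxE /induced_charge /Rintegral; congr fine.
by apply: eq_integral => x _; rewrite /= mxE.
Qed.

End integrable_fields.

(** * Strong duality *)

Section dual_problem.
Context {R : realType} {n : nat}.
Local Notation leb := (@lebesgue_rV R n).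
Variables (D : set 'rV[R]_n) (f : 'rV[R]_n -> R).
Hypothesis D_open : open D.
Hypothesis D_bounded : bounded_set D.
Hypothesis f_L2 : in_L2 D f.
Hypothesis f_dual : in_Wdual_ball D f.
Implicit Types (g h : 'rV[R]_n -> 'rV[R]_n) (phi psi : 'rV[R]_n -> R).

Let mD : measurable D. Proof. exact: mx_open_measurable. Qed.
Let D_lty : (leb D < +oo)%E. Proof. exact: lebesgue_bounded_lty. Qed.

Lemma f_test_integrable phi : test_function D phi ->
  leb.-integrable D (EFin \o (fun x => f x * phi x)).
Proof.
move=> tphi; have [mf f2] := f_L2; have [C HC] := test_function_bounded tphi.
apply: (integrableM_bounded (C := C)) => //.
- exact: square_integrable_integrable.
- by apply: measurable_funTS; apply: smooth_measurable; exact: test_function_smooth tphi.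
Qed.

Lemma field_L1_shift g phi : field_L1 D g -> test_function D phi ->
  field_L1 D (fun x => g x + grad phi x).
Proof. by move=> ig tphi; apply: field_L1D => //; exact: field_L1_grad tphi. Qed.

Definition energy g phi : R :=
  \int[leb]_(x in D) enorm (g x + grad phi x) + \int[leb]_(x in D) (f x * phi x).

(** The infimum of the primal problem over the competitors [u0 + phi], as a
    function of the gradient [g] of [u0]. *)
Definition relaxed g : R := inf [set energy g phi | phi in test_function D].

Lemma energy_ge g phi : field_L1 D g -> test_function D phi ->
  - (\int[leb]_(x in D) enorm (g x)) <= energy g phi.
Proof.
move=> ig tphi.
have iN := field_L1Z (-1) mD ig.
have is_ := field_L1_shift ig tphi.
have igr : field_L1 D (grad phi) by exact: field_L1_grad tphi.
have e1 := enorm_in_L1 mD ig; have e2 := enorm_in_L1 mD is_; have e3 := enorm_in_L1 mD igr.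
have H : \int[leb]_(x in D) enorm (grad phi x) <=
    \int[leb]_(x in D) enorm (g x + grad phi x) + \int[leb]_(x in D) enorm (g x).
  rewrite -RintegralD//; apply: le_Rintegral => //; first exact: integrableD_EFin.
  move=> x _; have := enormD (g x + grad phi x) (-1 *: g x).
  by rewrite enormZ normrN1 mul1r scaleN1r addrAC subrr add0r.
have := f_dual tphi; rewrite ler_norml => /andP[+ _]; rewrite /energy.
move: H; set a := Rintegral _ _ _; set b := Rintegral _ _ _; set c := Rintegral _ _ _.
by set k := Rintegral _ _ _; lra.
Qed.

Lemma relaxed_le g phi : field_L1 D g -> test_function D phi -> relaxed g <= energy g phi.
Proof.
move=> ig tphi; apply: ge_inf; last by exists phi.
exists (- (\int[leb]_(x in D) enorm (g x))) => _ [psi tpsi <-]; exact: energy_ge.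
Qed.

Lemma relaxed_ge g (m : R) : (forall phi, test_function D phi -> m <= energy g phi) ->
  m <= relaxed g.
Proof.
move=> H; apply: lb_le_inf; last by move=> _ [phi tphi <-]; exact: H.
by exists (energy g (fun=> 0)), (fun=> 0) => //; exact: test_function0.
Qed.

Lemma relaxed_le_norm g : field_L1 D g -> relaxed g <= \int[leb]_(x in D) enorm (g x).
Proof.
move=> ig; apply: le_trans (relaxed_le ig (@test_function0 _ _ D)) _.
rewrite /energy [X in _ + X]Rintegral0_eq ?addr0; last by move=> x _; rewrite mulr0.
by rewrite le_eqVlt; apply/orP; left; apply/eqP/eq_Rintegral => x _; rewrite grad0 addr0.
Qed.

(** The competitors form a vector space on which the energy is jointly sublinear,
    and a partial infimum of a sublinear functional is sublinear. *)
Lemma relaxed_sublinear : sublinear (field_L1 D) relaxed.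
Proof.
split=> [g h ig ih|s g s0 ig].
- have igh : field_L1 D (g + h) by exact: field_L1D.
  rewrite -lerBlDr; apply: relaxed_ge => phi tphi.
  rewrite lerBlDr -lerBlDl; apply: relaxed_ge => psi tpsi; rewrite lerBlDl.
  apply: le_trans (relaxed_le igh (test_functionD tphi tpsi)) _.
  have [s1 s2] := (test_function_smooth tphi, test_function_smooth tpsi).
  have i1 := enorm_in_L1 mD (field_L1_shift ig tphi).
  have i2 := enorm_in_L1 mD (field_L1_shift ih tpsi).
  have i3 := enorm_in_L1 mD (field_L1_shift igh (test_functionD tphi tpsi)).
  have f1 := f_test_integrable tphi; have f2 := f_test_integrable tpsi.
  have A1 : \int[leb]_(x in D) enorm ((g + h) x + grad (fun x => phi x + psi x) x) <=
      \int[leb]_(x in D) enorm (g x + grad phi x) + \int[leb]_(x in D) enorm (h x + grad psi x).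
    apply: (@le_trans _ _ (\int[leb]_(x in D) (enorm (g x + grad phi x) + enorm (h x + grad psi x)))).
      apply: (le_Rintegral mD i3); first exact: (integrableD_EFin mD i1 i2).
      by move=> x _; rewrite gradD// [(g + h) x]/(g x + h x) addrACA enormD.
    by rewrite (RintegralD mD i1 i2).
  have A2 : \int[leb]_(x in D) (f x * (phi x + psi x)) <=
      \int[leb]_(x in D) (f x * phi x) + \int[leb]_(x in D) (f x * psi x).
    by rewrite -RintegralD// le_eqVlt; apply/orP; left; apply/eqP/eq_Rintegral => x _; rewrite mulrDr.
  by apply: le_trans (lerD A1 A2) _; rewrite addrACA.
- have isg : field_L1 D (s *: g) by exact: field_L1Z.
  rewrite -ler_pdivrMl//; apply: relaxed_ge => phi tphi; rewrite ler_pdivrMl//.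
  apply: le_trans (relaxed_le isg (test_functionZ s tphi)) _.
  have i1 := enorm_in_L1 mD (field_L1_shift ig tphi).
  rewrite /energy mulrDr -!RintegralZl//; last exact: f_test_integrable.
  rewrite le_eqVlt; apply/orP; left; apply/eqP; congr (_ + _); apply: eq_Rintegral => x _.
    rewrite gradZ; last exact: test_function_smooth tphi.
    by rewrite [(s *: g) x]/(s *: g x) -scalerDr enormZ gtr0_norm.
  by rewrite mulrCA.
Qed.

(* Unfolding is what identifies the measure with its sigma-finite copy. *)
Transparent lebesgue_rV.
Lemma lebesgue_L1_dual (F : ('rV[R]_n -> R) -> R) :
  (forall h k : 'rV[R]_n -> R, in_L1 D h -> in_L1 D k -> F (fun x => h x + k x) = F h + F k) ->
  (forall (a : R) (h : 'rV[R]_n -> R), in_L1 D h -> F (fun x => a * h x) = a * F h) ->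
  (forall h : 'rV[R]_n -> R, in_L1 D h -> F h <= \int[leb]_(x in D) `|h x|) ->
  exists zeta : 'rV[R]_n -> R,
    [/\ measurable_fun setT zeta, forall x, `|zeta x| <= 1 &
      forall h : 'rV[R]_n -> R, in_L1 D h -> F h = \int[leb]_(x in D) (zeta x * h x)].
Proof. exact: (@L1_dual _ _ R (@lebesgue_rV_sf R n) D F mD D_lty). Qed.
Opaque lebesgue_rV.

Section representation.
Variable l : ('rV[R]_n -> 'rV[R]_n) -> R.
Hypothesis lD : forall g h, field_L1 D g -> field_L1 D h -> l (g + h) = l g + l h.
Hypothesis lZ : forall (a : R) g, field_L1 D g -> l (a *: g) = a * l g.
Hypothesis l_le : forall g, field_L1 D g -> l g <= \int[leb]_(x in D) enorm (g x).

Let axis i (h : 'rV[R]_n -> R) : 'rV[R]_n -> 'rV[R]_n := fun x => h x *: delta_mx 0 i.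

Let axis_L1 i (h : 'rV[R]_n -> R) : in_L1 D h -> field_L1 D (axis i h).
Proof.
move=> ih j; rewrite /in_L1.
rewrite (_ : (fun x => _) = (fun x => (i == j)%:R * h x)); last first.
  by apply/funext => x; rewrite !mxE eqxx/= mulrC eq_sym.
exact: integrableZ_EFin.
Qed.

Let axis_sum g : g = \sum_i axis i (fun x => g x 0 i).
Proof.
apply/funext => x; rewrite fct_sumE; apply/rowP => j.
rewrite summxE (bigD1 j)//= !mxE !eqxx mulr1 big1 ?addr0// => i ij.
by rewrite !mxE eq_sym (negbTE ij) andbF mulr0.
Qed.

Lemma field_dual : exists z : 'rV[R]_n -> 'rV[R]_n,
  [/\ forall i, measurable_fun setT (fun x => z x 0 i),
      forall i x, `|z x 0 i| <= 1 &
      forall g, field_L1 D g -> l g = \int[leb]_(x in D) dot (z x) (g x)].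
Proof.
have dual i : exists zeta : 'rV[R]_n -> R,
    [/\ measurable_fun setT zeta, forall x, `|zeta x| <= 1 &
      forall h : 'rV[R]_n -> R, in_L1 D h -> l (axis i h) = \int[leb]_(x in D) (zeta x * h x)].
  apply: (lebesgue_L1_dual (F := fun h : 'rV[R]_n -> R => l (axis i h))).
  - move=> h k ih ik; rewrite -lD; try exact: axis_L1.
    by congr l; apply/funext => x; rewrite /axis scalerDl.
  - move=> a h ih; rewrite -lZ; last exact: axis_L1.
    by congr l; apply/funext => x; rewrite /axis -scalerA.
  - move=> h ih; apply: le_trans (l_le (axis_L1 i ih)) _.
    rewrite le_eqVlt; apply/orP; left; apply/eqP/eq_Rintegral => x _.
    rewrite /axis enormZ (_ : enorm _ = 1) ?mulr1// /enorm /dot (bigD1 i)//= big1 ?addr0.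
      by rewrite !mxE !eqxx mulr1 sqrtr1.
    by move=> j ij; rewrite !mxE (negbTE ij) andbF mul0r.
have /choice[zeta zP] := dual.
exists (fun x => \row_i zeta i x); split.
- by move=> i; under eq_fun do rewrite mxE; have [] := zP i.
- by move=> i x; rewrite mxE; have [] := zP i.
move=> g ig.
have F0 : l 0 = 0.
  have i0 : field_L1 D (0 *: g) by exact: field_L1Z.
  by rewrite -(scale0r g) lZ// mul0r.
have lsum (s : seq 'I_n) : field_L1 D (\sum_(i <- s) axis i (fun x => g x 0 i)) /\
    l (\sum_(i <- s) axis i (fun x => g x 0 i)) = \sum_(i <- s) l (axis i (fun x => g x 0 i)).
  elim: s => [|i s [IH1 IH2]].
    by rewrite !big_nil; split => //; rewrite -(scale0r g); exact: field_L1Z.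
  have ia := axis_L1 i (ig i).
  by rewrite !big_cons lD// IH2; split => //; exact: field_L1D.
rewrite {1}(axis_sum g) (lsum _).2.
have iz i : leb.-integrable D (EFin \o (fun x => zeta i x * g x 0 i)).
  have [mz z1 _] := zP i.
  have := integrableM_bounded mD (ig i) (measurable_funTS mz) (fun x _ => z1 x).
  by apply: eq_integrable => // x _ /=; rewrite mulrC.
have [_ sumE] := Rintegral_sum (index_enum 'I_n) mD iz.
rewrite (_ : \int[leb]_(x in D) dot _ _ = \int[leb]_(x in D) \sum_i zeta i x * g x 0 i).
  by rewrite sumE; apply: eq_bigr => i _; have [_ _ ->] := zP i.
by apply: eq_Rintegral => x _; apply: eq_bigr => i _; rewrite mxE.
Qed.

(** Testing with the field itself on the set where it is longer than [1]. *)
Lemma field_dual_norm (z : 'rV[R]_n -> 'rV[R]_n) : (forall i, measurable_fun setT (fun x => z x 0 i)) ->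
  (forall i x, `|z x 0 i| <= 1) ->
  (forall g, field_L1 D g -> l g = \int[leb]_(x in D) dot (z x) (g x)) ->
  {ae leb, forall x, D x -> enorm (z x) <= 1}.
Proof.
move=> mz z1 lE.
have mez : measurable_fun D (fun x => enorm (z x)).
  by apply: measurable_enorm => // i; exact: measurable_funTS.
pose A := D `&` (fun x => enorm (z x)) @^-1` [set` `]1, +oo[].
have mA : measurable A by exact: mez.
have AD : A `<=` D by move=> x [].
pose g x := \1_A x *: z x.
have icst : leb.-integrable D (EFin \o (fun=> 1 : R)).
  apply: measurable_bounded_integrable => //; exists 1; split; first exact: num_real.
  by move=> r r1 x _ /=; rewrite normr1 ltW.
have ig : field_L1 D g.
  move=> i; apply: (dominated_integrable mD _ icst) => [|x _]; rewrite /g.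
    under eq_fun do rewrite mxE; apply: measurable_funTS; apply: measurable_funM => //.
  rewrite mxE normrM indicE; case: (_ \in _); rewrite ?normr1 ?normr0 ?mul1r ?mul0r//.
have izA : field_L1 A z.
  move=> i; apply: (dominated_integrable mA _ (integrableS mD mA AD icst)) => [|x _].
    exact: measurable_funTS.
  exact: z1.
have iezA := enorm_in_L1 mA izA.
have gE x : enorm (g x) = enorm (z x) * \1_A x.
  by rewrite /g enormZ mulrC ger0_norm// indicE.
have := l_le ig; rewrite lE//.
rewrite (_ : \int[leb]_(x in D) enorm (g x) = \int[leb]_(x in A) enorm (z x)); last first.
  by rewrite -(Rintegral_subset _ _ AD); apply: eq_Rintegral => x _.
rewrite (_ : \int[leb]_(x in D) dot (z x) (g x) = \int[leb]_(x in A) (enorm (z x) ^+ 2)); last first.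
  rewrite -(Rintegral_subset _ _ AD); apply: eq_Rintegral => x _.
  by rewrite /g dotZr enorm_sqr mulrC.
have i2 : leb.-integrable A (EFin \o (fun x => enorm (z x) ^+ 2)).
  apply: (dominated_integrable (g := fun x => n%:R * enorm (z x)) mA) => [||x _].
  - by apply: measurable_funX; exact: measurable_funS mez.
  - exact: integrableZ_EFin.
  rewrite ger0_norm ?sqr_ge0// expr2 ler_wpM2r ?enorm_ge0//.
  apply: le_trans (enorm_le_sum _) _; rewrite -[n in n%:R]card_ord -sumr_const.
  by apply: ler_sum => i _; exact: z1.
rewrite -subr_le0 -RintegralB// => le0.
have A0 : leb A = 0%E.
  apply: Rintegral_gt0_null le0 => //; first exact: integrableB_EFin.
  move=> x [_ /=]; rewrite in_itv/= andbT => z_gt1.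
  by rewrite subr_gt0 expr2 ltr_pMl// (lt_trans ltr01).
exists A; split => // x /= H; apply: contrapT => nA; apply: H => Dx.
by rewrite leNgt; apply/negP => zx; apply: nA; split => //=; rewrite in_itv/= andbT.
Qed.

End representation.

(** The functional given by the Hahn-Banach theorem is dominated by the mean of the
    norm, hence is given by a field in the unit ball of [L^oo]. At the gradient of a
    test function, [relaxed] is at most minus the integral of [f] against that
    function; applied to opposite test functions, this prescribes the divergence. *)
Theorem dual_maximizer g0 : field_L1 D g0 ->
  exists2 z, S_infty D f z & \int[leb]_(x in D) dot (z x) (g0 x) = relaxed g0.
Proof.
move=> ig0.
have S0 : field_L1 D 0 by rewrite -(scale0r g0); exact: field_L1Z.
have SD g h : field_L1 D g -> field_L1 D h -> field_L1 D (g + h) by exact: field_L1D.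
have SZ (a : R) g : field_L1 D g -> field_L1 D (a *: g) by exact: field_L1Z.
have [l [lD lZ lp lg0]] := hahn_banach S0 SD SZ relaxed_sublinear ig0.
have l_le g : field_L1 D g -> l g <= \int[leb]_(x in D) enorm (g x).
  by move=> ig; apply: le_trans (lp g ig) (relaxed_le_norm ig).
have [z [mz z1 lE]] := field_dual lD lZ l_le.
exists z; last by rewrite -lE.
split; first by split; [move=> i; exact: measurable_funTS|by apply: field_dual_norm mz z1 lE].
have key phi : test_function D phi -> - l (grad phi) <= \int[leb]_(x in D) (f x * phi x).
  move=> tphi; have igr : field_L1 D (grad phi) by exact: field_L1_grad tphi.
  rewrite -mulN1r -lZ//; apply: le_trans (lp _ (SZ _ _ igr)) _.
  apply: le_trans (relaxed_le (SZ _ _ igr) tphi) _.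
  rewrite /energy Rintegral0_eq ?add0r// => x _.
  by rewrite [X in enorm (X + _)](scaleN1r (grad phi x)) addNr enorm0.
move=> phi tphi; have igr : field_L1 D (grad phi) by exact: field_L1_grad tphi.
rewrite -lE//; apply/eqP; rewrite eq_le; apply/andP; split; last first.
  by rewrite lerNl; exact: key.
have := key _ (test_functionZ (-1) tphi).
rewrite (_ : grad _ = -1 *: grad phi); last first.
  by apply/funext => x; rewrite gradZ//; exact: test_function_smooth tphi.
rewrite lZ// mulN1r opprK; move=> /le_trans; apply.
rewrite -[leRHS]mulN1r -RintegralZl//; last exact: f_test_integrable.
by rewrite le_eqVlt; apply/orP; left; apply/eqP/eq_Rintegral => x _; rewrite mulrCA.
Qed.

End dual_problem.

Section competitor.
Context {R : realType} {n : nat}.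
Local Notation leb := (@lebesgue_rV R n).
Variables (D Ds : set 'rV[R]_n) (f u0 : 'rV[R]_n -> R) (g0 : 'rV[R]_n -> 'rV[R]_n).
Hypothesis D_open : open D.
Hypothesis Ds_open : open Ds.
Hypothesis DDs : closure D `<=` Ds.
Hypothesis bD0 : leb (closure D `\` D) = 0%E.
Hypothesis u0_W11 : in_W11 Ds u0 g0.
Hypothesis u0_L2 : in_L2 Ds u0.

Let mD : measurable D. Proof. exact: mx_open_measurable. Qed.
Let mDs : measurable Ds. Proof. exact: mx_open_measurable. Qed.
Let D_Ds : D `<=` Ds. Proof. by move=> x Dx; apply: DDs; exact: subset_closure. Qed.
Let mcD : measurable (closure D). Proof. exact: closure_measurable. Qed.

(** The derivative of [u0 + phi] has a density, so its variation on [closure D] is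
    an integral, to which the null boundary of [D] does not contribute. *)
Lemma smooth_competitor phi : test_function D phi -> exists u nu,
  [/\ in_BV_dirichlet D Ds u0 u nu, in_L2 Ds u &
      (vmeasure_variation nu (closure D) + (\int[leb]_(x in D) (f x * (u x - u0 x)))%:E <=
       (energy D f g0 phi)%:E)%E].
Proof.
move=> tphi; have [iu0 ig0 u0P] := u0_W11; have [mu0 iu02] := u0_L2.
have sphi := test_function_smooth tphi.
have [M HM] := test_function_support tphi.
have iphi E : measurable E -> leb.-integrable E (EFin \o phi).
  move=> mE; apply: (integrableS measurableT mE (@subsetT _ _)).
  by apply: continuous_support_integrable HM; exact: smooth_continuous.
pose G i x := (g0 x 0 i + partial i phi x) * \1_Ds x.
have iG0 i : leb.-integrable Ds (EFin \o (fun x => g0 x 0 i + partial i phi x)).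
  by apply: integrableD_EFin => //; [exact: ig0|exact: partial_in_L1 tphi].
have iG i : leb.-integrable setT (EFin \o G i) by apply/(integrable_mul_indic _ _ mDs); exact: iG0.
exists (fun x => u0 x + phi x), (fun i => induced_charge (iG i)); split.
- split; last first.
    by apply: aeW => x [_ nD]; rewrite (test_function_out tphi nD) addr0.
  split; first by apply: integrableD_EFin => //; exact: iphi.
  move=> psi tpsi i; have spsi := test_function_smooth tpsi.
  have [C HC] := test_function_bounded tpsi; have [C' HC'] := partial_bounded i tpsi.
  have mpsi : measurable_fun Ds psi by apply: measurable_funTS; exact: smooth_measurable.
  have mdpsi : measurable_fun Ds (partial i psi).
    by apply: measurable_funTS; exact: partial_measurable.
  rewrite (charge_Rintegral_induced (iG i) mDs mpsi (fun x _ => HC x)).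
  rewrite (_ : \int[leb]_(x in Ds) (G i x * psi x) =
      \int[leb]_(x in Ds) (g0 x 0 i * psi x + partial i phi x * psi x)); last first.
    apply: eq_Rintegral => x /set_mem xDs.
    by rewrite /G indicE (mem_set xDs) mulr1 mulrDl.
  have ip : leb.-integrable Ds (EFin \o partial i phi) by exact: partial_in_L1 tphi.
  have j1 := integrableM_bounded mDs (ig0 i) mpsi (fun x _ => HC x).
  have j2 := integrableM_bounded mDs ip mpsi (fun x _ => HC x).
  have j3 := integrableM_bounded mDs iu0 mdpsi (fun x _ => HC' x).
  have j4 := integrableM_bounded mDs (iphi _ mDs) mdpsi (fun x _ => HC' x).
  rewrite RintegralD// opprD -u0P//.
  rewrite (_ : - (\int[leb]_(x in Ds) (partial i phi x * psi x)) =
      \int[leb]_(x in Ds) (phi x * partial i psi x)).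
    by rewrite -RintegralD//; apply: eq_Rintegral => x _; rewrite mulrDl.
  rewrite 2!(Rintegral_indic _ Ds).
  transitivity (- \int[leb]_x (partial i phi x * psi x)).
    congr (- _); apply: eq_Rintegral => x _; rewrite indicE.
    have [xD|xD] := pselect (Ds x); first by rewrite (mem_set xD) mulr1.
    by rewrite (test_function_out tpsi xD) mulr0 mul0r.
  rewrite -(test_by_parts i tphi tpsi); apply: eq_Rintegral => x _; rewrite indicE.
  have [xD|xD] := pselect (Ds x); first by rewrite (mem_set xD) mulr1.
  by rewrite (test_function_out tphi) ?mul0r// => /D_Ds.
- have mphi : measurable_fun Ds phi by apply: measurable_funTS; exact: smooth_measurable.
  split; first exact: measurable_funD.
  have iphi2 : leb.-integrable Ds (EFin \o (fun x => phi x ^+ 2)).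
    apply: (integrableS measurableT mDs (@subsetT _ _)).
    apply: (continuous_support_integrable (M := M)).
      by apply: smooth_continuous; apply: smoothM.
    by move=> x /HM ->; rewrite expr0n.
  have i2 : leb.-integrable Ds (EFin \o (fun x => 2 * u0 x ^+ 2 + 2 * phi x ^+ 2)).
    by apply: integrableD_EFin => //; exact: integrableZ_EFin.
  apply: (dominated_integrable mDs _ i2) => [|x _].
    by apply: measurable_funX; exact: measurable_funD.
  rewrite ger0_norm ?sqr_ge0//; have := sqr_ge0 (u0 x - phi x); nra.
- rewrite /energy EFinD; apply: leeD; last first.
    rewrite lee_fin le_eqVlt; apply/orP; left; apply/eqP/eq_Rintegral => x _.
    by rewrite addrAC subrr add0r.
  apply: le_trans (variation_density_le iG mcD) _; rewrite lee_fin.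
  have igD : field_L1 (closure D) (fun x => g0 x + grad phi x).
    move=> i; apply: (integrableS mDs) => //.
    rewrite (_ : (fun x => _) = (fun x => g0 x 0 i + partial i phi x))//.
    by apply/funext => x; rewrite !mxE.
  have iE := enorm_in_L1 mcD igD.
  rewrite (_ : \int[leb]_(x in closure D) _ = \int[leb]_(x in closure D) enorm (g0 x + grad phi x)); last first.
    apply: eq_Rintegral => x /set_mem /DDs xDs; congr enorm; apply/rowP => i.
    by rewrite !mxE /G indicE (mem_set xDs) mulr1.
  have mE : measurable_fun (closure D) (fun x => enorm (g0 x + grad phi x)).
    exact: integrable_measurable iE.
  rewrite (Rintegral_indic _ (closure D)) (Rintegral_indic _ D) le_eqVlt; apply/orP; left; apply/eqP.
  apply: Rintegral_ae_eq => //.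
  + exact: measurable_mul_indic.
  + by apply: measurable_mul_indic => //; apply: measurable_funS mE => //; exact: subset_closure.
  exists (closure D `\` D); split => //; first exact: measurableD.
  move=> x /= H; apply: contrapT => nb; apply: H => _; congr (_ * _); rewrite !indicE.
  have [xD|xD] := pselect (D x); first by rewrite (mem_set xD) (mem_set (subset_closure xD)).
  rewrite (memNset xD) memNset// => cx; exact: nb.
Qed.

End competitor.

Theorem theorem5p3 (R : realType) (n : nat) (n_gt0 : (0 < n)%N)
    (Omega Omegas : set 'rV[R]_n)
    (Omega_bounded : bounded_set Omega) (Omega_lip : lipschitz_domain Omega)
    (Omegas_lip : lipschitz_domain Omegas)
    (Omega_Omegas : closure Omega `<=` Omegas)
    (f : 'rV[R]_n -> R) (f_L2 : in_L2 Omega f) (f_dual : in_Wdual_ball Omega f)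
    (u0 : 'rV[R]_n -> R) (grad_u0 : 'rV[R]_n -> 'rV[R]_n)
    (u0_W11 : in_W11 Omegas u0 grad_u0) (u0_L2 : in_L2 Omegas u0) :
  exists2 z, S_infty Omega f z &
    (forall z', S_infty Omega f z' ->
       \int[lebesgue_rV n]_(x in Omega) dot (z' x) (grad_u0 x) <=
       \int[lebesgue_rV n]_(x in Omega) dot (z x) (grad_u0 x)) /\
    ereal_inf [set e : \bar R | exists u nu,
      [/\ in_BV_dirichlet Omega Omegas u0 u nu, in_L2 Omegas u &
          e = (vmeasure_variation nu (closure Omega) +
               (\int[lebesgue_rV n]_(x in Omega) (f x * (u x - u0 x)))%:E)%E]] =
    (\int[lebesgue_rV n]_(x in Omega) dot (z x) (grad_u0 x))%:E.
Proof.
have [oO _ _ lipO] := Omega_lip; have [oOs _ _ _] := Omegas_lip.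
have cone x (cx : closure Omega x) := lipschitz_inner_cone oO lipO cx.
have bO := boundary_null oO Omega_bounded cone.
have mO : measurable Omega by exact: mx_open_measurable.
have mOs : measurable Omegas by exact: mx_open_measurable.
have ig0 : field_L1 Omega grad_u0.
  have [_ ig _] := u0_W11; move=> i; apply: (integrableS mOs mO _ (ig i)).
  by move=> x Ox; apply: Omega_Omegas; exact: subset_closure.
set X := [set e : \bar R | _].
have weak z' : S_infty Omega f z' ->
    ((\int[lebesgue_rV n]_(x in Omega) dot (z' x) (grad_u0 x))%:E <= ereal_inf X)%E.
  move=> z'S; apply: le_ereal_inf_tmp => _ [u [nu [uBV uL2 ->]]].
  exact: (weak_duality n_gt0 oO Omega_bounded cone oOs Omega_Omegas f_L2 u0_W11 u0_L2).
have [z zS zE] := dual_maximizer oO Omega_bounded f_L2 f_dual ig0.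
have inf_le : (ereal_inf X <= (relaxed Omega f grad_u0)%:E)%E.
  apply/lee_addgt0Pr => e e0.
  have hinf : has_inf [set energy Omega f grad_u0 phi | phi in test_function Omega].
    split; first by exists (energy Omega f grad_u0 (fun=> 0)), (fun=> 0) => //; exact: test_function0.
    exists (- (\int[lebesgue_rV n]_(x in Omega) enorm (grad_u0 x))) => _ [phi tphi <-].
    exact: energy_ge.
  have [_ [phi tphi <-] lt] := inf_adherent e0 hinf.
  have [u [nu [uBV uL2 le]]] := smooth_competitor f oO oOs Omega_Omegas bO u0_W11 u0_L2 tphi.
  apply: (@le_trans _ _ (energy Omega f grad_u0 phi)%:E); last by rewrite -EFinD lee_fin ltW.
  by apply: le_trans le; apply: ereal_inf_lbound; exists u, nu.
have infE : ereal_inf X = (\int[lebesgue_rV n]_(x in Omega) dot (z x) (grad_u0 x))%:E.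
  by apply/eqP; rewrite eq_le weak// andbT zE.
exists z => //; split => // z' z'S.
by rewrite -lee_fin -infE weak.
Qed.
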